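(* Let $p>2$, $f\ge1$, $q=p^f$, $k=(k_0,\dots,k_{f-1})$ with $r_i=k_i-2>q+p-2$ for all $i$, and suppose $r=\sum_ir_ip^i\equiv p^h\pmod{q-1}$ for some $0\le h\le f-1$. Let $a_p$ lie in a finite extension of $\mathbb{Q}_{p^f}$ with $v(a_p)\in(0,1)$. Assume that either $v(a_p)\neq\frac12$, or $v(a_p)=\frac12$ and $\frac{a_p^2-pr_h}{p}$ is a $p$-adic unit. Then the natural surjection $\mathrm{ind}_{KZ}^G\mathrm{cosoc}(Q)\twoheadrightarrow F_t$ vanishes on $T(\mathrm{ind}_{KZ}^G\mathrm{cosoc}(Q))$, i.e. it factors through $T$.
   Context: Setting: $\mathbb{Q}_{p^f}$ unramified of degree $f$ over $\mathbb{Q}_p$, ring of integers $\mathbb{Z}_{p^f}$, residue field $\mathbb F_q$, Teichmüller lifts $[\lambda]$; $G=\mathrm{GL}_2(\mathbb{Q}_{p^f})$, $K=\mathrm{GL}_2(\mathbb{Z}_{p^f})$, $Z$ the center, $\Gamma=\mathrm{GL}_2(\mathbb F_q)$, $v(p)=1$. For a ring $R$, $V(R)=\bigotimes_{i=0}^{f-1}\mathrm{Sym}^{r_i}R^2$ is modeled on polynomials homogeneous of degree $r_i$ in $(X_i,Y_i)$; $\begin{pmatrix}a&b\\c&d\end{pmatrix}\in K$ acts by $v\mapsto v(a^{\sigma^i}X_i+c^{\sigma^i}Y_i,b^{\sigma^i}X_i+d^{\sigma^i}Y_i)$ ($\sigma$ Frobenius), $p\in Z$ acts trivially. $[g,v]\in\mathrm{ind}_{KZ}^GV$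 is supported on $KZg^{-1}$ with $g'\mapsto g'g\cdot v$. Hecke operator: $T([g,v])=\sum_{\lambda\in\mathbb F_q}[g\begin{pmatrix}p&[\lambda]\\0&1\end{pmatrix},v(X_i,(-[\lambda])^{p^i}X_i+pY_i)]+[g\begin{pmatrix}1&0\\0&p\end{pmatrix},v(pX_i,Y_i)]$; on the induction of a mod $p$ weight $\bigotimes\mathrm{Sym}^{s_i}\bar{\mathbb F}_p^2\otimes\det^m$, $T$ is given by the reduced formula $T([g,v])=\sum_\lambda[g\begin{pmatrix}p&[\lambda]\\0&1\end{pmatrix},v(X_i,(-\lambda)^{p^i}X_i)]+[g\begin{pmatrix}1&0\\0&p\end{pmatrix},v(0,Y_i)]$. For $a_p$ in a finite extension $E$ of $\mathbb{Q}_{p^f}$ (ring of integers $\mathcal O_E$, residue field $k_E$): $\Pi_{k,a_p}=\mathrm{ind}_{KZ}^GV(E)/(T-a_p)$, $\Theta_{k,a_p}$ = image of $\mathrm{ind}_{KZ}^GV(\mathcal O_E)$ in it, $\bar\Theta_{k,a_p}=\Theta_{k,a_p}\otimes k_E$; there is a natural surjection $\mathrm{ind}_{KZ}^GV_r\twoheadrightarrow\bar\Theta_{k,a_p}$ with $V_r=V(\bar{\mathbb F}_p)$. Let $\theta_i=X_iY_{i-1}^p-Y_iX_{i-1}^p$ (indices mod $f$), $V_r^*$ the subspace of $V_r$ of elements $\sum_i\theta_iP_i$, $X_r$ the $\Gamma$-submodule generated by $\prod_iX_i^{r_i}$, and $Q=V_r/(V_r^*+X_r)$; under the hypotheses the surjection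 factors through $\mathrm{ind}_{KZ}^GQ\twoheadrightarrow\bar\Theta_{k,a_p}$. Let $Q_1=\mathrm{soc}(Q)\subset Q_2\subset\cdots$ be the socle filtration ($Q_{i+1}/Q_i=\mathrm{soc}(Q/Q_i)$), with $Q_f=Q$ as in the paper, $\mathrm{cosoc}(Q):=Q_f/Q_{f-1}$, $F_i$ the image of $\mathrm{ind}_{KZ}^GQ_i$ in $\bar\Theta_{k,a_p}$, and $F_t=F_f/F_{f-1}$; the map $\mathrm{ind}_{KZ}^G\mathrm{cosoc}(Q)\twoheadrightarrow F_t$ is the induced surjection. *)

(* Defs.v *)
From HB Require Import structures.
From mathcomp Require Import all_boot all_order all_algebra all_field.
From mathcomp Require Import ring_quotient ring.
From mathcomp Require Import boolp functions.
From mathcomp Require Import freeg mpoly.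

Set Implicit Arguments.
Unset Strict Implicit.
Unset Printing Implicit Defensive.

Import Order.TTheory GRing.Theory Num.Theory.
Local Open Scope ring_scope.
Local Open Scope quotient_scope.

Record submodule (R : nzRingType) (V : lmodType R) := Submodule {
  smem :> V -> Prop;
  smem0 : smem 0;
  smemP : forall a x y, smem x -> smem y -> smem (a *: x + y) }.

Section Submodules.
Variables (R : nzRingType) (V : lmodType R).
Implicit Types N : submodule V.

Definition spanned (S : V -> Prop) (x : V) : Prop :=
  forall N, (forall y, S y -> N y) -> N x.

Lemma spanned0 S : spanned S 0.
Proof. by move=> N _; apply: smem0. Qed.

Lemma spannedP S a x y : spanned S x -> spanned S y -> spanned S (a *: x + y).
Proof. by move=> hx hy N hN; apply: smemP; [apply: hx | apply: hy]. Qed.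

Definition lspan S : submodule V := Submodule (@spanned0 S) (@spannedP S).

Lemma mem_lspan (S : V -> Prop) x : S x -> lspan S x.
Proof. by move=> Sx N; apply. Qed.

Lemma smemD N x y : N x -> N y -> N (x + y).
Proof. by move=> hx hy; rewrite -[x]scale1r; apply: smemP. Qed.

Lemma smemZ N a x : N x -> N (a *: x).
Proof. by move=> hx; rewrite -[_ *: _]addr0; apply: smemP => //; apply: smem0. Qed.

Definition smem_pred N : {pred V} := fun x => `[< N x >].

Lemma smem_predP N x : reflect (N x) (x \in smem_pred N).
Proof. exact: asboolP. Qed.

Lemma smem_pred_closed N : submod_closed (smem_pred N).
Proof.
split=> [|a x y /smem_predP hx /smem_predP hy]; apply/smem_predP.
  exact: smem0.
exact: smemP.
Qed.

HB.instance Definition _ N :=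
  GRing.isSubmodClosed.Build R V (smem_pred N) (smem_pred_closed N).

Definition submod N := {x : V | x \in smem_pred N}.

HB.instance Definition _ N := SubChoice.on (submod N).
HB.instance Definition _ N := [SubChoice_isSubLmodule of submod N by <:].

Definition quotmod N := Quotient.quot (smem_pred N).

HB.instance Definition _ N := GRing.Zmodule.on (quotmod N).

Section Scale.
Variable N : submodule V.
Local Notation Q := (quotmod N).

Definition qclass (x : V) : Q := \pi_(Quotient.quot (smem_pred N)) x.

Lemma qclass_eq x y : qclass x = qclass y <-> N (x - y).
Proof.
split=> [/eqP|]; first by rewrite -Quotient.idealrBE => /smem_predP.
by move=> h; apply/eqP; rewrite -Quotient.idealrBE; apply/smem_predP.
Qed.

Lemma qclass_repr (x : Q) : qclass (repr x) = x.
Proof. exact: reprK. Qed.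

Lemma qclassD : {morph qclass : x y / x + y}.
Proof. by move=> x y; rewrite /qclass !piE. Qed.

Definition qlift (T : Type) (g : V -> T) (x : Q) : T := g (repr x).

Definition qscale (a : R) : Q -> Q := qlift (fun x => qclass (a *: x)).

Lemma qscaleE a x : qscale a (qclass x) = qclass (a *: x).
Proof.
apply/qclass_eq; rewrite -scalerBr; apply: smemZ.
by apply/qclass_eq; rewrite qclass_repr.
Qed.

Lemma qscaleA a b (v : Q) : qscale a (qscale b v) = qscale (a * b) v.
Proof. by rewrite -[v]qclass_repr !qscaleE scalerA. Qed.

Lemma qscale1 : left_id 1 qscale.
Proof. by move=> v; rewrite -[v]qclass_repr qscaleE scale1r. Qed.

Lemma qscaleDr : right_distributive qscale +%R.
Proof.
move=> a u v; rewrite -[u]qclass_repr -[v]qclass_repr -qclassD !qscaleE.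
by rewrite scalerDr qclassD.
Qed.

Lemma qscaleDl v : {morph qscale^~ v : a b / a + b}.
Proof. by move=> a b; rewrite -[v]qclass_repr !qscaleE scalerDl qclassD. Qed.

HB.instance Definition _ :=
  GRing.Zmodule_isLmodule.Build R Q qscaleA qscale1 qscaleDr qscaleDl.

Lemma qclass_linear : linear qclass.
Proof. by move=> a x y; rewrite qclassD; congr (_ + _); rewrite -qscaleE. Qed.

HB.instance Definition _ :=
  GRing.isLinear.Build R V Q _ qclass qclass_linear.

End Scale.
End Submodules.

Section Image.
Variables (R : nzRingType) (U V : lmodType R) (u : {linear U -> V}).

Definition image_mem (N : submodule U) (y : V) : Prop :=
  exists2 x, N x & u x = y.

Lemma image_mem0 N : image_mem N 0.
Proof. by exists 0; [apply: smem0 | rewrite linear0]. Qed.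

Lemma image_memP N a x y :
  image_mem N x -> image_mem N y -> image_mem N (a *: x + y).
Proof.
move=> [x' hx <-] [y' hy <-]; exists (a *: x' + y'); first exact: smemP.
by rewrite linearP.
Qed.

Definition lin_image N : submodule V := Submodule (image_mem0 N) (@image_memP N).

Definition preimage_mem (N : submodule V) (x : U) : Prop := N (u x).

Lemma preimage_mem0 N : preimage_mem N 0.
Proof. by rewrite /preimage_mem linear0; apply: smem0. Qed.

Lemma preimage_memP N a x y :
  preimage_mem N x -> preimage_mem N y -> preimage_mem N (a *: x + y).
Proof. by move=> hx hy; rewrite /preimage_mem linearP; apply: smemP. Qed.

Definition lin_preim N : submodule U :=
  Submodule (preimage_mem0 N) (@preimage_memP N).

End Image.

Definition full_sub (R : nzRingType) (V : lmodType R) : submodule V :=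
  @Submodule _ V (fun=> True) I (fun _ _ _ _ _ => I).

Definition restr (A B : nzRingType) (phi : {rmorphism A -> B})
  (M : lmodType B) : Type := M.

Section Restriction.
Variables (A B : nzRingType) (phi : {rmorphism A -> B}) (M : lmodType B).
Local Notation rM := (restr phi M).

HB.instance Definition _ := GRing.Zmodule.on rM.

Definition rscale (a : A) (x : rM) : rM := phi a *: (x : M).

Lemma rscaleA a b x : rscale a (rscale b x) = rscale (a * b) x.
Proof. by rewrite /rscale scalerA rmorphM. Qed.

Lemma rscale1 : left_id 1 rscale.
Proof. by move=> x; rewrite /rscale rmorph1 scale1r. Qed.

Lemma rscaleDr : right_distributive rscale +%R.
Proof. by move=> a x y; rewrite /rscale scalerDr. Qed.

Lemma rscaleDl x : {morph rscale^~ x : a b / a + b}.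
Proof. by move=> a b; rewrite /rscale rmorphD scalerDl. Qed.

HB.instance Definition _ :=
  GRing.Zmodule_isLmodule.Build A rM rscaleA rscale1 rscaleDr rscaleDl.

End Restriction.

(* M (x)_A B: the free B-module on the elements of M modulo the relations     *)
(* making m |-> m (x) 1 additive and A-linear along phi.                      *)
Section BaseChange.
Variables (A B : comNzRingType) (phi : {rmorphism A -> B}) (M : lmodType A).

Definition free_elt (m : M) : {freeg M / B} := << m >>.

Definition base_change_rel (z : {freeg M / B}) : Prop :=
  (exists m n, z = free_elt (m + n) - free_elt m - free_elt n) \/
  (exists a m, z = free_elt (a *: m) - phi a *: free_elt m).

Definition base_change : lmodType B := quotmod (lspan base_change_rel).

Definition tensor1 (m : M) : base_change := qclass _ (free_elt m).
End BaseChange.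

Definition GL2 (R : comUnitRingType) := {g : 'M[R]_2 | g \in unitmx}.

HB.instance Definition _ (R : comUnitRingType) := SubChoice.on (GL2 R).

Section GL2Group.
Variable R : comUnitRingType.
Implicit Types g h : GL2 R.

Lemma GL2_mul_unit g h : val g *m val h \in unitmx.
Proof. by rewrite unitmx_mul (valP g) (valP h). Qed.

Lemma GL2_inv_unit g : invmx (val g) \in unitmx.
Proof. by rewrite unitmx_inv (valP g). Qed.

Definition GL2_mul g h : GL2 R := Sub (val g *m val h) (GL2_mul_unit g h).
Definition GL2_inv g : GL2 R := Sub (invmx (val g)) (GL2_inv_unit g).
Definition GL2_one : GL2 R := Sub 1%:M (unitmx1 R 2).

Lemma GL2_mulA : associative GL2_mul.
Proof. by move=> g h l; apply/val_inj; rewrite /= mulmxA. Qed.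

Lemma GL2_mul1g : left_id GL2_one GL2_mul.
Proof. by move=> g; apply/val_inj; rewrite /= mul1mx. Qed.

Lemma GL2_mulg1 : right_id GL2_one GL2_mul.
Proof. by move=> g; apply/val_inj; rewrite /= mulmx1. Qed.

Lemma GL2_mulVg : left_inverse GL2_one GL2_inv GL2_mul.
Proof. by move=> g; apply/val_inj; rewrite /= mulVmx // (valP g). Qed.

Lemma GL2_mulgV : right_inverse GL2_one GL2_inv GL2_mul.
Proof. by move=> g; apply/val_inj; rewrite /= mulmxV // (valP g). Qed.

HB.instance Definition _ :=
  isGroup.Build (GL2 R) GL2_mulA GL2_mul1g GL2_mulg1 GL2_mulVg GL2_mulgV.

End GL2Group.

Definition mx2 (R : nzRingType) (a b c d : R) : 'M[R]_2 :=
  \matrix_(i, j) if i == 0 then (if j == 0 then a else b)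
                 else (if j == 0 then c else d).

Lemma det_mx2 (R : comNzRingType) (a b c d : R) :
  \det (mx2 a b c d) = a * d - b * c.
Proof.
rewrite (expand_det_row _ ord0) !big_ord_recl big_ord0 addr0.
rewrite /cofactor !det_mx11 !mxE /= expr0 expr1.
by rewrite mul1r mulN1r mulrN.
Qed.

Record rep (O : comUnitRingType) (R : comNzRingType) := Rep {
  rep_mod :> lmodType R;
  act : GL2 O -> {linear rep_mod -> rep_mod};
  act1 : forall x, act 1%g x = x;
  actM : forall k l x, act (k * l)%g x = act k (act l x) }.

Arguments act {O R r} k.

Section Representations.
Variables (O : comUnitRingType) (R : comNzRingType).
Implicit Types M : rep O R.

Record subrep M := Subrep {
  subrep_sub :> submodule M;
  subrep_act : forall k x, subrep_sub x -> subrep_sub (act k x) }.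

Definition orbit_of M (S : M -> Prop) (y : M) : Prop :=
  exists k x, S x /\ y = act k x.

Lemma genrep_act M (S : M -> Prop) k x :
  lspan (orbit_of S) x -> lspan (orbit_of S) (act k x).
Proof.
move=> hx; apply: (hx (lin_preim (act k) (lspan (orbit_of S)))).
move=> _ [l [y [Sy ->]]]; rewrite /= /preimage_mem -actM.
by apply: mem_lspan; exists (k * l)%g, y.
Qed.

Definition genrep M (S : M -> Prop) : subrep M := Subrep (@genrep_act M S).

Definition zero_sub M : subrep M := genrep (fun _ : M => False).

Lemma add_sub_act M (N1 N2 : subrep M) k x :
  lspan (fun x => N1 x \/ N2 x) x -> lspan (fun x => N1 x \/ N2 x) (act k x).
Proof.
move=> hx; apply: (hx (lin_preim (act k) (lspan (fun x => N1 x \/ N2 x)))).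
move=> y Ny; apply: mem_lspan.
by case: Ny => Ny; [left | right]; apply: subrep_act.
Qed.

Definition add_sub M (N1 N2 : subrep M) : subrep M :=
  Subrep (@add_sub_act M N1 N2).

Section SubRep.
Variables (M : rep O R) (N : subrep M).

Lemma sub_act_subproof k (x : submod N) : act k (val x) \in smem_pred N.
Proof. by apply/smem_predP/subrep_act/smem_predP/valP. Qed.

Definition sub_act k (x : submod N) : submod N :=
  Sub (act k (val x)) (sub_act_subproof k x).

Lemma sub_act_linear k : linear (sub_act k).
Proof. by move=> a x y; apply/val_inj; rewrite /= linearP. Qed.

HB.instance Definition _ k :=
  GRing.isLinear.Build R (submod N) (submod N) _ (sub_act k) (sub_act_linear k).

Lemma sub_act1 x : sub_act 1%g x = x.
Proof. by apply/val_inj; rewrite /= act1. Qed.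

Lemma sub_actM k l x : sub_act (k * l)%g x = sub_act k (sub_act l x).
Proof. by apply/val_inj; rewrite /= actM. Qed.

Definition sub_rep : rep O R :=
  @Rep O R (submod N) (fun k => sub_act k) sub_act1 sub_actM.

End SubRep.

Section QuotRep.
Variables (M : rep O R) (N : subrep M).

Definition quot_act k : quotmod N -> quotmod N :=
  qlift (fun x => qclass N (act k x)).

Lemma quot_actE k x : quot_act k (qclass N x) = qclass N (act k x).
Proof.
apply/qclass_eq; rewrite -linearB; apply: subrep_act.
by apply/qclass_eq; rewrite qclass_repr.
Qed.

Lemma quot_act_linear k : linear (quot_act k).
Proof.
move=> a x y; rewrite -[x]qclass_repr -[y]qclass_repr -linearP !quot_actE.
by rewrite !linearP.
Qed.

HB.instance Definition _ k := GRing.isLinear.Build R (quotmod N) (quotmod N) _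
  (quot_act k) (quot_act_linear k).

Lemma quot_act1 x : quot_act 1%g x = x.
Proof. by rewrite -[x]qclass_repr quot_actE act1. Qed.

Lemma quot_actM k l x : quot_act (k * l)%g x = quot_act k (quot_act l x).
Proof. by rewrite -[x]qclass_repr !quot_actE actM. Qed.

Definition quot_rep : rep O R :=
  @Rep O R (quotmod N) (fun k => quot_act k) quot_act1 quot_actM.

Lemma preim_quot_act (S : subrep quot_rep) k x :
  lin_preim (qclass N) S x -> lin_preim (qclass N) S (act k x).
Proof.
move=> Sx; have := subrep_act (s := S) k Sx.
by rewrite /= /preimage_mem quot_actE.
Qed.

Definition preim_quot (S : subrep quot_rep) : subrep M :=
  Subrep (@preim_quot_act S).

End QuotRep.

Definition simple_sub M (S : subrep M) : Prop :=
  (exists2 x, S x & x != 0) /\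
  forall S' : subrep M, (forall x, S' x -> S x) ->
    (forall x, S' x -> x = 0) \/ (forall x, S x -> S' x).

Definition soc M : subrep M :=
  genrep (fun x => exists2 S : subrep M, simple_sub S & S x).

Fixpoint socfil M (n : nat) : subrep M :=
  if n is n'.+1 then preim_quot (soc (quot_rep (socfil M n'))) else zero_sub M.

End Representations.

(* Additive equivariant maps; the coefficient rings may differ, so that       *)
(* reduction of coefficients is covered.                                      *)
Record equivar (O : comUnitRingType) (R R' : comNzRingType)
    (M : rep O R) (N : rep O R') := Equivar {
  equivar_fun :> {additive M -> N};
  equivar_act : forall k x, equivar_fun (act k x) = act k (equivar_fun x) }.

Section QuotSubMaps.
Variables (O : comUnitRingType) (R : comNzRingType) (M : rep O R).

Lemma qclass_act (N : subrep M) k x :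
  qclass N (act k x) = act (r := quot_rep N) k (qclass N x).
Proof. by rewrite /= quot_actE. Qed.

Definition quot_proj (N : subrep M) : equivar M (quot_rep N) :=
  @Equivar O R R M (quot_rep N) (qclass N) (@qclass_act N).

Definition sub_incl (N : subrep M) : equivar (sub_rep N) M :=
  @Equivar O R R (sub_rep N) M (\val : submod N -> M) (fun k x => erefl).

Definition res_sub_mem (N S : subrep M) : submodule (sub_rep N) :=
  lin_preim (\val : submod N -> M) S.

Lemma res_sub_act (N S : subrep M) k x :
  res_sub_mem N S x -> res_sub_mem N S (act k x).
Proof. by move=> Sx; apply: (@subrep_act _ _ _ S). Qed.

(* S viewed inside N, that is the intersection of S and N. *)
Definition res_sub (N S : subrep M) : subrep (sub_rep N) :=
  Subrep (@res_sub_act N S).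

End QuotSubMaps.

(* Q_n / Q_(n-1) for the socle filtration Q_0 = 0 < Q_1 = soc Q < ... *)
Definition soclayer (O : comUnitRingType) (R : comNzRingType) (Q : rep O R) n :
    rep O R :=
  quot_rep (res_sub (socfil Q n) (socfil Q n.-1)).

(* Additive valuations; the value at 0 is irrelevant. *)
Record valuation (K : fieldType) := Valuation {
  vfun :> K -> rat;
  vfunM : forall x y, x != 0 -> y != 0 -> vfun (x * y) = vfun x + vfun y;
  vfunD : forall x y, x != 0 -> y != 0 -> x + y != 0 ->
    Num.min (vfun x) (vfun y) <= vfun (x + y) }.

Section ValuationRing.
Variables (K : fieldType) (v : valuation K).

Definition vge (c : rat) (x : K) : bool := (x == 0) || (c <= v x).
Definition vgt (c : rat) (x : K) : bool := (x == 0) || (c < v x).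

Lemma v1 : v 1 = 0.
Proof.
have := @vfunM _ v 1 1 (oner_neq0 _) (oner_neq0 _); rewrite mulr1 => /eqP.
by rewrite -{1}[v 1]addr0 (inj_eq (addrI _)) => /eqP.
Qed.

Lemma vN1 : v (-1) = 0.
Proof.
have N1 : -1 != 0 :> K by rewrite oppr_eq0 oner_neq0.
have := @vfunM _ v _ _ N1 N1; rewrite mulrNN mulr1 v1 => /esym/eqP.
by rewrite -mulr2n mulrn_eq0 /= => /eqP.
Qed.

Lemma vV x : x != 0 -> v x^-1 = - v x.
Proof.
move=> nx; apply/eqP; rewrite -addr_eq0 addrC -vfunM ?invr_eq0 //.
by rewrite divff // v1.
Qed.

Lemma vfunX x n : x != 0 -> v (x ^+ n) = v x *+ n.
Proof.
move=> nx; elim: n => [|n IH]; first by rewrite expr0 v1.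
by rewrite exprS vfunM ?expf_neq0 // IH mulrS.
Qed.

Lemma vfunXz x (n : int) : x != 0 -> v (x ^ n) = v x *~ n.
Proof.
move=> nx; case: n => n; first by rewrite -exprnP -pmulrn vfunX.
by rewrite NegzE -exprnN vV ?expf_neq0 // vfunX // mulrNz pmulrn.
Qed.

Definition intring_pred : {pred K} := vge 0.

Lemma intring_closed : subring_closed intring_pred.
Proof.
rewrite /intring_pred; split; rewrite ?unfold_in /vge.
- by rewrite v1 lexx orbT.
- move=> x y; rewrite ![_ \in _]unfold_in.
  have [->|nx] /= := eqVneq x 0; have [->|ny] /= := eqVneq y 0 => hx hy.
  + by rewrite subr0 eqxx.
  + by rewrite sub0r -mulN1r vfunM ?oppr_eq0 ?oner_neq0 // vN1 add0r hy orbT.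
  + by rewrite subr0 hx orbT.
  have [//|nxy /=] := eqVneq (x - y) 0.
  have ny' : - y != 0 by rewrite oppr_eq0.
  apply: le_trans (vfunD v nx ny' nxy).
  rewrite le_min hx -mulN1r vfunM ?oppr_eq0 ?oner_neq0 //.
  by rewrite vN1 add0r hy.
move=> x y; rewrite ![_ \in _]unfold_in.
have [->|nx] /= := eqVneq x 0; first by rewrite mul0r eqxx.
have [->|ny] /= := eqVneq y 0; first by rewrite mulr0 eqxx.
by move=> hx hy; rewrite vfunM // addr_ge0 ?orbT.
Qed.

HB.instance Definition _ :=
  GRing.isSubringClosed.Build K intring_pred intring_closed.

Definition intring := {x : K | x \in intring_pred}.

HB.instance Definition _ := SubChoice.on intring.
HB.instance Definition _ := [SubChoice_isSubComNzRing of intring by <:].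

Definition int_unit : {pred intring} :=
  [pred x | (val x != 0) && (v (val x) == 0)].

Lemma int_inv_subproof (x : intring) : x \in int_unit ->
  (val x)^-1 \in intring_pred.
Proof.
rewrite inE => /andP[nx /eqP vx].
by rewrite unfold_in /= /vge invr_eq0 vV // vx oppr0 lexx orbT.
Qed.

Definition int_inv (x : intring) : intring :=
  if boolP (x \in int_unit) is AltTrue h
  then Sub (val x)^-1 (int_inv_subproof h) else x.

Lemma int_mulVr : {in int_unit, left_inverse 1 int_inv *%R}.
Proof.
move=> x ux; apply/val_inj; rewrite /int_inv /=.
case: {-}_ / boolP => [h|]; last by rewrite ux.
by rewrite /= mulVf //; move: ux; rewrite inE => /andP[].
Qed.

Lemma int_unitP (x y : intring) : y * x = 1 -> int_unit x.
Proof.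
move=> /(congr1 val) /= yx; have := oner_neq0 K; rewrite -yx mulf_eq0 negb_or.
case/andP=> ny nx; apply/andP; split=> //.
have := vfunM v ny nx; rewrite yx v1 => /esym/eqP; rewrite addr_eq0 => /eqP vyx.
have := valP x; have := valP y; rewrite ![_ \in _]unfold_in /vge.
rewrite (negPf nx) (negPf ny) /= vyx oppr_ge0 => h1 h2.
by apply/eqP/le_anti; rewrite h1 h2.
Qed.

Lemma int_inv_out : {in [predC int_unit], int_inv =1 id}.
Proof.
move=> x; rewrite inE => ux; rewrite /int_inv.
by case: {-}_ / boolP => // h; rewrite h in ux.
Qed.

HB.instance Definition _ := GRing.ComNzRing_hasMulInverse.Build intring
  int_mulVr int_unitP int_inv_out.

End ValuationRing.

(* K is the completion of the field of rationals for the p-adic valuation. *)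
Record is_Qp (p : nat) (K : fieldType) (v : valuation K) : Prop := IsQp {
  Qp_nat : forall n, (0 < n)%N -> n%:R != 0 :> K /\ v n%:R = (logn p n)%:R;
  Qp_dense : forall (x : K) (N : nat), exists a : rat,
    vge v N%:R (x - ratr a);
  Qp_complete : forall u : nat -> K,
    (forall N : nat, exists n0, forall m n,
       (n0 <= m)%N -> (n0 <= n)%N -> vge v N%:R (u m - u n)) ->
    exists l, forall N : nat, exists n0, forall n,
       (n0 <= n)%N -> vge v N%:R (u n - l) }.

(* F is the unramified extension of Q_p of degree f (p still generates the    *)
(* maximal ideal of its ring of integers), E a finite extension of F, kbar    *)
(* an algebraic closure of the residue field of E. All valuations are         *)
(* normalized by v(p) = 1.                                                    *)
Record padic_setting (p f : nat) := PadicSetting {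
  p_prime : prime p;
  Qp : fieldType;
  vQp : valuation Qp;
  QpP : is_Qp p vQp;

  F : fieldExtType Qp;
  vF : valuation F;
  vF_Qp : forall x : Qp, x != 0 -> vF x%:A = vQp x;
  dim_F : \dim {: F} = f;
  F_unramified : forall x : F, x != 0 -> exists n : int, vF x = n%:~R;

  kF : finFieldType;
  card_kF : #|kF| = (p ^ f)%N;
  resF : {rmorphism intring vF -> kF};
  resF_surj : forall c, exists x, resF x = c;
  resF_ker : forall x, resF x = 0 <-> vgt vF 0 (val x);

  teich : kF -> intring vF;
  teichX : forall c, teich c ^+ (p ^ f) = teich c;
  res_teich : forall c, resF (teich c) = c;

  (* frob is the only endomorphism with this property: it is the            *)
  (* restriction of the Frobenius automorphism of F over Q_p                *)
  frob : {rmorphism intring vF -> intring vF};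
  frobP : forall x, resF (frob x) = resF x ^+ p;

  E : fieldExtType F;
  vE : valuation E;
  vE_F : forall x : F, x != 0 -> vE x%:A = vF x;

  kbar : closedFieldType;
  redE : {rmorphism intring vE -> kbar};
  redE_ker : forall x, redE x = 0 <-> vgt vE 0 (val x);
  kbar_alg : forall c : kbar, exists2 n, (0 < n)%N & c ^+ (p ^ n) = c }.

(* X_i and Y_i are the variables of index i and f + i. *)
Definition varX (f : nat) (R : nzRingType) (i : 'I_f) : {mpoly R[f + f]} :=
  'X_(lshift f i).
Definition varY (f : nat) (R : nzRingType) (i : 'I_f) : {mpoly R[f + f]} :=
  'X_(rshift f i).

Section Polynomials.
Variables (f : nat) (R : comNzRingType).
Local Notation P := {mpoly R[f + f]}.

Definition multihom (r : 'I_f -> nat) : {pred P} :=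
  fun v => all (fun m : 'X_{1..f + f} =>
    [forall i, (m (lshift f i) + m (rshift f i))%N == r i]) (msupp v).

Lemma multihomP r (v : P) :
  reflect (forall m : 'X_{1..f + f}, m \in msupp v ->
            forall i, (m (lshift f i) + m (rshift f i))%N = r i)
          (v \in multihom r).
Proof.
apply: (iffP allP) => h m hm; last by apply/forallP => i; rewrite h.
by move=> i; apply/eqP; move/forallP: (h m hm).
Qed.

Lemma multihom_closed r : submod_closed (multihom r).
Proof.
split=> [|a u v /multihomP hu /multihomP hv].
  by apply/multihomP => m; rewrite msupp0.
apply/multihomP => m /msuppD_le; rewrite mem_cat => /orP[/msuppZ_le|]; last first.
  exact: hv.
exact: hu.
Qed.

HB.instance Definition _ r :=
  GRing.isSubmodClosed.Build R P (multihom r) (multihom_closed r).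

Lemma multihomM r s u v : u \in multihom r -> v \in multihom s ->
  u * v \in multihom (fun i => (r i + s i)%N).
Proof.
move=> /multihomP hu /multihomP hv; apply/multihomP => m /msuppM_le.
case/allpairsP=> -[m1 m2] /= [h1 h2 ->] i.
by rewrite !mnmDE addnACA hu // hv.
Qed.

Lemma multihom1 : 1 \in multihom (fun=> 0%N).
Proof.
apply/multihomP => m; rewrite msupp1 inE => /eqP -> i.
by rewrite !mnm0E.
Qed.

Lemma multihomX r u n : u \in multihom r ->
  u ^+ n \in multihom (fun i => (r i * n)%N).
Proof.
move=> hu; elim: n => [|n IH].
  by rewrite expr0; have := multihom1; congr (_ \in multihom _); apply/funext => i;
     rewrite muln0.
rewrite exprS; have := multihomM hu IH; congr (_ \in multihom _).
by apply/funext => i; rewrite mulnS.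
Qed.

Lemma multihom_prod (I : Type) (s : seq I) (r : I -> 'I_f -> nat) (u : I -> P) :
  (forall j, u j \in multihom (r j)) ->
  \prod_(j <- s) u j \in multihom (fun i => \sum_(j <- s) r j i)%N.
Proof.
move=> hu; elim: s => [|j s IH].
  rewrite big_nil; have := multihom1; congr (_ \in multihom _).
  by apply/funext => i; rewrite big_nil.
rewrite big_cons; have := multihomM (hu j) IH; congr (_ \in multihom _).
by apply/funext => i; rewrite big_cons.
Qed.

Lemma varX_multihom i : varX R i \in multihom (fun j => (i == j)%N).
Proof.
apply/multihomP => m; rewrite msuppX inE => /eqP -> j.
by rewrite !mnm1E (inj_eq (@lshift_inj _ _)) eq_lrshift addn0.
Qed.

Lemma varY_multihom i : varY R i \in multihom (fun j => (i == j)%N).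
Proof.
apply/multihomP => m; rewrite msuppX inE => /eqP -> j.
by rewrite !mnm1E (inj_eq (@rshift_inj _ _)) eq_rlshift.
Qed.

Definition polyV (r : 'I_f -> nat) := {v : P | v \in multihom r}.

HB.instance Definition _ r := SubChoice.on (polyV r).
HB.instance Definition _ r := [SubChoice_isSubLmodule of polyV r by <:].

(* The substitution (X_i, Y_i) := (X_i, Y_i) *m A i. *)
Definition lin_forms (A : 'I_f -> 'M[R]_2) : (f + f).-tuple P :=
  [tuple match fintype.split j with
         | inl i => A i 0 0 *: varX R i + A i 1 0 *: varY R i
         | inr i => A i 0 1 *: varX R i + A i 1 1 *: varY R i
         end | j < f + f].

Definition lsubst (A : 'I_f -> 'M[R]_2) (v : P) : P := v \mPo lin_forms A.

Lemma lin_formsX A i : tnth (lin_forms A) (lshift f i) =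
  A i 0 0 *: varX R i + A i 1 0 *: varY R i.
Proof. by rewrite tnth_mktuple (fintype.unsplitK (inl i)). Qed.

Lemma lin_formsY A i : tnth (lin_forms A) (rshift f i) =
  A i 0 1 *: varX R i + A i 1 1 *: varY R i.
Proof. by rewrite tnth_mktuple (fintype.unsplitK (inr i)). Qed.

Lemma lsubstX A i :
  lsubst A (varX R i) = A i 0 0 *: varX R i + A i 1 0 *: varY R i.
Proof. by rewrite /lsubst comp_mpolyXU -tnth_nth lin_formsX. Qed.

Lemma lsubstY A i :
  lsubst A (varY R i) = A i 0 1 *: varX R i + A i 1 1 *: varY R i.
Proof. by rewrite /lsubst comp_mpolyXU -tnth_nth lin_formsY. Qed.

Lemma lsubst_multihom A r v : v \in multihom r -> lsubst A v \in multihom r.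
Proof.
move=> /multihomP hv; rewrite /lsubst comp_mpolyE big_seq.
apply: rpred_sum => m hm; apply: rpredZ.
have hA i a b : a *: varX R i + b *: varY R i \in multihom (fun j => (i == j)%N).
  by apply: rpredD; apply: rpredZ; [apply: varX_multihom | apply: varY_multihom].
rewrite big_split_ord /=.
have hX : \prod_(i < f) tnth (lin_forms A) (lshift f i) ^+ m (lshift f i)
  \in multihom (fun j => \sum_(i < f) (i == j) * m (lshift f i))%N.
  by apply: multihom_prod => i; apply: multihomX; rewrite lin_formsX.
have hY : \prod_(i < f) tnth (lin_forms A) (rshift f i) ^+ m (rshift f i)
  \in multihom (fun j => \sum_(i < f) (i == j) * m (rshift f i))%N.
  by apply: multihom_prod => i; apply: multihomX; rewrite lin_formsY.
have := multihomM hX hY; congr (_ \in multihom _).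
apply/funext => j; rewrite -(hv _ hm j).
have S (g : 'I_f -> nat) : (\sum_(i < f) (i == j) * g i)%N = g j.
  rewrite (bigD1 j) //= eqxx mul1n big1 ?addn0 // => i /negPf ->.
  by rewrite mul0n.
by rewrite !S.
Qed.

Definition psubst (A : 'I_f -> 'M[R]_2) r (v : polyV r) : polyV r :=
  Sub (lsubst A (val v)) (lsubst_multihom A (valP v)).

Lemma lsubst1 v : lsubst (fun=> 1%:M) v = v.
Proof.
rewrite -[RHS]comp_mpoly_id /lsubst; congr (_ \mPo _).
apply: eq_from_tnth => j; rewrite !tnth_mktuple.
case: fintype.splitP => i ji; rewrite !mxE /= ?mulr1n ?mulr0n scale1r scale0r ?addr0 ?add0r;
  by congr mpolyX; congr mnm1; apply/val_inj.
Qed.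

Lemma sum2 (g : 'I_2 -> R) : \sum_i g i = g 0 + g 1.
Proof.
by rewrite !big_ord_recl big_ord0 addr0; congr (_ + g _); apply/val_inj.
Qed.

Lemma lsubstM A B v :
  lsubst A (lsubst B v) = lsubst (fun i => A i *m B i) v.
Proof.
rewrite /lsubst !(comp_mpolyEX v) raddf_sum; apply: eq_bigr => m _.
rewrite /= linearZ /= !comp_mpolyX rmorph_prod; congr (_ *: _).
apply: eq_bigr => j _; rewrite rmorphXn; congr (_ ^+ _).
rewrite -[j]fintype.splitK; case: (fintype.split j) => i; rewrite /= ?lin_formsX ?lin_formsY;
  rewrite linearD !linearZ /= -!/(lsubst A _) lsubstX lsubstY;
  rewrite !mxE !sum2 !scalerDr !scalerA !scalerDl addrACA;
  by rewrite ![_ * B i _ _]mulrC.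
Qed.

End Polynomials.

Section Setting.
Variables (p f : nat) (D : padic_setting p f).

Notation OF := (intring (vF D)).
Notation OE := (intring (vE D)).
Notation G := (GL2 (F D)).
Notation K := (GL2 OF).

Lemma inclOE_subproof (x : OF) : (val x)%:A \in intring_pred (vE D).
Proof.
have := valP x; rewrite ![_ \in _]unfold_in /vge.
have [->|nx] /= := eqVneq (val x) 0; first by rewrite scale0r eqxx.
by rewrite vE_F // => ->; rewrite orbT.
Qed.

Definition inclOE (x : OF) : OE := Sub (val x)%:A (inclOE_subproof x).

Lemma inclOE_additive : zmod_morphism inclOE.
Proof. by move=> x y; apply/val_inj; rewrite /= scalerBl. Qed.

Lemma inclOE_multiplicative : monoid_morphism inclOE.
Proof.
split=> [|x y]; apply/val_inj; rewrite /= ?scale1r //.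
by rewrite -scalerAl mul1r scalerA.
Qed.

HB.instance Definition _ :=
  GRing.isZmodMorphism.Build OF OE inclOE inclOE_additive.
HB.instance Definition _ :=
  GRing.isMonoidMorphism.Build OF OE inclOE inclOE_multiplicative.

Definition structOE : {rmorphism OF -> OE} := inclOE.
Definition structE : {rmorphism OF -> E D} := (\val : OE -> E D) \o inclOE.
Definition structkbar : {rmorphism OF -> kbar D} := redE D \o inclOE.

Definition frobn (i : nat) : OF -> OF := iter i (frob D).

Lemma frobn_additive i : zmod_morphism (frobn i).
Proof.
by rewrite /frobn; elim: i => //= i IH x y; rewrite !iterS IH rmorphB.
Qed.

Lemma frobn_multiplicative i : monoid_morphism (frobn i).
Proof.
rewrite /frobn; split; first by elim: i => // i IH; rewrite iterS IH rmorph1.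
by elim: i => //= i IH x y; rewrite !iterS IH rmorphM.
Qed.

HB.instance Definition _ i :=
  GRing.isZmodMorphism.Build OF OF (frobn i) (frobn_additive i).
HB.instance Definition _ i :=
  GRing.isMonoidMorphism.Build OF OF (frobn i) (frobn_multiplicative i).

(* (x)_i Sym^(r_i) R^2 (x) det^m, for an algebra j : OF -> R. *)
Section Weights.
Variables (R : comNzRingType) (j : {rmorphism OF -> R}).
Variables (r : 'I_f -> nat) (m : nat).

Definition conj_mx (k : 'M[OF]_2) (i : 'I_f) : 'M[R]_2 :=
  map_mx (j \o frobn i) k.

Definition weight_act_fun (k : K) (v : polyV R r) : polyV R r :=
  j (\det (val k)) ^+ m *: psubst (conj_mx (val k)) v.

Lemma weight_act_linear k : linear (weight_act_fun k).
Proof.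
move=> a u v; apply/val_inj; rewrite /= /lsubst linearP scalerDr.
by rewrite !scalerA mulrC.
Qed.

HB.instance Definition _ k := GRing.isLinear.Build R (polyV R r) (polyV R r) _
  (weight_act_fun k) (weight_act_linear k).

Lemma weight_act1 v : weight_act_fun 1%g v = v.
Proof.
apply/val_inj; rewrite /= det1 rmorph1 expr1n scale1r -[RHS]lsubst1.
by congr lsubst; apply/funext => i; rewrite /conj_mx map_mx1.
Qed.

Lemma weight_actM k l v :
  weight_act_fun (k * l)%g v = weight_act_fun k (weight_act_fun l v).
Proof.
apply/val_inj; rewrite /= det_mulmx rmorphM exprMn.
rewrite [in RHS]/lsubst linearZ scalerA /= -!/(lsubst _ _) lsubstM; congr (_ *: _).
by congr lsubst; apply/funext => i; rewrite /conj_mx map_mxM.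
Qed.

Definition weight_rep : rep OF R :=
  @Rep OF R (polyV R r) (fun k => weight_act_fun k) weight_act1 weight_actM.

End Weights.

Definition Vrep (R : comNzRingType) (j : {rmorphism OF -> R}) r : rep OF R :=
  weight_rep j r 0.

Section CoefMap.
Variables (R R' : comNzRingType) (phi : {rmorphism R -> R'}).
Variables (j : {rmorphism OF -> R}) (r : 'I_f -> nat).

Lemma coef_map_subproof (v : polyV R r) : map_mpoly phi (val v) \in multihom r.
Proof.
have /multihomP hv := valP v; apply/multihomP => m; rewrite mcoeff_msupp => hm.
apply: hv; rewrite mcoeff_msupp; apply: contraNneq hm => h.
by rewrite mcoeff_map_mpoly h raddf0.
Qed.

Definition coef_map_fun (v : polyV R r) : polyV R' r :=
  Sub (map_mpoly phi (val v)) (coef_map_subproof v).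

Lemma coef_map_additive : zmod_morphism coef_map_fun.
Proof. by move=> u v; apply/val_inj; rewrite /= raddfB. Qed.

HB.instance Definition _ := GRing.isZmodMorphism.Build (polyV R r) (polyV R' r)
  coef_map_fun coef_map_additive.

Lemma map_lsubst (A : 'I_f -> 'M[R]_2) (v : {mpoly R[f + f]}) :
  map_mpoly phi (lsubst A v) = lsubst (fun i => map_mx phi (A i)) (map_mpoly phi v).
Proof.
have -> : map_mpoly phi v = \sum_(m <- msupp v) phi v@_m *: 'X_[m].
  rewrite {1}[v]mpolyE (raddf_sum (map_mpoly phi)); apply: eq_bigr => m _.
  by rewrite /= map_mpolyZ map_mpolyX.
rewrite /lsubst (raddf_sum (comp_mpoly _)) comp_mpolyEX.
rewrite (raddf_sum (map_mpoly phi)); apply: eq_bigr => m _.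
rewrite /= map_mpolyZ comp_mpolyZ; congr (_ *: _).
rewrite !comp_mpolyX rmorph_prod; apply: eq_bigr => l _.
rewrite rmorphXn; congr (_ ^+ _); rewrite -[l]fintype.splitK.
case: (fintype.split l) => i; rewrite /= ?lin_formsX ?lin_formsY raddfD /= !map_mpolyZ;
by rewrite !map_mpolyX !mxE.
Qed.

Lemma coef_map_act k v :
  coef_map_fun (act (r := Vrep j r) k v) =
  act (r := Vrep (phi \o j) r) k (coef_map_fun v).
Proof.
apply/val_inj; rewrite /= !expr0 !scale1r map_lsubst; congr lsubst.
by apply/funext => i; apply/matrixP => a b; rewrite !mxE.
Qed.

Definition coef_map : equivar (Vrep j r) (Vrep (phi \o j) r) :=
  @Equivar _ _ _ (Vrep j r) (Vrep (phi \o j) r) coef_map_fun coef_map_act.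

End CoefMap.

Definition coefE r : equivar (Vrep structOE r) (Vrep structE r) :=
  coef_map (\val : OE -> E D) structOE r.
Definition coefkbar r : equivar (Vrep structOE r) (Vrep structkbar r) :=
  coef_map (redE D) structOE r.

Lemma vF_nat n : (0 < n)%N ->
  n%:R != 0 :> F D /\ vF D n%:R = (logn p n)%:R.
Proof.
move=> n0; have [nn vn] := Qp_nat (QpP D) n0.
have E : n%:R = (n%:R : Qp D)%:A :> F D by rewrite scaler_nat.
by rewrite E vF_Qp // vn scaler_eq0 negb_or nn oner_neq0.
Qed.

Lemma pF_neq0 : p%:R != 0 :> F D.
Proof. by case: (vF_nat (prime_gt0 (p_prime D))). Qed.

Lemma vF_p : vF D p%:R = 1.
Proof.
have [_ ->] := vF_nat (prime_gt0 (p_prime D)).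
by rewrite logn_prime ?eqxx // (p_prime D).
Qed.

Lemma KZelt_unit (n : int) (k : K) :
  p%:R ^ n *: map_mx val (val k) \in (unitmx : pred 'M[F D]_2).
Proof.
rewrite unitmxZ; last by rewrite unitfE expfz_neq0 // pF_neq0.
by have := valP k; rewrite !unitmxE det_map_mx; apply: rmorph_unit.
Qed.

(* The element p^n k of KZ; every element of KZ has this form, since Z is     *)
(* generated by p and the scalar matrices in K. *)
Definition KZelt (n : int) (k : K) : G :=
  Sub (p%:R ^ n *: map_mx val (val k)) (KZelt_unit n k).

Lemma KZelt_inj n n' k k' : KZelt n k = KZelt n' k' -> n = n' /\ k = k'.
Proof.
move=> /(congr1 val) /= e.
have p0 := pF_neq0.
have vdet (l : K) : \det (map_mx val (val l) : 'M[F D]_2) != 0 /\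
    vF D (\det (map_mx val (val l))) = 0.
  have := valP l; rewrite unitmxE => /andP[d0 /eqP vd].
  by rewrite det_map_mx.
have en : n = n'.
  have vz m (l : K) : vF D (\det (p%:R ^ m *: map_mx val (val l))) = m%:~R *+ 2.
    have [d0 vd0] := vdet l.
    by rewrite detZ (vfunM _ (expf_neq0 2 (expfz_neq0 _ p0)) d0) vd0 addr0
               (vfunX _ 2 (expfz_neq0 _ p0)) vfunXz // vF_p.
  have := congr1 (fun M => vF D (\det M)) e; rewrite !vz => /eqP.
  by rewrite eqrMn2r // eqr_int => /eqP.
split=> //; apply/val_inj.
have {}e : map_mx val (val k) = map_mx val (val k') :> 'M[F D]_2.
  by apply: (scalerI _ (etrans e _)); rewrite ?en // expfz_neq0.
apply/matrixP => a b; apply/val_inj.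
by have /matrixP/(_ a b) := e; rewrite !mxE.
Qed.

Section Induction.
Variables (R : comNzRingType) (M : rep OF R).

Definition ind_mem (phi : G -> M) : Prop :=
  (forall n k g, phi (KZelt n k * g)%g = act k (phi g)) /\
  (exists s : seq G, forall g, phi g != 0 ->
     exists n k h, h \in s /\ g = (KZelt n k * h)%g).

Lemma ind_mem0 : ind_mem 0.
Proof.
by split=> [n k g|]; [rewrite linear0 | exists [::] => g; rewrite eqxx].
Qed.

Lemma ind_memP a x y : ind_mem x -> ind_mem y -> ind_mem (a *: x + y).
Proof.
move=> [ex [s hs]] [ey [t ht]]; split=> [n k g|].
  by rewrite /GRing.add /GRing.scale /= ex ey linearP.
exists (s ++ t) => g; have [x0|/hs[n [k [h [hh ->]]]] _] := eqVneq (x g) 0.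
  have [y0|/ht[n [k [h [hh ->]]]] _] := eqVneq (y g) 0.
    by rewrite /GRing.add /GRing.scale /= x0 y0 scaler0 addr0 eqxx.
  by exists n, k, h; rewrite mem_cat hh orbT.
by exists n, k, h; rewrite mem_cat hh.
Qed.

Definition ind_sub : submodule (G -> M) := Submodule ind_mem0 ind_memP.

Definition ind : lmodType R := submod ind_sub.

Definition ind_fun (x : ind) : G -> M := val (x : submod ind_sub).

Definition elt_fun (g : G) (v : M) (g' : G) : M :=
  if pselect (exists nk : int * K, (g' * g)%g = KZelt nk.1 nk.2) is left h
  then act (projT1 (cid h)).2 v else 0.

Lemma elt_funE g v g' n k : (g' * g)%g = KZelt n k -> elt_fun g v g' = act k v.
Proof.
move=> e; rewrite /elt_fun; case: pselect => [h|]; last by case; exists (n, k).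
by case: (cid h) => -[n' k'] /= e'; rewrite e' in e; case: (KZelt_inj e) => _ ->.
Qed.

Lemma KZeltM n k n' k' : (KZelt n k * KZelt n' k')%g = KZelt (n + n') (k * k')%g.
Proof.
have mM : map_mx val (val (k * k')%g) =
    map_mx val (val k) *m map_mx val (val k') :> 'M[F D]_2.
  exact: (map_mxM (\val : OF -> F D)).
apply/val_inj; rewrite [LHS]/= -scalemxAl -scalemxAr scalerA -mM.
by rewrite -expfzDr // pF_neq0.
Qed.

Lemma KZelt1 : KZelt 0 1%g = 1%g.
Proof.
apply/val_inj; rewrite /= expr0z scale1r.
exact: (map_mx1 (\val : OF -> F D)).
Qed.

Lemma KZeltV n k : (KZelt n k)^-1%g = KZelt (- n) k^-1%g.
Proof.
apply: (@mulgI _ (KZelt n k)).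
by rewrite mulgV KZeltM subrr mulgV KZelt1.
Qed.

Lemma elt_mem g v : ind_mem (elt_fun g v).
Proof.
split=> [n k g'|].
  have [[[n' k'] /= e]|ne] := pselect (exists nk, (g' * g)%g = KZelt nk.1 nk.2).
    rewrite (elt_funE v e) -actM; apply: (@elt_funE _ _ _ (n + n')).
    by rewrite -mulgA e KZeltM.
  rewrite /elt_fun; case: pselect => [[[n' k'] /= e]|_].
    case: ne; exists (- n + n', k^-1 * k')%g => /=.
    by rewrite -KZeltM -e -KZeltV -mulgA mulKg.
  by case: pselect => // _; rewrite linear0.
exists [:: g^-1%g] => g'; rewrite /elt_fun; case: pselect => [[[n k] /= e] _|].
  by exists n, k, g^-1%g; rewrite inE eqxx -e mulgK.
by rewrite eqxx.
Qed.

(* [g, v] *)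
Definition elt (g : G) (v : M) : ind :=
  (Sub (elt_fun g v) (introT (smem_predP ind_sub _) (elt_mem g v)) :
     submod ind_sub).

End Induction.

Section IndMap.
Variables (R R' : comNzRingType) (M : rep OF R) (N : rep OF R').
Variable (u : equivar M N).

Lemma ind_map_mem (x : ind M) : ind_mem (u \o ind_fun x : G -> N).
Proof.
have /smem_predP[ex [s hs]] := valP (x : submod (ind_sub M)).
split=> [n k g|]; first by rewrite /= /ind_fun ex equivar_act.
exists s => g /= hg; apply: hs; apply: contraNneq hg => hg.
by rewrite /ind_fun hg raddf0.
Qed.

Definition ind_map (x : ind M) : ind N :=
  (Sub (u \o ind_fun x) (introT (smem_predP (ind_sub N) _) (ind_map_mem x)) :
     submod (ind_sub N)).

End IndMap.
Section IndSub.
Variables (R : comNzRingType) (M : rep OF R) (N : subrep M).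

Definition ind_in_mem (x : ind M) : Prop := forall g, N (ind_fun x g).

Lemma ind_in_mem0 : ind_in_mem 0.
Proof. by move=> g; apply: (smem0 N). Qed.

Lemma ind_in_memP a x y :
  ind_in_mem x -> ind_in_mem y -> ind_in_mem (a *: x + y).
Proof. by move=> hx hy g; apply: (smemP (s := N) a (hx g) (hy g)). Qed.

(* ind N as a submodule of ind M *)
Definition ind_in : submodule (ind M) := Submodule ind_in_mem0 ind_in_memP.

End IndSub.

Lemma gl_teich_unit (c : kF D) :
  mx2 p%:R (val (teich c)) 0 1 \in (unitmx : pred 'M[F D]_2).
Proof. by rewrite unitmxE det_mx2 mulr1 mulr0 subr0 unitfE pF_neq0. Qed.

Lemma gl_alpha_unit : mx2 1 0 0 p%:R \in (unitmx : pred 'M[F D]_2).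
Proof. by rewrite unitmxE det_mx2 mul1r mulr0 subr0 unitfE pF_neq0. Qed.

Definition gl_teich (c : kF D) : G :=
  Sub (mx2 p%:R (val (teich c)) 0 1) (gl_teich_unit c).
Definition gl_alpha : G := Sub (mx2 1 0 0 p%:R) gl_alpha_unit.

Section Hecke.
Variables (R : comNzRingType) (j : {rmorphism OF -> R}).
Variables (r : 'I_f -> nat) (m : nat).
Local Notation W := (weight_rep j r m).

(* T([g, v]). For R = kbar one has p = 0 in R, and this is the reduced        *)
(* formula.                                                                   *)
Definition hecke_elt (g : G) (v : W) : ind W :=
  \sum_(c : kF D) elt (M := W) (g * gl_teich c)%g
     (psubst (fun i => mx2 1 ((- j (teich c)) ^+ (p ^ i)) 0 p%:R) v)
  + elt (M := W) (g * gl_alpha)%g (psubst (fun=> mx2 p%:R 0 0 1) v).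

(* hecke_rel x y means y = T x, T being the additive extension of hecke_elt   *)
(* (the elements [g, v] generate ind W).                                      *)
Definition hecke_rel (x y : ind W) : Prop :=
  exists s : seq (G * W), x = \sum_(gv <- s) elt gv.1 gv.2 /\
                          y = \sum_(gv <- s) hecke_elt gv.1 gv.2.

End Hecke.

(* T(ind M), for a semisimple representation M over kbar. The simple          *)
(* representations of GL_2(F_q) over kbar are the weights Sym^s (x) det^m with*)
(* 0 <= s_i <= p - 1, so M is the sum of the images of the equivariant maps   *)
(* iota from the weights, and T on ind M is the operator commuting with all   *)
(* the maps ind iota.                                                         *)
Definition hecke_image (M : rep OF (kbar D)) : submodule (ind M) :=
  lspan (fun z => exists (s : 'I_f -> nat) (m : nat)
      (iota : equivar (weight_rep structkbar s m) M)
      (x y : ind (weight_rep structkbar s m)),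
    [/\ forall i, (s i < p)%N,
        forall a v, iota (a *: v) = a *: iota v,
        hecke_rel x y
      & z = ind_map iota y]).

Section Reduction.
Variables (r : 'I_f -> nat) (ap : E D).

(* (T - a_p)(ind V(E)) *)
Definition hecke_shift : submodule (ind (Vrep structE r)) :=
  lspan (fun z => exists2 xy, hecke_rel xy.1 xy.2 & z = xy.2 - ap *: xy.1).

Definition bigPi : lmodType (E D) := quotmod hecke_shift.

Definition theta_map (x : ind (Vrep structOE r)) :
    restr (\val : OE -> E D) bigPi :=
  qclass hecke_shift (ind_map (coefE r) x).

Lemma theta_map_linear : linear theta_map.
Proof.
move=> a x y; rewrite /theta_map [RHS]/=.
have -> : ind_map (coefE r) (a *: x + y) =
    val a *: ind_map (coefE r) x + ind_map (coefE r) y.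
  apply/val_inj/funext => g; apply/val_inj => /=.
  apply: etrans (raddfD (map_mpoly (\val : OE -> E D)) _ _) _.
  by congr (_ + _); apply: (map_mpolyZ (\val : OE -> E D)).
exact: (linearP (qclass hecke_shift) (val a)).
Qed.

HB.instance Definition _ := GRing.isLinear.Build OE (ind (Vrep structOE r))
  (restr (\val : OE -> E D) bigPi) _ theta_map theta_map_linear.

Definition Theta : lmodType OE := submod (lin_image theta_map (full_sub _)).

Lemma to_theta_subproof x : theta_map x \in smem_pred (lin_image theta_map (full_sub _)).
Proof. by apply/smem_predP; exists x. Qed.

Definition to_theta (x : ind (Vrep structOE r)) : Theta :=
  (Sub (theta_map x) (to_theta_subproof x) :
     submod (lin_image theta_map (full_sub _))).

(* The reduction of Theta, with scalars extended from the residue field of E  *)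
(* to kbar. *)
Definition Thetabar : lmodType (kbar D) := base_change (redE D) Theta.

Definition natural_surj (psi : ind (Vrep structkbar r) -> Thetabar) : Prop :=
  forall x, psi (ind_map (coefkbar r) x) = tensor1 (redE D) (to_theta x).

End Reduction.

Definition theta (i : 'I_f) : {mpoly (kbar D)[f + f]} :=
  varX _ i * varY _ (ord_pred i) ^+ p - varY _ i * varX _ (ord_pred i) ^+ p.

Section Quotient.
Variable r : 'I_f -> nat.
Local Notation V := (Vrep structkbar r).

Definition Vstar_mem (v : V) : Prop :=
  exists P : 'I_f -> {mpoly (kbar D)[f + f]},
    val (v : polyV (kbar D) r) = \sum_i theta i * P i.

Lemma Vstar_mem0 : Vstar_mem 0.
Proof. by exists (fun=> 0); rewrite big1 // => i _; rewrite mulr0. Qed.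

Lemma Vstar_memP a x y : Vstar_mem x -> Vstar_mem y -> Vstar_mem (a *: x + y).
Proof.
move=> [P hP] [P' hP']; exists (fun i => a *: P i + P' i).
rewrite /= hP hP' scaler_sumr -big_split; apply: eq_bigr => i _.
by rewrite mulrDr scalerAr.
Qed.

Definition Vstar_sub : submodule V := Submodule Vstar_mem0 Vstar_memP.

Lemma struct_frob x : structkbar (frob D x) = structkbar x ^+ p.
Proof.
apply/eqP; rewrite -rmorphXn -subr_eq0 -rmorphB; apply/eqP.
apply/redE_ker => /=.
have /resF_ker : resF D (frob D x - x ^+ p) = 0.
  by rewrite rmorphB rmorphXn frobP subrr.
rewrite /vgt; case: eqVneq => [/= h _|n0 /=]; first by rewrite h scale0r eqxx.
by rewrite vE_F // => ->; rewrite orbT.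
Qed.

Lemma struct_frobn i x : structkbar (frobn i x) = structkbar x ^+ (p ^ i).
Proof.
rewrite /frobn; elim: i => [|i IH]; first by rewrite expn0 expr1.
by rewrite iterS struct_frob IH -exprM expnSr.
Qed.

Lemma struct_card x : structkbar x ^+ (p ^ f) = structkbar x.
Proof.
apply/eqP; rewrite -rmorphXn -subr_eq0 -rmorphB; apply/eqP.
apply/redE_ker => /=.
have /resF_ker : resF D (x ^+ (p ^ f) - x) = 0.
  by rewrite rmorphB rmorphXn -(card_kF D) expf_card subrr.
rewrite /vgt; case: eqVneq => [/= h _|n0 /=]; first by rewrite h scale0r eqxx.
by rewrite vE_F // => ->; rewrite orbT.
Qed.

Lemma struct_pred (i : 'I_f) x :
  structkbar (frobn (ord_pred i) x) ^+ p = structkbar (frobn i x).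
Proof.
rewrite !struct_frobn -exprM -expnSr; case: i => -[|i] hi /=.
  by rewrite add0n modn_small ?ltn_predL // prednK // struct_card expn0 expr1.
by rewrite modnDr modn_small // ltnW.
Qed.

Lemma kbar_pchar : p \in [pchar (kbar D)].
Proof.
rewrite !inE (p_prime D) /=.
have -> : p%:R = structkbar p%:R by rewrite rmorph_nat.
apply/eqP/redE_ker => /=.
rewrite /vgt.
have -> : val (p%:R : OF) = p%:R by rewrite (rmorph_nat (\val : OF -> F D)).
by rewrite vE_F ?pF_neq0 // vF_p ltr01 orbT.
Qed.

Lemma theta_lsubst (k : 'M[OF]_2) (i : 'I_f) :
  exists c : kbar D, lsubst (conj_mx structkbar k) (theta i) = c *: theta i.
Proof.
have pP : p \in [pchar {mpoly (kbar D)[f + f]}].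
  exact: (rmorph_pchar (@mpolyC _ _)) kbar_pchar.
pose A := conj_mx structkbar k.
have hA a b : A (ord_pred i) a b ^+ p = A i a b by rewrite !mxE /= struct_pred.
exists (A i 0 0 * A i 1 1 - A i 0 1 * A i 1 0).
rewrite -/A /theta /lsubst rmorphB !rmorphM !rmorphXn /= -!/(lsubst _ _).
rewrite !lsubstX !lsubstY !exprDn_pchar ?pnatE ?(p_prime D) // !exprZn !hA.
rewrite -!mul_mpolyC rmorphB !rmorphM /=; ring.
Qed.

Lemma Vstar_act k x : Vstar_sub x -> Vstar_sub (act k x).
Proof.
move=> [P hP].
have /choice[c hc] := theta_lsubst (val k).
exists (fun i => c i *: lsubst (conj_mx structkbar (val k)) (P i)).
rewrite /= expr0 scale1r hP /lsubst (raddf_sum (comp_mpoly _)) /=.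
apply: eq_bigr => i _; rewrite rmorphM /= -!/(lsubst _ _) hc.
by rewrite -scalerAl -scalerAr.
Qed.

Definition Vstar : subrep V := Subrep Vstar_act.

(* GL2 OF acts on V through GL_2(F_q), so this is the GL_2(F_q)-submodule     *)
(* generated by prod_i X_i^(r_i).                                             *)
Definition Xr : subrep V :=
  genrep (fun v : V => val (v : polyV (kbar D) r) = \prod_i varX _ i ^+ r i).

Definition repQ : rep OF (kbar D) := quot_rep (add_sub Vstar Xr).

Definition projQ : equivar V repQ := quot_proj (add_sub Vstar Xr).

Definition cosocQ : rep OF (kbar D) := soclayer repQ f.

End Quotient.

Section Filtration.
Variables (r : 'I_f -> nat) (ap : E D).
Variable psiQ : {linear ind (repQ r) -> Thetabar r ap}.

(* F_n, the image of ind Q_n *)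
Definition Fil (n : nat) : submodule (Thetabar r ap) :=
  lin_image psiQ (ind_in (socfil (repQ r) n)).

(* F_t = F_f / F_(f-1) *)
Definition Ft : lmodType (kbar D) :=
  quotmod (lin_preim (\val : submod (Fil f) -> Thetabar r ap) (Fil f.-1)).

Definition toFt (y : submod (Fil f)) : Ft := qclass _ y.

(* pi is induced by psiQ on ind cosoc(Q) = ind (Q_f / Q_(f-1)). *)
Definition induced_surj (pi : ind (cosocQ r) -> Ft) : Prop :=
  forall (x : ind (sub_rep (socfil (repQ r) f))) (y : submod (Fil f)),
    val y = psiQ (ind_map (sub_incl _) x) ->
    pi (ind_map (quot_proj _) x) = toFt y.

End Filtration.
End Setting.

Definition padic_unit (K : fieldType) (v : valuation K) (x : K) : Prop :=
  x != 0 /\ v x = 0.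

(* Main.v *)
Require Import Defs.
From HB Require Import structures.
From mathcomp Require Import fingroup cyclic.
From mathcomp Require Import all_boot all_order all_algebra all_field.
From mathcomp Require Import ring zify lra.
From mathcomp Require Import boolp functions.
From mathcomp Require Import mpoly.

Set Implicit Arguments.
Unset Strict Implicit.
Unset Printing Implicit Defensive.

Import Order.TTheory GRing.Theory Num.Theory.
Local Open Scope ring_scope.

(* Modulo V_r^*, elements of V_r are functions on F_q^2, and evaluating them
   shows that the socle layers of Q are cut out by the weights of monomials;
   in the cosocle, the vectors fixed by the upper unipotents are multiples of the
   class of eps = prod_i X_i^(r_i) Y_h / X_h.
   Applying T - a_p to the sum of the u_m Y^r, where m runs over F_q and u_m is
   the upper unipotent of [m], and computing modulo p^2 yields
     (a_p^2 - p r_h) sum_c [g_c, eps] in im (T - a_p) + (a_p^3, p a_p) ind V(O_E).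
   The hypothesis on a_p makes the valuation of a_p^2 - p r_h smaller than those
   of a_p^3 and p a_p, so after division sum_c [g_c, eps] vanishes in Theta-bar,
   and so does T [g, prod_i X_i^(s_i)] for every weight s mapping to the cosocle.
   Equivariance of T under lower unipotents extends this to the whole weight,
   which they generate from prod_i X_i^(s_i). *)

(** * Submodules *)

Lemma linear_fun_ex (R : nzRingType) (U W : lmodType R) (u : U -> W) :
  linear u -> exists u' : {linear U -> W}, u' =1 u.
Proof.
move=> lin_u; pose lin_mixin := GRing.isLinear.Build R U W _ u lin_u.
by exists (HB.pack u lin_mixin : {linear U -> W}).
Qed.

Lemma linear_factor (R : nzRingType) (A B C : lmodType R) (u : {linear A -> B})
    (psi : {linear A -> C}) :
  (forall y, exists x, u x = y) -> (forall x, u x = 0 -> psi x = 0) ->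
  exists psi' : {linear B -> C}, forall x, psi' (u x) = psi x.
Proof.
move=> u_surj ker_le; have [g gK] := choice u_surj.
have psi_eq x y : u x = u y -> psi x = psi y.
  by move=> e; apply/subr0_eq; rewrite -linearB ker_le // linearB e subrr.
have [a x y|psi' psi'E] := @linear_fun_ex _ B C (psi \o g).
  by rewrite /= -linearP; apply: psi_eq; rewrite linearP !gK.
by exists psi' => x; rewrite psi'E; apply: psi_eq; rewrite gK.
Qed.

Section Submodules.
Variables (R : nzRingType) (U V : lmodType R).
Implicit Types N : submodule V.

Lemma smemN N x : N x -> N (- x).
Proof. by rewrite -scaleN1r; apply: smemZ. Qed.

Lemma smemB N x y : N x -> N y -> N (x - y).
Proof. by move=> Nx /smemN; apply: smemD. Qed.

Lemma smemBC N x y : N (x - y) -> N (y - x).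
Proof. by rewrite -opprB => /smemN; rewrite opprK. Qed.

Lemma smemB_trans N y x z : N (x - y) -> N (y - z) -> N (x - z).
Proof. by move=> Nxy Nyz; rewrite -(subrKA y); apply: smemD. Qed.

Lemma smem_sum N (I : Type) (s : seq I) (P : pred I) (x : I -> V) :
  (forall i, P i -> N (x i)) -> N (\sum_(i <- s | P i) x i).
Proof.
by move=> Nx; apply: (big_ind N); [apply: smem0 | apply: smemD |].
Qed.

Lemma lin_ker_closed (u : {linear U -> V}) a x y :
  u x = 0 -> u y = 0 -> u (a *: x + y) = 0.
Proof. by move=> ux uy; rewrite linearP ux uy scaler0 addr0. Qed.

Definition lin_ker (u : {linear U -> V}) : submodule U :=
  Submodule (linear0 u) (@lin_ker_closed u).

Lemma corestrict_linear (u : {linear U -> V}) N (uN : forall x, u x \in smem_pred N) :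
  linear (fun x => Sub (u x) (uN x) : submod N).
Proof. by move=> a x y; apply/val_inj; rewrite /= linearP. Qed.

Lemma corestrict_eq0 (u : {linear U -> V}) N (uN : forall x, u x \in smem_pred N) x :
  u x = 0 -> (Sub (u x) (uN x) : submod N) = 0.
Proof. by move=> ux0; apply/val_inj. Qed.

Lemma qclass_eq0 N x : qclass N x = 0 <-> N x.
Proof. by rewrite -(linear0 (qclass N)) -[N x]/(N x) qclass_eq subr0. Qed.

Lemma lspan_fin_family (I : finType) (P : I -> Prop) (x : I -> V) N y :
  lspan (fun z => N z \/ exists2 i, P i & z = x i) y ->
  exists2 c : I -> R,
    forall i, c i != 0 -> P i & N (y - \sum_i c i *: x i).
Proof.
pose comb z := exists2 c : I -> R,
  forall i, c i != 0 -> P i & N (z - \sum_i c i *: x i).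
have comb_N z : N z -> comb z.
  move=> Nz; exists (fun=> 0) => [i|]; first by rewrite eqxx.
  by rewrite big1 ?subr0 // => i _; rewrite scale0r.
have comb_lin a z z' : comb z -> comb z' -> comb (a *: z + z').
  move=> [c Pc Nz] [c' Pc' Nz']; exists (fun i => a * c i + c' i) => [i|].
    have [ci0|/Pc//] := eqVneq (c i) 0.
    by rewrite ci0 mulr0 add0r; apply: Pc'.
  rewrite (eq_bigr (fun i => a *: (c i *: x i) + c' i *: x i)); last first.
    by move=> i _; rewrite scalerDl scalerA.
  by rewrite big_split -scaler_sumr opprD addrACA -scalerBr; apply: smemP.
move=> /(_ (Submodule (comb_N _ (smem0 N)) comb_lin)); apply=> z [|[i Pi ->]].
  exact: comb_N.
exists (fun j => (j == i)%:R) => [j|]; first by case: (eqVneq j i) => [->|_] //; rewrite eqxx.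
rewrite (bigD1 i) //= eqxx scale1r big1 ?addr0 ?subrr; first exact: smem0.
by move=> j /negPf ->; rewrite scale0r.
Qed.

End Submodules.

Lemma smemZ_inv (R : unitRingType) (U : lmodType R) (N : submodule U) a x :
  a \is a GRing.unit -> N (a *: x) -> N x.
Proof. by move=> ua /(smemZ a^-1); rewrite scalerA mulVr // scale1r. Qed.

Section Thicken.
Variables (R : comNzRingType) (V : lmodType R) (N : submodule V) (c : R).

Definition thicken_mem (x : V) : Prop := exists z, N (x - c *: z).

Lemma thicken_mem0 : thicken_mem 0.
Proof. by exists 0; rewrite scaler0 subr0; apply: smem0. Qed.

Lemma thicken_memP a x y :
  thicken_mem x -> thicken_mem y -> thicken_mem (a *: x + y).
Proof.
move=> [z Nxz] [z' Nyz']; exists (a *: z + z').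
rewrite scalerDr scalerA [c * a]mulrC -scalerA opprD addrACA -scalerBr.
exact: smemP.
Qed.

Definition thicken : submodule V := Submodule thicken_mem0 thicken_memP.

Lemma thicken_sub x : N x -> thicken x.
Proof. by move=> Nx; exists 0; rewrite scaler0 subr0. Qed.

Lemma thicken_scale x : thicken (c *: x).
Proof. by exists x; rewrite subrr; apply: smem0. Qed.

End Thicken.

Lemma thicken_mulr (R : comNzRingType) (V : lmodType R) (N : submodule V) a c x :
  thicken N (a * c) x -> thicken N c x.
Proof. by move=> [z Nz]; exists (a *: z); rewrite scalerA mulrC. Qed.

Lemma thickenZ (R : comNzRingType) (V : lmodType R) (N : submodule V) a c x :
  thicken N c x -> thicken N (a * c) (a *: x).
Proof. by move=> [z Nz]; exists z; rewrite -scalerA -scalerBr; apply: smemZ. Qed.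

Lemma eq_big_support (I : eqType) (A : nmodType) (F : I -> A) (s t : seq I) :
  uniq s -> uniq t -> (forall i, F i != 0 -> i \in s) ->
  (forall i, F i != 0 -> i \in t) -> \sum_(i <- s) F i = \sum_(i <- t) F i.
Proof.
move=> uniq_s uniq_t supp_s supp_t.
have big_nz u : \sum_(i <- u) F i = \sum_(i <- [seq i <- u | F i != 0]) F i.
  rewrite big_filter [LHS](bigID (fun i => F i != 0)) /= [X in _ + X]big1 ?addr0 //.
  by move=> i /negPn/eqP.
rewrite (big_nz s) (big_nz t); apply/perm_big/uniq_perm; rewrite ?filter_uniq //.
move=> i; rewrite !mem_filter; case: eqVneq => //= Fi.
by rewrite supp_s // supp_t.
Qed.

Lemma sum_support_linear (R : nzRingType) (I : eqType) (U A C : lmodType R)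
    (coef : I -> U -> A) (supp : U -> seq I) (F : I -> A -> C) :
  (forall i, linear (coef i)) -> (forall i, linear (F i)) ->
  (forall u, uniq (supp u)) -> (forall u i, coef i u != 0 -> i \in supp u) ->
  linear (fun u => \sum_(i <- supp u) F i (coef i u)).
Proof.
move=> coef_lin F_lin uniq_supp mem_supp a u v.
have F0 i : F i 0 = 0 by have [F' FE] := linear_fun_ex (F_lin i); rewrite -FE linear0.
pose s := undup (supp (a *: u + v) ++ supp u ++ supp v).
have widen w : {subset supp w <= s} ->
    \sum_(i <- supp w) F i (coef i w) = \sum_(i <- s) F i (coef i w).
  have mem_w i : F i (coef i w) != 0 -> i \in supp w.
    by move=> Fi; apply: mem_supp; apply: contraNneq Fi => ->; rewrite F0.
  by move=> sub; apply: eq_big_support; rewrite ?undup_uniq // => i /mem_w // /sub.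
rewrite !widen => [|i|i|i]; try by rewrite mem_undup !mem_cat => ->; rewrite ?orbT.
by rewrite scaler_sumr -big_split; apply: eq_bigr => i _; rewrite coef_lin F_lin.
Qed.

(** * Induced representations *)

Section EquivariantMaps.
Variables (O : comUnitRingType) (R : comNzRingType) (M M' : rep O R).
Variable u : {linear M -> M'}.
Hypothesis u_act : forall k x, u (act k x) = act k (u x).

Lemma image_sub_act (N : subrep M) k y :
  lin_image u N y -> lin_image u N (act k y).
Proof.
by move=> [x Nx <-]; exists (act k x); [apply: subrep_act | apply: u_act].
Qed.

Definition image_sub (N : subrep M) : subrep M' := Subrep (@image_sub_act N).

Lemma preim_sub_act (N : subrep M') k x :
  lin_preim u N x -> lin_preim u N (act k x).
Proof.
move=> Nux; rewrite -[lin_preim u N _]/(N (u (act k x))) u_act.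
exact: subrep_act.
Qed.

Definition preim_sub (N : subrep M') : subrep M := Subrep (@preim_sub_act N).

End EquivariantMaps.

Lemma act_sub_mem (O : comUnitRingType) (R : comNzRingType) (M : rep O R)
    (N : subrep M) k (x : M) : N x -> N (act k x - x).
Proof. by move=> Nx; apply: smemB => //; apply: subrep_act. Qed.

Lemma act_invariant_mod (O : comUnitRingType) (R : comNzRingType) (M : rep O R)
    (N : subrep M) k (x y : M) :
  N (x - y) -> N (act k x - x) -> N (act k y - y).
Proof.
move=> Nxy Nx; have -> : act k y - y = (act k x - x) - (act k (x - y) - (x - y)).
  by rewrite (linearB (act k)) opprD opprK addrACA subKr addKr.
by apply: smemB => //; apply: act_sub_mem.
Qed.

Section Induced.
Variables (p f : nat) (D : padic_setting p f).
Local Notation OF := (intring (vF D)).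
Local Notation G := (GL2 (F D)).

Section OneRep.
Variables (R : comNzRingType) (M : rep OF R).

Lemma ind_eq (x y : ind M) : (forall g, ind_fun x g = ind_fun y g) -> x = y.
Proof. by move=> e; apply/val_inj/funext. Qed.

Lemma ind_funP a (x y : ind M) g :
  ind_fun (a *: x + y) g = a *: ind_fun x g + ind_fun y g.
Proof. by []. Qed.

Lemma ind_fun_sum I (s : seq I) (x : I -> ind M) g :
  ind_fun (\sum_(i <- s) x i) g = \sum_(i <- s) ind_fun (x i) g.
Proof. exact: (big_morph (fun x : ind M => ind_fun x g)). Qed.

Lemma ind_funK (x : ind M) n k g :
  ind_fun x (KZelt n k * g)%g = act k (ind_fun x g).
Proof. by have /smem_predP[equi _] := valP (x : submod (ind_sub M)); apply: equi. Qed.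

Lemma ind_fun_elt g (v : M) g' n k :
  (g' * g)%g = KZelt n k -> ind_fun (elt g v) g' = act k v.
Proof. exact: elt_funE. Qed.

Lemma ind_fun_elt0 g (v : M) g' :
  ~ (exists nk, (g' * g)%g = KZelt nk.1 nk.2) -> ind_fun (elt g v) g' = 0.
Proof. by rewrite /ind_fun /= /elt_fun; case: pselect. Qed.

Lemma elt_linear g : linear (elt (M := M) g).
Proof.
move=> a x y; apply: ind_eq => g'; rewrite ind_funP.
have [[[n k] /= e]|ne] := pselect (exists nk, (g' * g)%g = KZelt nk.1 nk.2).
  by rewrite !(ind_fun_elt _ e) linearP.
by rewrite !ind_fun_elt0 // scaler0 addr0.
Qed.

HB.instance Definition _ g :=
  GRing.isLinear.Build R M (ind M) _ (elt g) (elt_linear g).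

Lemma elt_KZ g n k (v : M) : elt (g * KZelt n k)%g v = elt g (act k v).
Proof.
apply: ind_eq => g'.
have [[[n' k'] /= e]|ne] := pselect (exists nk, (g' * g)%g = KZelt nk.1 nk.2).
  rewrite (ind_fun_elt _ e) -actM; apply: (@ind_fun_elt _ _ _ (n' + n)).
  by rewrite mulgA e KZeltM.
rewrite !ind_fun_elt0 // => -[[n' k'] /=]; rewrite mulgA => e; apply: ne.
by exists (n' - n, k' * k^-1)%g; rewrite /= -KZeltM -KZeltV -e mulgK.
Qed.

Definition cosetKZ (g h : G) : Prop := exists n k, h = (KZelt n k * g)%g.

Lemma cosetKZ_refl g : cosetKZ g g.
Proof. by exists 0, 1%g; rewrite KZelt1 mul1g. Qed.

Definition coset_rep (g : G) : G :=
  xchoose (P := fun h => `[< cosetKZ g h >])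
    (ex_intro _ g (introT (asboolP _) (cosetKZ_refl g))).

Lemma coset_repP g : cosetKZ g (coset_rep g).
Proof. exact/asboolP/(xchooseP (P := fun h => `[< cosetKZ g h >])). Qed.

Lemma coset_rep_eq g h : cosetKZ g h -> coset_rep g = coset_rep h.
Proof.
move=> [n [k ->]]; apply: eq_xchoose => h'; apply/asboolP/asboolP.
  move=> [n' [k' ->]]; exists (n' - n), (k' * k^-1)%g.
  by rewrite -KZeltM -KZeltV mulgA mulgVK.
by move=> [n' [k' ->]]; exists (n' + n), (k' * k)%g; rewrite -KZeltM mulgA.
Qed.

Definition support_reps (x : ind M) (t : seq G) : Prop :=
  [/\ uniq t, forall g, g \in t -> coset_rep g = g &
      forall g, ind_fun x g != 0 -> coset_rep g \in t].

Lemma support_reps_ex (x : ind M) : exists t, support_reps x t.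
Proof.
have /smem_predP[_ [s supp_s]] := valP (x : submod (ind_sub M)).
exists (undup (map coset_rep s)); split; first exact: undup_uniq.
  move=> g; rewrite mem_undup => /mapP[h _ ->].
  by rewrite -(coset_rep_eq (coset_repP h)).
move=> g /supp_s[n [k [h [hs e]]]]; rewrite mem_undup; apply/mapP.
by exists h => //; apply/esym/coset_rep_eq; exists n, k.
Qed.

Lemma ind_sum_elt (x : ind M) t : support_reps x t ->
  x = \sum_(h <- t) elt h^-1%g (ind_fun x h).
Proof.
move=> [uniq_t rep_t supp_t]; apply: ind_eq => g; rewrite ind_fun_sum.
have off_coset h : h \in t -> h != coset_rep g ->
    ind_fun (elt h^-1%g (ind_fun x h)) g = 0.
  move=> ht hg; rewrite ind_fun_elt0 // => -[[n k] /= e].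
  case/negP: hg; rewrite -(rep_t h ht); apply/eqP/coset_rep_eq.
  by exists n, k; rewrite -e mulgVK.
have [gt|gNt] := boolP (coset_rep g \in t); last first.
  rewrite big_seq big1 => [|h ht].
    by apply/eqP; move: gNt; apply: contraNT => /supp_t.
  by apply: off_coset => //; apply: contraNneq gNt => <-.
rewrite (bigD1_seq _ gt uniq_t) /= big_seq_cond big1 ?addr0; last first.
  by move=> h /andP[ht hg]; apply: off_coset.
have [n [k e]] := coset_repP g.
have gE : (g * (coset_rep g)^-1)%g = KZelt (- n) k^-1%g.
  by rewrite e invgM mulgA mulgV mul1g KZeltV.
by rewrite (ind_fun_elt _ gE) e ind_funK -actM mulVg act1.
Qed.

Lemma ind_generated (x : ind M) : exists2 s : seq (G * M),
  x = \sum_(gv <- s) elt gv.1 gv.2 &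
  forall gv, gv \in s -> exists g, gv.2 = ind_fun x g.
Proof.
have [t xt] := support_reps_ex x.
exists [seq (h^-1%g, ind_fun x h) | h <- t].
  by rewrite big_map /= -(ind_sum_elt xt).
by move=> _ /mapP[h _ ->]; exists h.
Qed.

Lemma elt_ind_in (S : subrep M) (g : G) (x : M) : S x -> ind_in S (elt g x).
Proof.
move=> Sx g'.
have [[[n k] /= e]|ne] := pselect (exists nk, (g' * g)%g = KZelt nk.1 nk.2).
  by rewrite (ind_fun_elt x e); apply: subrep_act.
by rewrite ind_fun_elt0 //; apply: (smem0 S).
Qed.

End OneRep.

Section Maps.
Variables (R R' : comNzRingType) (M : rep OF R) (N : rep OF R').
Variable u : equivar M N.

Lemma ind_map_elt g v : ind_map u (elt g v) = elt g (u v).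
Proof.
apply: ind_eq => g'; rewrite -[LHS]/(u (ind_fun (elt g v) g')).
have [[[n k] /= e]|ne] := pselect (exists nk, (g' * g)%g = KZelt nk.1 nk.2).
  by rewrite !(ind_fun_elt _ e); apply: equivar_act.
by rewrite !ind_fun_elt0 // raddf0.
Qed.

Lemma ind_map_zmod : zmod_morphism (ind_map u).
Proof. by move=> x y; apply: ind_eq => g; apply: (raddfB u). Qed.

HB.instance Definition _ :=
  GRing.isZmodMorphism.Build (ind M) (ind N) (ind_map u) ind_map_zmod.

Lemma ind_map_sum_elt (I : finType) (g : I -> G) (v : I -> M) :
  ind_map u (\sum_i elt (g i) (v i)) = \sum_i elt (g i) (u (v i)).
Proof. by rewrite raddf_sum; apply: eq_bigr => i _; apply: ind_map_elt. Qed.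

Lemma ind_map_semilinear (phi : R -> R') :
  (forall a v, u (a *: v) = phi a *: u v) ->
  forall a x, ind_map u (a *: x) = phi a *: ind_map u x.
Proof. by move=> uZ a x; apply: ind_eq => g; apply: uZ. Qed.

Lemma ind_map_surj : (forall w, exists v, u v = w) ->
  forall y, exists x, ind_map u x = y.
Proof.
move=> /choice[l uK] y; have [s -> _] := ind_generated y.
exists (\sum_(gv <- s) elt gv.1 (l gv.2)); rewrite raddf_sum.
by apply: eq_bigr => gv _; rewrite /= ind_map_elt uK.
Qed.

End Maps.

Lemma ind_map_linear (R : comNzRingType) (M N : rep OF R) (u : equivar M N) :
  linear u -> linear (ind_map u).
Proof. by move=> u_lin a x y; apply: ind_eq => g; apply: u_lin. Qed.

Lemma ind_map_sub_incl_linear (R : comNzRingType) (M : rep OF R) (N : subrep M) :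
  linear (ind_map (sub_incl N)).
Proof. exact: (ind_map_linear (u := sub_incl N)). Qed.

Lemma ind_quot_factor (R : comNzRingType) (M : rep OF R) (N : subrep M)
    (C : lmodType R) (psi : {linear ind M -> C}) :
  (forall g v, N v -> psi (elt g v) = 0) ->
  exists psi' : {linear ind (quot_rep N) -> C},
    forall x, psi' (ind_map (quot_proj N) x) = psi x.
Proof.
move=> psiN.
have [q qE] := linear_fun_ex (ind_map_linear (u := quot_proj N) (linearP (qclass N))).
have [y|x|psi' psi'E] := @linear_factor _ _ _ _ q psi.
- have [w|x <-] := ind_map_surj (u := quot_proj N) _ y; last by exists x.
  by exists (repr w); apply: qclass_repr.
- rewrite qE => x0; have [s xE s_val] := ind_generated x.
  rewrite xE linear_sum big_seq big1 // => gv /s_val[g gvE]; apply: psiN.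
  by apply/qclass_eq0; rewrite gvE -[LHS]/(ind_fun (ind_map (quot_proj N) x) g) x0.
by exists psi' => x; rewrite -psi'E qE.
Qed.

End Induced.

(** * Base p digits and power sums *)

Lemma expr_eq_mod (R : nzSemiRingType) (q : nat) (x : R) (a b : nat) :
  x ^+ q = x -> (0 < q)%N -> (0 < a)%N -> (0 < b)%N -> a = b %[mod q - 1] ->
  x ^+ a = x ^+ b.
Proof.
move=> xq q_gt0.
wlog le_ab : a b / (a <= b)%N => [wlog_le a_gt0 b_gt0 e|a_gt0 _ e].
  by case/orP: (leq_total a b) => ?; [apply: wlog_le | apply/esym/wlog_le].
have add_period n : x ^+ (a + n * (q - 1)) = x ^+ a.
  elim: n => [|n IH]; first by rewrite mul0n addn0.
  have -> : (a + n.+1 * (q - 1) = (a + n * (q - 1)).-1 + q)%N by nia.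
  by rewrite exprD xq -exprSr prednK ?IH //; lia.
move/eqP: e; rewrite eq_sym eqn_mod_dvd // => /dvdnP[n e].
by rewrite -(subnKC le_ab) e add_period.
Qed.

Lemma mod_pos_repr (n a : nat) : (0 < a)%N -> (0 < n)%N ->
  exists2 b, (0 < b <= n)%N & b = a %[mod n].
Proof.
move=> a_gt0 n_gt0; exists (a.-1 %% n).+1; first by rewrite /= ltn_mod.
by rewrite -addn1 modnDml addn1 prednK.
Qed.

Lemma sum_delta f (i : 'I_f) : (\sum_t (t == i) = 1)%N.
Proof. by rewrite (bigD1 i) //= eqxx big1 // => t /negPf ->. Qed.

Lemma sum_le1_delta f (d : 'I_f -> nat) : (\sum_i d i <= 1)%N ->
  (forall i, d i = 0%N) \/ exists i, forall t, d t = (t == i).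
Proof.
move=> sum_le1; have [d0|/existsNP[i /eqP di]] := pselect (forall i, d i = 0%N).
  by left.
right; exists i => t; have [->|ti] := eqVneq t i.
  apply/eqP; rewrite eqn_leq lt0n di andbT; apply: leq_trans sum_le1.
  by rewrite (bigD1 i) //= leq_addr.
by move: sum_le1; rewrite (bigD1 i) //= (bigD1 t) //=; lia.
Qed.

Lemma ord_cycle_ind f (P : 'I_f -> Prop) (i0 : 'I_f) :
  (forall i, P i -> P (ordS i)) -> P i0 -> forall i, P i.
Proof.
move=> P_ordS P_i0.
have iter_ordS n : P (iter n (@ordS f) i0) /\ iter n (@ordS f) i0 = ((i0 + n) %% f)%N :> nat.
  elim: n => [|n [IH e]]; first by rewrite addn0 modn_small.
  by split; [apply: P_ordS | rewrite iterS /= e -addn1 modnDml addn1 addnS].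
move=> i; have [Pi e] := iter_ordS (i + (f - i0))%N.
suff <- : iter (i + (f - i0)) (@ordS f) i0 = i by [].
by apply/val_inj; rewrite /= e addnCA subnKC ?modnDr ?modn_small // ltnW.
Qed.

Lemma binomial_widen p (R : comNzRingType) (x y : R) n : (n < p)%N ->
  (x + y) ^+ n = \sum_(k < p) y ^+ k * ('C(n, k)%:R * x ^+ (n - k)).
Proof.
move=> lt_np; rewrite exprDn.
rewrite (big_ord_widen _ (fun k => (x ^+ (n - k) * y ^+ k) *+ 'C(n, k)) lt_np).
rewrite [RHS](bigID (fun k : 'I_p => (k < n.+1)%N)) /= [X in _ = _ + X]big1 ?addr0.
  by apply: eq_bigr => k _; rewrite -mulr_natr; ring.
by move=> k; rewrite -leqNgt => /bin_small ->; rewrite mul0r mulr0.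
Qed.

Section Digits.
Variable p : nat.

Definition ofdigits f (b : 'I_f -> nat) : nat := \sum_(i < f) b i * p ^ i.

Lemma ofdigits_recl f (b : 'I_f.+1 -> nat) :
  ofdigits b = (b ord0 + p * ofdigits (fun i => b (lift ord0 i)))%N.
Proof.
rewrite /ofdigits big_ord_recl expn0 muln1 big_distrr; congr (_ + _)%N.
by apply: eq_bigr => i _; rewrite /= /bump /= add1n expnS; lia.
Qed.

Lemma eq_ofdigits f (b c : 'I_f -> nat) : b =1 c -> ofdigits b = ofdigits c.
Proof. by move=> e; apply: eq_bigr => i _; rewrite e. Qed.

Lemma ofdigitsD f (b c : 'I_f -> nat) :
  ofdigits (fun i => (b i + c i)%N) = (ofdigits b + ofdigits c)%N.
Proof. by rewrite /ofdigits -big_split; apply: eq_bigr => i _; rewrite mulnDl. Qed.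

Lemma ofdigitsB f (b c : 'I_f -> nat) : (forall i, c i <= b i)%N ->
  ofdigits (fun i => (b i - c i)%N) = (ofdigits b - ofdigits c)%N.
Proof.
move=> le_cb; apply/eqP; rewrite -(eqn_add2r (ofdigits c)) -ofdigitsD subnK.
  by apply/eqP/eq_ofdigits => i; rewrite subnK.
by apply: leq_sum => i _; rewrite leq_mul2r le_cb orbT.
Qed.

Lemma leq_ofdigits f (b c : 'I_f -> nat) :
  (forall i, b i <= c i)%N -> (ofdigits b <= ofdigits c)%N.
Proof. by move=> le_bc; apply: leq_sum => i _; rewrite leq_mul2r le_bc orbT. Qed.

Lemma leq_digit_ofdigits f (b : 'I_f -> nat) i : (b i * p ^ i <= ofdigits b)%N.
Proof. by rewrite /ofdigits (bigD1 i) //= leq_addr. Qed.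

Lemma ofdigits_scale_delta f (i : 'I_f) n :
  ofdigits (fun j => (n * (j == i))%N) = (n * p ^ i)%N.
Proof.
rewrite /ofdigits (bigD1 i) //= eqxx muln1 big1 ?addn0 // => j /negPf ->.
by rewrite muln0.
Qed.

Lemma ofdigits_delta f (i : 'I_f) : ofdigits (fun j => (j == i : nat)) = (p ^ i)%N.
Proof.
by rewrite -[RHS]mul1n -ofdigits_scale_delta; apply: eq_ofdigits => j; rewrite mul1n.
Qed.

Lemma ofdigits0 f (b : 'I_f -> nat) : b =1 (fun=> 0%N) -> ofdigits b = 0%N.
Proof. by move=> b0; rewrite /ofdigits big1 // => i _; rewrite b0. Qed.

Lemma prodr_expr_ofdigits f (R : comNzRingType) (x : R) (b : 'I_f -> nat) :
  \prod_(i < f) (x ^+ (p ^ i)) ^+ b i = x ^+ ofdigits b.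
Proof. by rewrite -prodrXr; apply: eq_bigr => i _; rewrite -exprM mulnC. Qed.

Lemma ofdigits_ltn f (b : 'I_f -> nat) :
  (forall i, b i < p)%N -> (ofdigits b < p ^ f)%N.
Proof.
elim: f b => [|f IH] b lt_bp; first by rewrite /ofdigits big_ord0 expn0.
have lt_tail := IH _ (fun i => lt_bp (lift ord0 i)).
apply: leq_trans (_ : p * (ofdigits (fun i => b (lift ord0 i))).+1 <= _)%N.
  by rewrite ofdigits_recl mulnS ltn_add2r.
by rewrite expnS leq_mul2l lt_tail orbT.
Qed.

Definition digits f (n : {ffun 'I_f -> 'I_p}) : 'I_f -> nat := fun i => n i.

Lemma digits_ex f (b : 'I_f -> nat) :
  (forall i, b i < p)%N -> exists n : {ffun 'I_f -> 'I_p}, digits n = b.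
Proof.
move=> lt_bp; exists [ffun i => Ordinal (lt_bp i)].
by apply/funext => i; rewrite /digits ffunE.
Qed.

Lemma ofdigits_digits_ltn f (n : {ffun 'I_f -> 'I_p}) :
  (ofdigits (digits n) < p ^ f)%N.
Proof. by apply: ofdigits_ltn => i; apply: ltn_ord. Qed.

Lemma ofdigits_digits_leq f (n : {ffun 'I_f -> 'I_p}) :
  (ofdigits (digits n) <= p ^ f - 1)%N.
Proof. by have := ofdigits_digits_ltn n; lia. Qed.

Hypothesis p_gt1 : (1 < p)%N.

Lemma ofdigits_inj f (b c : 'I_f -> nat) : (forall i, b i < p)%N ->
  (forall i, c i < p)%N -> ofdigits b = ofdigits c -> b =1 c.
Proof.
elim: f b c => [|f IH] b c lt_bp lt_cp; first by move=> _ [].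
rewrite !ofdigits_recl => e.
have e0 : b ord0 = c ord0.
  have := congr1 (modn^~ p) e.
  by rewrite !(mulnC p) !(addnC _ (_ * p)%N) !modnMDl !modn_small.
move: e; rewrite e0 => /addnI/eqP; rewrite eqn_pmul2l; last exact: ltnW.
move=> /eqP/IH e i; case: (unliftP ord0 i) => [j ->|-> //].
by apply: e.
Qed.

Lemma ltn_ofdigits f (b c : 'I_f -> nat) i : (forall i, b i <= c i)%N ->
  (b i < c i)%N -> (ofdigits b < ofdigits c)%N.
Proof.
move=> le_bc lt_bci; rewrite -subn_gt0 -ofdigitsB //.
apply: leq_trans (leq_digit_ofdigits _ i).
by rewrite muln_gt0 subn_gt0 lt_bci expn_gt0 ltnW.
Qed.

Lemma ofdigits_gt0 f (b : 'I_f -> nat) i : (0 < b i)%N -> (0 < ofdigits b)%N.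
Proof.
move=> bi; apply: leq_trans (leq_digit_ofdigits b i).
by rewrite muln_gt0 bi expn_gt0 ltnW.
Qed.

Lemma ofdigits_eq0 f (b : 'I_f -> nat) : ofdigits b = 0%N -> b =1 (fun=> 0%N).
Proof. by move=> b0 i; case: posnP (@ofdigits_gt0 _ b i) => // _ /(_ isT); rewrite b0. Qed.

Lemma ofdigits_digits_inj f :
  injective (fun n : {ffun 'I_f -> 'I_p} => ofdigits (digits n)).
Proof.
move=> n n' /ofdigits_inj e; apply/ffunP => i; apply/val_inj.
by apply: e => j; apply: ltn_ord.
Qed.

End Digits.

Arguments ofdigits_digits_inj {p} p_gt1 {f}.

Definition prod_bin (R : comNzRingType) f (b k : 'I_f -> nat) : R :=
  \prod_i 'C(b i, k i)%:R.

Lemma prod_bin_small (R : comNzRingType) f (b k : 'I_f -> nat) :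
  ~ (forall i, k i <= b i)%N -> prod_bin R b k = 0.
Proof.
by move=> /existsNP[i /negP]; rewrite -ltnNge => lt_bk;
   rewrite /prod_bin (bigD1 i) //= bin_small // mul0r.
Qed.

Section CharP.
Variables (p : nat) (R : comNzRingType).
Hypothesis p_pchar : p \in [pchar R].

Lemma exprD_pchar_pow (x y : R) i : (x + y) ^+ (p ^ i) = x ^+ (p ^ i) + y ^+ (p ^ i).
Proof.
rewrite exprDn_pchar // pnatX pnatE ?p_pchar //.
by case/andP: p_pchar.
Qed.

Lemma exprD_ofdigits f (x y : R) (b : 'I_f -> nat) : (forall i, b i < p)%N ->
  (x + y) ^+ ofdigits p b =
  \sum_(k : {ffun 'I_f -> 'I_p}) y ^+ ofdigits p (digits k) *
     (prod_bin R b (digits k) * x ^+ ofdigits p (fun i => (b i - k i)%N)).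
Proof.
move=> lt_bp; rewrite -prodr_expr_ofdigits.
under eq_bigr => i _ do rewrite exprD_pchar_pow (binomial_widen _ _ (lt_bp i)).
rewrite bigA_distr_bigA; apply: eq_bigr => k _.
by rewrite !big_split /= !prodr_expr_ofdigits.
Qed.

End CharP.

Lemma bin_pchar_neq0 p (R : idomainType) n k : p \in [pchar R] ->
  (k <= n < p)%N -> 'C(n, k)%:R != 0 :> R.
Proof.
move=> p_pchar /andP[le_kn lt_np]; rewrite -(dvdn_pcharf p_pchar).
have p_prime := pcharf_prime p_pchar.
have fact_ndvd m : (m < p)%N -> ~~ (p %| m`!)%N.
  elim: m => [|m IH] lt_mp; first by rewrite gtnNdvd // prime_gt1.
  by rewrite factS Euclid_dvdM // negb_or gtnNdvd //= IH // ltnW.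
apply: contra (fact_ndvd n lt_np) => dvd_bin.
by rewrite -(bin_fact le_kn) dvdn_mulr.
Qed.

Lemma prod_bin_unit p (R : fieldType) f (b k : 'I_f -> nat) : p \in [pchar R] ->
  (forall i, k i <= b i < p)%N -> prod_bin R b k \is a GRing.unit.
Proof.
move=> p_pchar range; rewrite unitfE; apply/prodf_neq0 => i _.
exact: (bin_pchar_neq0 p_pchar).
Qed.

Section PowerSums.
Variable k : finFieldType.
Local Notation q := #|k|.

Lemma natr_card_finField : q%:R = 0 :> k.
Proof.
apply: (addrI (\sum_(z : k) z)); rewrite addr0 [RHS](reindex_inj (addIr 1)) big_split.
by rewrite sumr_const cardT.
Qed.

Lemma finField_expr_neq1 e : ~~ (q.-1 %| e)%N -> exists2 g : k, g != 0 & g ^+ e != 1.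
Proof.
have /cyclicP[x xE] := field_unit_group_cyclic [set: {unit k}]%G.
rewrite -card_finField_unit xE -orderE order_dvdn => xe.
exists (FinRing.uval x); first by rewrite -unitfE (valP x).
by apply: contra xe => /eqP xe1; apply/eqP/val_inj; rewrite /= FinRing.val_unitX.
Qed.

Lemma sum_expr_finField e : (0 < e)%N ->
  \sum_(z : k) z ^+ e = - (q.-1 %| e)%N%:R.
Proof.
move=> e_gt0; have [/dvdnP[n eE]|/finField_expr_neq1[g g0 ge]] := boolP (q.-1 %| e)%N.
  have expr1 z : z != 0 :> k -> z ^+ e = 1.
    move=> z0; rewrite eE mulnC exprM -[RHS](expr1n _ n); congr (_ ^+ _).
    by apply: (mulfI z0); rewrite mulr1 -exprS prednK ?expf_card // ltnW ?finRing_gt1.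
  rewrite (bigD1 0) //= expr0n eqn0Ngt e_gt0 add0r (eq_bigr _ expr1) sumr_const.
  rewrite (eq_card (_ : _ =i predC1 0)) // cardC1; apply/eqP.
  by rewrite -addr_eq0 natr1 prednK ?natr_card_finField // ltnW ?finRing_gt1.
apply/eqP; rewrite oppr0; set S := \sum_z _.
have : (g ^+ e - 1) * S == 0.
  rewrite mulrBl mul1r subr_eq0 [X in _ == X](reindex_inj (mulfI g0)) mulr_sumr.
  by apply/eqP/eq_bigr => z _; rewrite exprMn.
by rewrite mulf_eq0 subr_eq0 (negPf ge).
Qed.

Lemma sum_translate_finField (c : k) e : (0 < e)%N ->
  \sum_(z : k) (z - c) ^+ e = - (q.-1 %| e)%N%:R.
Proof.
move=> e_gt0; rewrite -sum_expr_finField // (reindex_inj (addIr c)).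
by apply: eq_bigr => z _; rewrite addrK.
Qed.

Lemma sum_expr_compl_finField (a b : nat) : (0 < a < q)%N -> (b < q)%N ->
  \sum_(z : k) z ^+ (q.-1 - a + b) = - (a == b)%:R.
Proof.
move=> a_range b_lt.
have [e0|e_gt0] := posnP (q.-1 - a + b)%N.
  rewrite e0; under eq_bigr do rewrite expr0.
  rewrite sumr_const natr_card_finField.
  by have [ab|] := eqVneq a b; rewrite ?oppr0 //; move: e0; rewrite ab; lia.
rewrite sum_expr_finField //; congr (- _%:R); congr nat_of_bool.
apply/idP/eqP => [/dvdnP[n nE]|<-]; last by rewrite subnK ?dvdnn //; lia.
have n_lt2 : (n < 2)%N by rewrite -(ltn_pmul2r (_ : 0 < q.-1)%N) -?nE; lia.
by case: n nE n_lt2 => [|[|//]]; lia.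
Qed.

Variables (R : comNzRingType) (iota : {rmorphism k -> R}) (U : lmodType R).
Variables (I : finType) (e : I -> nat) (x : I -> U) (S : submodule U).
Hypotheses (e_inj : injective e) (e_lt : forall i, (e i < q)%N).

(* Multiplying by z^(q-1-e_i) and summing over z picks out the i-th coefficient. *)
Lemma mem_power_coef_sub (y : U) i : (0 < e i)%N ->
  (forall z, S (\sum_j iota z ^+ e j *: x j - y)) -> S (x i).
Proof.
move=> ei_gt0 S_sum; have ei_range : (0 < e i < q)%N by rewrite ei_gt0 e_lt.
have sum_z b : (b < q)%N ->
    \sum_(z : k) iota z ^+ (q.-1 - e i) * iota z ^+ b = - (e i == b)%:R.
  move=> b_lt; under eq_bigr do rewrite -exprD -rmorphXn.
  by rewrite -rmorph_sum sum_expr_compl_finField // rmorphN rmorph_nat.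
have -> : x i = - \sum_z iota z ^+ (q.-1 - e i) *: (\sum_j iota z ^+ e j *: x j - y).
  under eq_bigr do rewrite scalerBr scaler_sumr; rewrite sumrB -scaler_suml exchange_big.
  have -> : \sum_z iota z ^+ (q.-1 - e i) = 0.
    rewrite (eq_bigr (fun z => iota z ^+ (q.-1 - e i) * iota z ^+ 0)); last first.
      by move=> z _; rewrite mulr1.
    by rewrite sum_z ?(gtn_eqF ei_gt0) ?oppr0 // ltnW ?finRing_gt1.
  under eq_bigr => j _.
    under eq_bigr do rewrite scalerA; rewrite -scaler_suml sum_z //.
    over.
  rewrite scale0r subr0 (bigD1 i) //= eqxx scaleN1r big1 ?addr0 ?opprK // => j ji.
  by rewrite (inj_eq e_inj) eq_sym (negPf ji) oppr0 scale0r.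
by apply: smemN; apply: smem_sum => z _; apply: smemZ.
Qed.

Lemma mem_power_coef i : (forall z, S (\sum_j iota z ^+ e j *: x j)) -> S (x i).
Proof.
move=> S_sum; have [ei0|ei_gt0] := posnP (e i); last first.
  by apply: (@mem_power_coef_sub 0) => // z; rewrite subr0.
have := S_sum 0; rewrite (bigD1 i) //= ei0 expr0 scale1r rmorph0 big1 ?addr0 // => j ji.
by rewrite expr0n -ei0 (inj_eq e_inj) (negPf ji) scale0r.
Qed.

End PowerSums.

Lemma sum_mobius_finField (k : finFieldType) (A : nmodType) (F : k -> A) (z : k) :
  \sum_(c | 1 - z * c != 0) F c = \sum_(c | 1 + z * c != 0) F (c / (1 + z * c)).
Proof.
rewrite (reindex_onto (fun c => c / (1 + z * c)) (fun c => c / (1 - z * c))) /=; last first.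
  move=> c c_neq; have -> : 1 + z * (c / (1 - z * c)) = (1 - z * c)^-1 by field.
  by rewrite invrK divfK.
apply: eq_bigl => c; have [c0|c_neq0] := eqVneq (1 + z * c) 0.
  rewrite c0 invr0 !mulr0 subr0 oner_neq0 invr1 mulr1 /=.
  by apply/eqP => c_eq0; move: c0; rewrite -c_eq0 mulr0 addr0 => /eqP; rewrite oner_eq0.
have -> : 1 - z * (c / (1 + z * c)) = (1 + z * c)^-1 by field.
by rewrite invr_eq0 c_neq0 invrK divfK // eqxx.
Qed.

(** * Multihomogeneous polynomials *)

Section MultihomPolynomials.
Variables (f : nat) (R : comNzRingType).
Local Notation P := {mpoly R[f + f]}.

Definition expX (m : 'X_{1..f + f}) (i : 'I_f) : nat := m (lshift f i).
Definition expY (m : 'X_{1..f + f}) (i : 'I_f) : nat := m (rshift f i).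

Definition mon (a b : 'I_f -> nat) : 'X_{1..f + f} :=
  [multinom match fintype.split j with inl i => a i | inr i => b i end
   | j < f + f].

Lemma expX_mon a b i : expX (mon a b) i = a i.
Proof. by rewrite /expX mnmE (fintype.unsplitK (inl i)). Qed.

Lemma expY_mon a b i : expY (mon a b) i = b i.
Proof. by rewrite /expY mnmE (fintype.unsplitK (inr i)). Qed.

Lemma eq_mnm_expXY m m' : expX m =1 expX m' -> expY m =1 expY m' -> m = m'.
Proof.
move=> eX eY; apply/mnmP => j; rewrite -[j]fintype.splitK.
by case: (fintype.split j) => i; [apply: eX | apply: eY].
Qed.

Lemma mpolyX_mon a b : 'X_[mon a b] =
  (\prod_i varX R i ^+ a i) * (\prod_i varY R i ^+ b i) :> P.
Proof.
rewrite mpolyXE_id big_split_ord; congr (_ * _); apply: eq_bigr => i _.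
  by rewrite -[mon a b _]/(expX (mon a b) i) expX_mon.
by rewrite -[mon a b _]/(expY (mon a b) i) expY_mon.
Qed.

Lemma varXY_mpolyX i j c d a b :
  varX R i ^+ c * varY R j ^+ d * 'X_[mon a b] =
  'X_[mon (fun t => a t + c * (t == i))%N (fun t => b t + d * (t == j))%N].
Proof.
rewrite !mpolyX_mon mulrACA [varX R i ^+ c * _]mulrC [varY R j ^+ d * _]mulrC.
have expr_delta (u : 'I_f -> P) n l : u l ^+ n = \prod_t u t ^+ (n * (t == l)).
  rewrite (bigD1 l) //= eqxx muln1 big1 ?mulr1 // => t /negPf ->.
  by rewrite muln0.
rewrite (expr_delta (varX R)) (expr_delta (varY R)).
by congr (_ * _); rewrite -big_split; apply: eq_bigr => t _; rewrite exprD.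
Qed.

Variable r : 'I_f -> nat.

Lemma mpolyX_multihom m :
  (forall i, expX m i + expY m i = r i)%N -> ('X_[m] : P) \in multihom r.
Proof. by move=> deg_m; apply/multihomP => m'; rewrite msuppX inE => /eqP ->. Qed.

Definition vmon (b : 'I_f -> nat) : polyV R r :=
  insubd (0 : polyV R r) 'X_[mon (fun i => (r i - b i)%N) b].

Lemma val_vmon b : (forall i, b i <= r i)%N ->
  val (vmon b) = 'X_[mon (fun i => (r i - b i)%N) b].
Proof.
move=> le_br; rewrite val_insubd mpolyX_multihom // => i.
by rewrite expX_mon expY_mon subnK.
Qed.

Lemma polyV_vmon (u : polyV R r) m : val u = 'X_[m] ->
  (forall i, expY m i <= r i)%N /\ u = vmon (expY m).
Proof.
move=> uE; have deg_m i : (expX m i + expY m i = r i)%N.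
  by have /multihomP := valP u; apply; rewrite uE msuppX inE.
have le_mr i : (expY m i <= r i)%N by rewrite -deg_m leq_addl.
split=> //; apply/val_inj; rewrite uE val_vmon //; congr mpolyX.
by apply: eq_mnm_expXY => i; rewrite ?expX_mon ?expY_mon // -deg_m addnK.
Qed.

Lemma polyV_sum_mon (v : polyV R r) :
  v = \sum_(m <- msupp (val v)) (val v)@_m *: vmon (expY m).
Proof.
apply/val_inj; rewrite raddf_sum {1}[val v]mpolyE; apply: eq_big_seq => m vm.
have deg_m i : (expX m i + expY m i = r i)%N by have /multihomP := valP v; apply.
have [|_ <- //] := @polyV_vmon (Sub 'X_[m] (mpolyX_multihom deg_m)) m.
by [].
Qed.

Lemma polyV_ind (S : submodule (polyV R r)) :
  (forall b, (forall i, b i <= r i)%N -> S (vmon b)) -> forall v, S v.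
Proof.
move=> S_vmon v; rewrite [v]polyV_sum_mon big_seq; apply: smem_sum => m vm.
apply: smemZ; apply: S_vmon => i; have /multihomP/(_ m vm i) <- := valP v.
exact: leq_addl.
Qed.

Lemma linprod_multihom (a b : 'I_f -> R) :
  \prod_i (a i *: varX R i + b i *: varY R i) ^+ r i \in multihom r.
Proof.
have lin i : a i *: varX R i + b i *: varY R i \in multihom (fun j => i == j : nat).
  by apply: rpredD; apply: rpredZ; [apply: varX_multihom | apply: varY_multihom].
have := multihom_prod (index_enum 'I_f) (fun i => multihomX (r i) (lin i)).
congr (_ \in multihom _); apply/funext => j.
by rewrite (bigD1 j) //= eqxx mul1n big1 ?addn0 // => i /negPf ->.
Qed.

Definition linprod (a b : 'I_f -> R) : polyV R r :=
  Sub (\prod_i (a i *: varX R i + b i *: varY R i) ^+ r i) (linprod_multihom a b).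

Lemma eq_linprod a a' b b' : a =1 a' -> b =1 b' -> linprod a b = linprod a' b'.
Proof. by move=> /funext -> /funext ->. Qed.

Lemma linprodZ (c a b : 'I_f -> R) :
  linprod (fun i => c i * a i) (fun i => c i * b i) =
  (\prod_i c i ^+ r i) *: linprod a b.
Proof.
apply/val_inj; rewrite /= -scaler_prod; apply: eq_bigr => i _.
by rewrite -exprZn scalerDr !scalerA.
Qed.

Lemma psubst_linprod (A : 'I_f -> 'M[R]_2) a b : psubst A (linprod a b) =
  linprod (fun i => A i 0 0 * a i + A i 0 1 * b i)
          (fun i => A i 1 0 * a i + A i 1 1 * b i).
Proof.
apply/val_inj; rewrite /= /lsubst rmorph_prod; apply: eq_bigr => i _.
rewrite rmorphXn /= linearD !linearZ /= -!/(lsubst A _).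
rewrite lsubstX lsubstY !scalerDr !scalerA addrACA -!scalerDl.
by rewrite ![_ * A i _ _]mulrC.
Qed.

Lemma linprod10 : linprod (fun=> 1) (fun=> 0) = vmon (fun=> 0%N).
Proof.
apply/val_inj; rewrite val_vmon // mpolyX_mon [X in _ * X]big1 ?mulr1 //=.
by apply: eq_bigr => i _; rewrite scale0r addr0 scale1r subn0.
Qed.

Lemma linprod01 : linprod (fun=> 0) (fun=> 1) = vmon r.
Proof.
apply/val_inj; rewrite val_vmon // mpolyX_mon [X in X * _]big1 ?mul1r /=.
  by apply: eq_bigr => i _; rewrite scale0r add0r scale1r.
by move=> i _; rewrite subnn.
Qed.

Lemma psubst_linear A : linear (@psubst f R A r).
Proof. by move=> a u v; apply/val_inj; rewrite /= /lsubst linearP. Qed.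

HB.instance Definition _ A := GRing.isLinear.Build R (polyV R r) (polyV R r) _
  (psubst A (r := r)) (psubst_linear A).

Lemma val_psubst_vmon A b : (forall i, b i <= r i)%N ->
  val (psubst A (vmon b)) =
  (\prod_i (A i 0 0 *: varX R i + A i 1 0 *: varY R i) ^+ (r i - b i)) *
  (\prod_i (A i 0 1 *: varX R i + A i 1 1 *: varY R i) ^+ b i).
Proof.
move=> le_br; rewrite /= val_vmon // /lsubst mpolyX_mon rmorphM !rmorph_prod /=.
by congr (_ * _); apply: eq_bigr => i _; rewrite rmorphXn /= ?comp_mpolyXU -tnth_nth
  ?lin_formsX ?lin_formsY.
Qed.

Lemma linprod_digits p (t : R) : (forall i, r i < p)%N ->
  linprod (fun=> 1) (fun i => t ^+ (p ^ i)) =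
  \sum_(k : {ffun 'I_f -> 'I_p}) t ^+ ofdigits p (digits k) *:
    (prod_bin R r (digits k) *: vmon (digits k)).
Proof.
move=> lt_rp; apply/val_inj; rewrite raddf_sum /=.
under eq_bigr => i _ do rewrite scale1r (binomial_widen _ _ (lt_rp i)).
rewrite bigA_distr_bigA; apply: eq_bigr => k _ /=.
under eq_bigr => i _ do rewrite exprZn -scalerAl mulr_natl -scaler_nat -scalerAr scalerA.
rewrite scaler_prod big_split prodr_expr_ofdigits -scalerA -/(prod_bin R r (digits k)).
congr (_ *: _); have [le_kr|lt_rk] := pselect (forall i, digits k i <= r i)%N.
  congr (_ *: _); rewrite val_vmon // mpolyX_mon -big_split.
  by apply: eq_bigr => i _; rewrite mulrC.
by rewrite prod_bin_small // !scale0r.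
Qed.

End MultihomPolynomials.

Arguments vmon {f} R r b.
Arguments linprod {f R} r a b.

Lemma exprN_odd (R : nzRingType) (x : R) n : odd n -> (- x) ^+ n = - x ^+ n.
Proof. by move=> odd_n; rewrite exprNn -signr_odd odd_n expr1 mulN1r. Qed.

Lemma val_intring_nat (K : fieldType) (v : valuation K) n :
  val (n%:R : intring v) = n%:R.
Proof. exact: (rmorph_nat (\val : intring v -> K)). Qed.

Section Residues.
Variables (p f : nat) (D : padic_setting p f).
Local Notation kb := (kbar D).
Local Notation sb := (structkbar D).
Local Notation q1 := (p ^ f - 1)%N.

Lemma p_gt1 : (1 < p)%N. Proof. exact/prime_gt1/p_prime/D. Qed.

Lemma expp_gt0 i : (0 < p ^ i)%N. Proof. by rewrite expn_gt0 ltnW ?p_gt1. Qed.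

Lemma pred_card_kF : #|kF D|.-1 = q1. Proof. by rewrite card_kF subn1. Qed.

Lemma resF_p : resF D p%:R = 0.
Proof. by apply/resF_ker; rewrite val_intring_nat /vgt vF_p ltr01 orbT. Qed.

Lemma resF_frobn i x : resF D (frobn i x) = resF D x ^+ (p ^ i).
Proof.
rewrite /frobn; elim: i => [|i IH]; first by rewrite expn0 expr1.
by rewrite iterS frobP IH -exprM expnSr.
Qed.

Lemma resF_eq0_dvd x : resF D x = 0 -> exists y, x = p%:R * y.
Proof.
move/resF_ker; rewrite /vgt; case: eqVneq => [x0 _|x_neq0 /= vx_gt0].
  by exists 0; apply/val_inj; rewrite /= mulr0.
have [n vxE] := F_unramified x_neq0.
have int_quo : val x / p%:R \in intring_pred (vF D).
  rewrite unfold_in /vge /= vfunM ?invr_eq0 ?pF_neq0 // vV ?pF_neq0 // vF_p vxE.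
  move: vx_gt0; rewrite vxE ltr0z gtz0_ge1 -(ler_int rat) subr_ge0 => ->.
  by rewrite orbT.
exists (Sub (val x / p%:R) int_quo); apply/val_inj.
by rewrite /= val_intring_nat mulrC divfK ?pF_neq0.
Qed.

Lemma resF_eq_mod x y : resF D x = resF D y -> exists z, x = y + p%:R * z.
Proof.
move=> e; have [|z xyE] := @resF_eq0_dvd (x - y); first by rewrite rmorphB e subrr.
by exists z; rewrite -xyE subrKC.
Qed.

Lemma kF_pchar : p \in [pchar (kF D)].
Proof. by rewrite !inE (p_prime D) /= -(rmorph_nat (resF D)) resF_p eqxx. Qed.

Lemma kbar_natp : p%:R = 0 :> kb.
Proof. exact: pcharf0 (kbar_pchar D). Qed.

Lemma structkbar_eq0 x : sb x = 0 <-> resF D x = 0.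
Proof.
rewrite resF_ker; split; last first.
  move=> vx; apply/redE_ker; move: vx; rewrite /vgt /=.
  case: eqVneq => [-> _|x0 /=]; first by rewrite scale0r eqxx.
  by rewrite vE_F // => ->; rewrite orbT.
move/redE_ker; rewrite /vgt /=; case: (eqVneq (val x) 0) => //= x0.
by rewrite scaler_eq0 (negPf x0) oner_eq0 /= vE_F.
Qed.

Lemma structkbar_eq x y : sb x = sb y <-> resF D x = resF D y.
Proof.
split=> e; apply/subr0_eq; rewrite -rmorphB; apply/structkbar_eq0;
by rewrite rmorphB e subrr.
Qed.

Definition kF_kbar (c : kF D) : kb := sb (teich c).

Lemma kF_kbar_resF x : kF_kbar (resF D x) = sb x.
Proof. by apply/structkbar_eq; rewrite res_teich. Qed.

Lemma kF_kbar_zmod : zmod_morphism kF_kbar.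
Proof.
move=> a b; rewrite /kF_kbar -rmorphB; apply/structkbar_eq.
by rewrite rmorphB !res_teich.
Qed.

Lemma kF_kbar_monoid : monoid_morphism kF_kbar.
Proof.
split=> [|a b]; first by rewrite -(rmorph1 (resF D)) kF_kbar_resF rmorph1.
by rewrite /kF_kbar -rmorphM; apply/structkbar_eq; rewrite rmorphM !res_teich.
Qed.

HB.instance Definition _ :=
  GRing.isZmodMorphism.Build (kF D) kb kF_kbar kF_kbar_zmod.
HB.instance Definition _ :=
  GRing.isMonoidMorphism.Build (kF D) kb kF_kbar kF_kbar_monoid.

Hypothesis p_gt2 : (2 < p)%N.

Lemma odd_expp i : odd (p ^ i).
Proof.
rewrite oddX; case/even_prime: (p_prime D) => [e|->]; last by rewrite orbT.
by move: p_gt2; rewrite e.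
Qed.

Lemma ltn_expp_q1 (i : 'I_f) : (p ^ i < q1)%N.
Proof.
have le_pf : (p ^ i * p <= p ^ f)%N by rewrite -expnSr leq_pexp2l // ltnW // p_gt1.
by have := expp_gt0 i; nia.
Qed.

Hypothesis f_gt0 : (0 < f)%N.

Lemma q_gt2 : (2 < p ^ f)%N.
Proof. by apply: leq_trans p_gt2 _; rewrite -{1}(expn1 p) leq_pexp2l // ltnW // p_gt1. Qed.

End Residues.

Arguments kF_kbar {p f} D c.

(** * Functions on pairs of elements of the ring of integers *)

Section Functions.
Variables (p f : nat) (D : padic_setting p f).
Local Notation OF := (intring (vF D)).
Local Notation K := (GL2 OF).
Local Notation kb := (kbar D).
Local Notation sb := (structkbar D).
Local Notation q1 := (p ^ f - 1)%N.

Definition Fun2 := OF * OF -> kb^o.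
HB.instance Definition _ := GRing.Lmodule.on Fun2.

Lemma Fun2Z a (phi : Fun2) xy : (a *: phi) xy = a * phi xy.
Proof. by []. Qed.

Definition fun_act (k : K) (phi : Fun2) : Fun2 := fun xy =>
  phi (xy.1 * val k 0 0 + xy.2 * val k 1 0, xy.1 * val k 0 1 + xy.2 * val k 1 1).

Lemma fun_act_linear k : linear (fun_act k).
Proof. by []. Qed.

HB.instance Definition _ k :=
  GRing.isLinear.Build kb Fun2 Fun2 _ (fun_act k) (fun_act_linear k).

Lemma fun_act1 phi : fun_act 1%g phi = phi.
Proof.
apply/funext => -[x y]; rewrite /fun_act !mxE /=.
by rewrite !mulr1 !mulr0 addr0 add0r.
Qed.

Lemma fun_actM k l phi : fun_act (k * l)%g phi = fun_act k (fun_act l phi).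
Proof.
by apply/funext => -[x y]; rewrite /fun_act !mxE !sum2 /=; congr (phi (_, _)); ring.
Qed.

Definition funrep : rep OF kb :=
  @Rep OF kb Fun2 (fun k => fun_act k) fun_act1 fun_actM.

Definition eval_point (xy : OF * OF) (j : 'I_(f + f)) : kb :=
  match fintype.split j with
  | inl i => sb xy.1 ^+ (p ^ i)
  | inr i => sb xy.2 ^+ (p ^ i)
  end.

Lemma eval_pointX xy i : eval_point xy (lshift f i) = sb xy.1 ^+ (p ^ i).
Proof. by rewrite /eval_point (fintype.unsplitK (inl i)). Qed.

Lemma eval_pointY xy i : eval_point xy (rshift f i) = sb xy.2 ^+ (p ^ i).
Proof. by rewrite /eval_point (fintype.unsplitK (inr i)). Qed.

Definition evalfun r (v : Vrep sb r) : funrep :=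
  fun xy => (val (v : polyV kb r)).@[eval_point xy].

Lemma evalfun_linear r : linear (@evalfun r).
Proof. by move=> a u v; apply/funext => xy; rewrite /evalfun mevalD mevalZ. Qed.

HB.instance Definition _ r :=
  GRing.isLinear.Build kb (Vrep sb r) funrep _ (@evalfun r) (@evalfun_linear r).

Lemma conj_mxE k (i : 'I_f) a b : conj_mx sb k i a b = sb (k a b) ^+ (p ^ i).
Proof. by rewrite mxE; apply: struct_frobn. Qed.

Lemma evalfun_act r k (v : Vrep sb r) : evalfun (act k v) = act k (evalfun v).
Proof.
apply/funext => xy; rewrite /evalfun /= expr0 scale1r /lsubst comp_mpoly_meval.
apply: meval_eq => j; rewrite -[j]fintype.splitK; case: (fintype.split j) => i /=;
rewrite ?lin_formsX ?lin_formsY mevalD !mevalZ !mevalXU eval_pointX eval_pointY;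
by rewrite ?(eval_pointX, eval_pointY) !conj_mxE -!exprMn
  -(exprD_pchar_pow (kbar_pchar D)) -!rmorphM -rmorphD ![_ * val k _ _]mulrC.
Qed.

Definition monfun (a b : nat) : funrep := fun xy => sb xy.1 ^+ a * sb xy.2 ^+ b.

Lemma monfunE a b x y : monfun a b (x, y) = sb x ^+ a * sb y ^+ b.
Proof. by []. Qed.

Lemma evalfun_vmon r b : (forall i, b i <= r i)%N ->
  evalfun (vmon kb r b) = monfun (ofdigits p r - ofdigits p b) (ofdigits p b).
Proof.
move=> le_br; apply/funext => xy; rewrite /evalfun val_vmon // mpolyX_mon mevalM.
rewrite !rmorph_prod /= /monfun -ofdigitsB // -!prodr_expr_ofdigits.
by congr (_ * _); apply: eq_bigr => i _; rewrite rmorphXn /= mevalXU ?eval_pointX ?eval_pointY.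
Qed.

Lemma evalfun_vmon0 r :
  evalfun (vmon kb r (fun=> 0%N)) = monfun (ofdigits p r) 0.
Proof. by rewrite evalfun_vmon // (@ofdigits0 p f (fun=> 0%N)) // subn0. Qed.

Lemma monfun_modl a a' b : (0 < a)%N -> (0 < a')%N -> a = a' %[mod q1] ->
  monfun a b = monfun a' b.
Proof.
move=> a_gt0 a'_gt0 e; apply/funext => xy; congr (_ * _).
exact: (expr_eq_mod (struct_card _) (expp_gt0 D f)).
Qed.

Lemma monfun_modr a b b' : (0 < b)%N -> (0 < b')%N -> b = b' %[mod q1] ->
  monfun a b = monfun a b'.
Proof.
move=> b_gt0 b'_gt0 e; apply/funext => xy; congr (_ * _).
exact: (expr_eq_mod (struct_card _) (expp_gt0 D f)).
Qed.

Lemma meval_theta i xy : (theta D i).@[eval_point xy] = 0.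
Proof.
rewrite /theta mevalB !mevalM !rmorphXn /= !mevalXU !eval_pointX !eval_pointY.
have frob_pred z : (sb z ^+ (p ^ ord_pred i)) ^+ p = sb z ^+ (p ^ i).
  by rewrite -!struct_frobn struct_pred struct_frobn.
by rewrite !frob_pred mulrC subrr.
Qed.

Lemma evalfun_Vstar r (v : Vrep sb r) : Vstar D r v -> evalfun v = 0.
Proof.
move=> [P vE]; apply/funext => xy; rewrite /evalfun vE (raddf_sum (meval _)) big1 //.
by move=> i _; rewrite /= mevalM meval_theta mul0r.
Qed.

Lemma ugl_unit (c : OF) : mx2 1 c 0 1 \in unitmx.
Proof. by rewrite unitmxE det_mx2 mulr1 mulr0 subr0 unitr1. Qed.

Lemma lgl_unit (c : OF) : mx2 1 0 c 1 \in unitmx.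
Proof. by rewrite unitmxE det_mx2 mulr1 mul0r subr0 unitr1. Qed.

Lemma wgl_unit : mx2 0 1 1 0 \in (unitmx : pred 'M[OF]_2).
Proof. by rewrite unitmxE det_mx2 mulr0 sub0r mulr1 unitrN unitr1. Qed.

Definition ugl (c : OF) : K := Sub (mx2 1 c 0 1) (ugl_unit c).
Definition lgl (c : OF) : K := Sub (mx2 1 0 c 1) (lgl_unit c).
Definition wgl : K := Sub (mx2 0 1 1 0) wgl_unit.

Lemma act_ugl_monfun c a (b : 'I_f -> nat) : (forall i, b i < p)%N ->
  act (ugl c) (monfun a (ofdigits p b)) =
  \sum_(k : {ffun 'I_f -> 'I_p}) sb c ^+ ofdigits p (digits k) *:
    (prod_bin kb b (digits k) *:
      monfun (a + ofdigits p (digits k)) (ofdigits p (fun i => (b i - k i)%N))).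
Proof.
move=> lt_bp; apply/funext => -[x y]; rewrite fct_sumE /= /fun_act !mxE /=.
rewrite mulr0 addr0 !mulr1 monfunE addrC rmorphD rmorphM.
rewrite (exprD_ofdigits (kbar_pchar D)) // mulr_sumr; apply: eq_bigr => k _.
by rewrite !Fun2Z monfunE exprMn exprD; ring.
Qed.

Lemma act_lgl_monfun c a (b : 'I_f -> nat) : (forall i, b i < p)%N ->
  act (lgl c) (monfun (ofdigits p b) a) =
  \sum_(k : {ffun 'I_f -> 'I_p}) sb c ^+ ofdigits p (digits k) *:
    (prod_bin kb b (digits k) *:
      monfun (ofdigits p (fun i => (b i - k i)%N)) (a + ofdigits p (digits k))).
Proof.
move=> lt_bp; apply/funext => -[x y]; rewrite fct_sumE /= /fun_act !mxE /=.
rewrite mulr0 add0r !mulr1 monfunE rmorphD rmorphM.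
rewrite (exprD_ofdigits (kbar_pchar D)) // mulr_suml; apply: eq_bigr => k _.
by rewrite !Fun2Z monfunE exprMn exprD; ring.
Qed.

Lemma act_wgl_monfun a b : act wgl (monfun a b) = monfun b a.
Proof.
apply/funext => -[x y]; rewrite /= /fun_act !mxE /= !monfunE.
by rewrite !mulr0 !mulr1 add0r addr0 mulrC.
Qed.

End Functions.

Arguments monfun {p f} D a b.

Lemma sum_option (A : nmodType) (I : finType) (F : option I -> A) :
  \sum_o F o = F None + \sum_i F (Some i).
Proof.
rewrite (bigD1 None) //= (reindex_omap Some id) => [|[]//].
by congr (_ + _); apply: eq_bigl => i; rewrite eqxx.
Qed.

Lemma expp_ordS p f (i : 'I_f) :
  (0 < p)%N -> (p ^ ordS i = p * p ^ i %[mod p ^ f - 1])%N.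
Proof.
move=> p_gt0; rewrite -expnS /=.
have [lt_if|le_fi] := ltnP i.+1 f; first by rewrite (modn_small lt_if).
have -> : i.+1 = f by apply/eqP; rewrite eqn_leq le_fi ltn_ord.
by apply/eqP; rewrite modnn expn0 eq_sym eqn_mod_dvd ?dvdnn // expn_gt0 p_gt0.
Qed.

Section Carry.
Variables (p f : nat) (i0 : 'I_f) (b : 'I_f -> nat).

Definition carry (t : 'I_f) : nat := (b t - p * (t == i0) + (t == ordS i0))%N.

Lemma carry_ordS_gt0 : (0 < carry (ordS i0))%N.
Proof. by rewrite /carry eqxx addn1. Qed.

Hypothesis b_ge_p : (p <= b i0)%N.

Lemma carryE t : (b t + (t == ordS i0) = carry t + p * (t == i0))%N.
Proof.
rewrite /carry addnAC subnK //.
by case: eqVneq => [->|_]; rewrite ?muln1 ?muln0.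
Qed.

Lemma ofdigits_carry :
  (ofdigits p b + p ^ ordS i0 = ofdigits p carry + p * p ^ i0)%N.
Proof.
rewrite -ofdigits_delta -ofdigits_scale_delta -!ofdigitsD.
exact/eq_ofdigits/carryE.
Qed.

Lemma ofdigits_carry_mod : (0 < p)%N -> (ofdigits p carry = ofdigits p b %[mod p ^ f - 1])%N.
Proof.
move=> p_gt0; apply/eqP; rewrite -(eqn_modDr (p ^ ordS i0)) ofdigits_carry.
by rewrite eqn_modDl; apply/eqP/expp_ordS.
Qed.

Lemma ltn_sum_carry : (1 < p)%N -> (\sum_t carry t < \sum_t b t)%N.
Proof.
move=> p_gt1; have := congr1 (fun F => \sum_t F t)%N (funext carryE).
by rewrite !big_split /= -big_distrr /= !sum_delta; lia.
Qed.

Variable r : 'I_f -> nat.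
Hypotheses (b_le : forall i, (b i <= r i)%N) (b_lt : (b (ordS i0) < r (ordS i0))%N).

Lemma carry_le t : (carry t <= r t)%N.
Proof.
have := carryE t; have := b_le t; have [->|_] := eqVneq t (ordS i0); last by lia.
by have := b_lt; lia.
Qed.

Lemma carry_ltn : (1 < p)%N -> (carry i0 < r i0)%N.
Proof.
have := carryE i0; have := b_le i0; rewrite eqxx muln1.
by have [->|_] := eqVneq i0 (ordS i0); have := b_lt; lia.
Qed.

End Carry.

Section EvaluationKernel.
Variables (p f : nat) (D : padic_setting p f) (r : 'I_f -> nat).
Local Notation kb := (kbar D).
Local Notation V := (Vrep (structkbar D) r).

Definition theta_relation (v : V) : Prop := exists i0 b,
  [/\ (p <= b i0)%N, (b (ordS i0) < r (ordS i0))%N, forall i, (b i <= r i)%N &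
      v = vmon kb r b - vmon kb r (carry p i0 b)].

Definition theta_span : submodule V := lspan theta_relation.

Lemma val_theta_relation i0 b :
  (p <= b i0)%N -> (b (ordS i0) < r (ordS i0))%N -> (forall i, b i <= r i)%N ->
  val (vmon kb r b - vmon kb r (carry p i0 b)) =
  theta D (ordS i0) * 'X_[mon (fun t => r t - b t - (t == ordS i0))%N
                              (fun t => b t - p * (t == i0))%N].
Proof.
move=> b_ge_p b_lt b_le; have b'_le := carry_le b_ge_p b_le b_lt.
rewrite raddfB /= !val_vmon // /theta ordSK mulrBl.
have r_b t : ((t == ordS i0) <= r t - b t)%N.
  by case: eqVneq => // ->; rewrite subn_gt0.
rewrite -[varX _ _ in RHS]expr1 -[varY _ (ordS i0)]expr1 [varY _ _ ^+ 1 * _]mulrC.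
rewrite !varXY_mpolyX; congr (mpolyX _ _ - mpolyX _ _).
  apply: eq_mnm_expXY => t; rewrite ?expX_mon ?expY_mon ?mul1n.
    by have := r_b t; lia.
  by have := carryE b_ge_p t; rewrite /carry; lia.
apply: eq_mnm_expXY => t; rewrite ?expX_mon ?expY_mon ?mul1n.
  by have := r_b t; have := carryE b_ge_p t; have := b'_le t; have := b_le t; lia.
by rewrite /carry.
Qed.

Lemma theta_span_Vstar v : theta_span v -> Vstar D r v.
Proof.
apply=> _ [i0 [b [b_ge_p b_lt b_le ->]]].
exists (fun j => if j == ordS i0 then 'X_[mon (fun t => r t - b t - (t == ordS i0))%N
                              (fun t => b t - p * (t == i0))%N] else 0).
rewrite (bigD1 (ordS i0)) //= eqxx big1 ?addr0; first exact: val_theta_relation.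
by move=> j /negPf ->; rewrite mulr0.
Qed.

Hypotheses (f_gt0 : (0 < f)%N) (r_ge_q : forall i, (p ^ f <= r i)%N).

Let p_gt0 : (0 < p)%N := ltnW (p_gt1 D).

Lemma r_ge_p i : (p <= r i)%N.
Proof. by apply: leq_trans (r_ge_q i); rewrite -{1}(expn1 p) leq_pexp2l. Qed.

Lemma ofdigits_r_ge_q : (p ^ f <= ofdigits p r)%N.
Proof.
apply: leq_trans (leq_digit_ofdigits p r (Ordinal f_gt0)).
by rewrite expn0 muln1.
Qed.

Lemma ltn_digits_r (n : {ffun 'I_f -> 'I_p}) :
  (ofdigits p (digits n) < ofdigits p r)%N.
Proof. exact: leq_trans (ofdigits_digits_ltn n) ofdigits_r_ge_q. Qed.

Lemma digits_le_r (n : {ffun 'I_f -> 'I_p}) i : (digits n i <= r i)%N.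
Proof. exact: leq_trans (ltnW (ltn_ord _)) (r_ge_p i). Qed.

Definition normal_monomial (o : option {ffun 'I_f -> 'I_p}) : V :=
  vmon kb r (if o is Some n then digits n else r).

Lemma vmon_normal_form b : (forall i, b i <= r i)%N ->
  lspan (fun z => theta_span z \/ exists2 o, True & z = normal_monomial o)
    (vmon kb r b : V).
Proof.
have [n] := ubnP (\sum_i b i)%N; elim: n b => // n IH b; rewrite ltnS => sum_b b_le.
have [lt_bp|/existsNP[i0 /negP]] := pselect (forall i, b i < p)%N.
  by have [k <-] := digits_ex lt_bp; apply: mem_lspan; right; exists (Some k).
rewrite -leqNgt => b_ge_p.
have [[i ge_p lt_r]|stuck] :=
    pselect (exists2 i, (p <= b i)%N & (b (ordS i) < r (ordS i))%N).
  rewrite -[vmon kb r b](subrK (vmon kb r (carry p i b))); apply: smemD.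
    by apply: mem_lspan; left; apply: mem_lspan; exists i, b.
  by apply: IH (carry_le ge_p b_le lt_r); apply: leq_trans (ltn_sum_carry ge_p (p_gt1 D)) sum_b.
have b_top i : (p <= b i)%N -> b (ordS i) = r (ordS i).
  by move=> ge_p; apply/eqP; rewrite eqn_leq b_le leqNgt; apply/negP => lt_r;
     apply: stuck; exists i.
have all_ge_p := ord_cycle_ind (P := fun i => (p <= b i)%N)
  (fun i ge_p => leq_trans (r_ge_p _) (eq_leq (esym (b_top i ge_p)))) b_ge_p.
have -> : b = r by apply/funext => i; rewrite -[i]ord_predK b_top.
by apply: mem_lspan; right; exists None.
Qed.

Lemma evalfun_eq0_theta_span (v : V) : evalfun v = 0 -> theta_span v.
Proof.
move=> v0.
have [c _ v_nf] : exists2 c : option {ffun 'I_f -> 'I_p} -> kb,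
    forall o, c o != 0 -> True & theta_span (v - \sum_o c o *: normal_monomial o).
  by apply: lspan_fin_family; apply: polyV_ind => b; apply: vmon_normal_form.
suff c0 o : c o = 0 by move: v_nf; rewrite big1 ?subr0 // => o _; rewrite c0 scale0r.
have sum_xy x y : \sum_o c o * evalfun (normal_monomial o) (x, y) = 0.
  have := evalfun_Vstar (theta_span_Vstar v_nf).
  rewrite linearB /= v0 sub0r linear_sum => /eqP; rewrite oppr_eq0 => /eqP.
  move=> /(congr1 (fun phi : Fun2 D => phi (x, y))); rewrite fct_sumE => sum0.
  by apply: etrans sum0; apply: eq_bigr => o' _; rewrite linearZ.
have evalSome n x y : evalfun (normal_monomial (Some n)) (x, y) =
    monfun D (ofdigits p r - ofdigits p (digits n)) (ofdigits p (digits n)) (x, y).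
  by rewrite evalfun_vmon //; apply: digits_le_r.
have evalNone x y : evalfun (normal_monomial None) (x, y) = monfun D 0 (ofdigits p r) (x, y).
  by rewrite evalfun_vmon // subnn.
have cNone : c None = 0.
  have := sum_xy 0 1; rewrite sum_option evalNone monfunE expr0 rmorph1 expr1n !mulr1.
  rewrite big1 ?addr0 // => n _; rewrite evalSome monfunE rmorph0 expr0n.
  by rewrite subn_eq0 leqNgt ltn_digits_r mul0r mulr0.
case: o => [n|]; last exact: cNone.
apply: (mem_power_coef (iota := kF_kbar D) (x := fun n => c (Some n) : kb^o)
  (S := lin_ker idfun) (ofdigits_digits_inj (p_gt1 D))) => [k|z].
  by rewrite card_kF ofdigits_digits_ltn.
rewrite -[lin_ker _ _]/(_ = 0); have := sum_xy 1 (teich z).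
rewrite sum_option cNone mul0r add0r => sum0; apply: etrans sum0.
by apply: eq_bigr => k _; rewrite evalSome monfunE rmorph1 expr1n mul1r mulrC.
Qed.

End EvaluationKernel.

(** * Socle filtration of Q *)

Section LayerWeights.
Variables (p f : nat) (h : 'I_f).

(* The number of steps, between 1 and f, from i up to h in the cycle Z/f. *)
Definition hdist (i : 'I_f) : nat := if (i < h)%N then (h - i)%N else (h + f - i)%N.

Lemma hdist_inj : injective hdist.
Proof.
move=> i i' e; apply/val_inj; move: e; rewrite /hdist /=.
have := ltn_ord i; have := ltn_ord i'; have := ltn_ord h.
by case: (ltnP i h); case: (ltnP i' h); lia.
Qed.

Lemma hdist_gt0 i : (0 < hdist i)%N.
Proof. by rewrite /hdist; have := ltn_ord i; case: (ltnP i h); lia. Qed.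

Lemma hdist_le i : (hdist i <= f)%N.
Proof. by rewrite /hdist; have := ltn_ord h; case: (ltnP i h); lia. Qed.

Lemma hdist_self : hdist h = f.
Proof. by rewrite /hdist ltnn addKn. Qed.

Lemma hdist_surj j : (0 < j <= f)%N -> exists i, hdist i = j.
Proof.
move=> j_range; have lt_hf := ltn_ord h; have [le_jh|lt_hj] := leqP j h.
  have lt_f : (h - j < f)%N by lia.
  by exists (Ordinal lt_f); rewrite /hdist /=; case: ltnP; lia.
have lt_f : (h + f - j < f)%N by lia.
by exists (Ordinal lt_f); rewrite /hdist /=; case: ltnP; lia.
Qed.

Lemma val_ordS (i : 'I_f) : ordS i = (if (i.+1 < f)%N then i.+1 else 0%N) :> nat.
Proof.
rewrite /=; case: ltnP => [/modn_small //|le_fi].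
by rewrite (_ : i.+1 = f) ?modnn //; have := ltn_ord i; lia.
Qed.

Lemma hdist_eq1 i : hdist i = 1%N -> ordS i = h.
Proof.
move=> e; apply/val_inj; rewrite -[LHS]/(nat_of_ord (ordS i)) val_ordS.
move: e; rewrite /hdist /=; have := ltn_ord h; have := ltn_ord i.
by case: (ltnP i.+1 f); case: (ltnP i h); lia.
Qed.

Lemma hdist_ordS i : (1 < hdist i)%N -> hdist (ordS i) = (hdist i).-1.
Proof.
rewrite /hdist val_ordS; have := ltn_ord h; have := ltn_ord i.
case: (ltnP i.+1 f) => lt_if; case: (ltnP i h) => lt_ih.
- by case: (ltnP i.+1 h); lia.
- by case: (ltnP i.+1 h); lia.
- by case: (ltnP 0 h); lia.
- by case: (ltnP 0 h); lia.
Qed.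

(* The degrees of the polynomials spanning the j-th layer: starting from the
   degree 1 in (X_h, Y_h), each step trades one unit at an index for p units at
   its predecessor. *)
Definition layer_wt (j : nat) (i : 'I_f) : nat :=
  if j == 0%N then (i == h : nat)
  else if hdist i == j then p else if (hdist i < j)%N then p.-1 else 0%N.

Lemma layer_wt_top i0 : layer_wt (hdist i0) i0 = p.
Proof. by rewrite /layer_wt eqn0Ngt hdist_gt0 eqxx. Qed.

Lemma layer_wt_other i0 i : i != i0 ->
  layer_wt (hdist i0) i = if (hdist i < hdist i0)%N then p.-1 else 0%N.
Proof.
by move=> ni; rewrite /layer_wt eqn0Ngt hdist_gt0 (inj_eq hdist_inj) (negPf ni).
Qed.

Hypothesis p_gt1 : (1 < p)%N.

Lemma layer_wt_lt i0 i : i != i0 -> (layer_wt (hdist i0) i < p)%N.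
Proof. by move=> /layer_wt_other ->; case: ifP => _; lia. Qed.

Lemma layer_wt_carry i0 : carry p i0 (layer_wt (hdist i0)) =1 layer_wt (hdist i0).-1.
Proof.
move=> t; rewrite /carry.
have [hd1|hd_neq1] := eqVneq (hdist i0) 1%N.
  rewrite hd1 /= -hd1 (hdist_eq1 hd1) {2}/layer_wt /=.
  have [->|ti] := eqVneq t i0; first by rewrite layer_wt_top muln1 subnn.
  by rewrite layer_wt_other // hd1 ltnS leqn0 eqn0Ngt hdist_gt0 muln0.
have hd_gt1 : (1 < hdist i0)%N by have := hdist_gt0 i0; lia.
have hdS := hdist_ordS hd_gt1; rewrite -hdS.
have i0S : i0 != ordS i0 by apply/eqP => e; move: hdS; rewrite -e; lia.
have [->|tS] := eqVneq t (ordS i0).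
  rewrite layer_wt_top layer_wt_other 1?eq_sym // hdS ltn_predL hdist_gt0.
  by rewrite (negPf i0S) muln0; lia.
rewrite addn0; have [->|ti] := eqVneq t i0.
  by rewrite layer_wt_top layer_wt_other // hdS muln1 subnn ltnNge leq_pred.
rewrite !layer_wt_other // muln0 subn0 hdS.
have ht : hdist t != (hdist i0).-1 by rewrite -hdS (inj_eq hdist_inj).
by congr (if _ then _ else _); lia.
Qed.

Lemma layer_wt_pred_ge i0 t : t != i0 ->
  (layer_wt (hdist i0) t <= layer_wt (hdist i0).-1 t)%N.
Proof. by move=> ti; rewrite -layer_wt_carry /carry (negPf ti) muln0 subn0 leq_addr. Qed.

Lemma layer_wt_f_ge i : (p.-1 <= layer_wt f i)%N.
Proof.
rewrite -hdist_self; have [->|ih] := eqVneq i h; first by rewrite layer_wt_top leq_pred.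
rewrite layer_wt_other // hdist_self ltn_neqAle hdist_le andbT -{1}hdist_self.
by rewrite (inj_eq hdist_inj) ih.
Qed.

Lemma ofdigits_layer_wt j : (j <= f)%N ->
  (ofdigits p (layer_wt j) = p ^ h %[mod p ^ f - 1])%N.
Proof.
elim: j => [|j IH] lt_jf; first by rewrite -(ofdigits_delta p h).
have [i0 hdE] := @hdist_surj j.+1 lt_jf.
rewrite -IH 1?ltnW // -[j]/(j.+1.-1) -hdE -(eq_ofdigits p (@layer_wt_carry i0)).
by rewrite ofdigits_carry_mod ?layer_wt_top // ltnW.
Qed.

Lemma layer_wt_gt0 j : (j <= f)%N -> exists i, (0 < layer_wt j i)%N.
Proof.
case: (posnP j) => [-> _|j_gt0 le_jf]; first by exists h; rewrite /layer_wt /= eqxx.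
have [|i0 <-] := @hdist_surj j; first by rewrite j_gt0.
by exists i0; rewrite layer_wt_top ltnW.
Qed.

Lemma ofdigits_layer_wt_gt0 j : (j <= f)%N -> (0 < ofdigits p (layer_wt j))%N.
Proof. by move=> /layer_wt_gt0[i]; apply: ofdigits_gt0. Qed.

End LayerWeights.

Section Layers.
Variables (p f : nat) (D : padic_setting p f) (h : 'I_f).
Local Notation kb := (kbar D).
Local Notation sb := (structkbar D).
Local Notation q1 := (p ^ f - 1)%N.
Local Notation wt := (layer_wt p h).
Hypothesis p_gt2 : (2 < p)%N.

Let lt1p : (1 < p)%N := p_gt1 D.

Definition full_subrep (O : comUnitRingType) (R : comNzRingType) (M : rep O R) :
  subrep M := @Subrep O R M (full_sub M) (fun _ _ _ => I).

Definition layer (j : nat) : subrep (funrep D) :=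
  image_sub (@evalfun_act _ _ D (wt j)) (full_subrep (Vrep sb (wt j))).

Lemma layer_ind j (S : submodule (funrep D)) :
  (forall b, (forall i, b i <= wt j i)%N ->
     S (monfun D (ofdigits p (wt j) - ofdigits p b) (ofdigits p b))) ->
  forall phi, layer j phi -> S phi.
Proof.
move=> S_mon _ [w _ <-].
apply: (polyV_ind (S := lin_preim (@evalfun p f D (wt j)) S)) => b b_le.
rewrite -[lin_preim _ _ _]/(S (evalfun (vmon kb (wt j) b : Vrep sb (wt j)))).
by rewrite evalfun_vmon //; apply: S_mon.
Qed.

Lemma layer_monfun j b : (forall i, b i <= wt j i)%N ->
  layer j (monfun D (ofdigits p (wt j) - ofdigits p b) (ofdigits p b)).
Proof. by move=> b_le; exists (vmon kb (wt j) b) => //; apply: evalfun_vmon. Qed.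

(* The function x^a y^n with a > 0 and a + n = p^h mod q - 1. *)
Definition hmono (n : nat) : funrep D := monfun D (q1 - n + p ^ h) n.

Lemma monfun_hmono a n : (0 < a)%N -> (n <= q1)%N ->
  (a + n = p ^ h %[mod q1])%N -> monfun D a n = hmono n.
Proof.
move=> a_gt0 n_le e; apply: monfun_modl => //.
  by rewrite addn_gt0 (expp_gt0 D) orbT.
by apply/eqP; rewrite -(eqn_modDr n) e addnAC subnK // modnDl.
Qed.

Lemma layer_hmono_sub j b : (j <= f)%N -> (forall i, b i <= wt j i)%N ->
  (exists i, b i < wt j i)%N -> (ofdigits p b <= q1)%N -> layer j (hmono (ofdigits p b)).
Proof.
move=> le_jf b_le [i b_lt] b_q1; have lt_b := ltn_ofdigits lt1p b_le b_lt.
rewrite -(@monfun_hmono (ofdigits p (wt j) - ofdigits p b)) ?subn_gt0 //.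
  exact: layer_monfun.
by rewrite subnK ?ofdigits_layer_wt // ltnW.
Qed.

Lemma layer_hmono0 j : (j <= f)%N -> layer j (hmono 0).
Proof.
move=> le_jf; rewrite -(@ofdigits0 p f (fun=> 0%N)) //.
by apply: layer_hmono_sub; rewrite ?ofdigits0 //; apply: layer_wt_gt0.
Qed.

Lemma layer_hmono_expp j i : (j <= f)%N -> (1 < wt j i)%N -> layer j (hmono (p ^ i)).
Proof.
move=> le_jf wt_gt1; rewrite -(ofdigits_delta p i); apply: layer_hmono_sub => //.
- by move=> t; case: eqVneq => // ->; apply: ltnW.
- by exists i; rewrite eqxx.
by rewrite ofdigits_delta ltnW // (ltn_expp_q1 D).
Qed.

Definition digit_mono (n : {ffun 'I_f -> 'I_p}) : funrep D :=
  hmono (ofdigits p (digits n)).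

Lemma act_ugl_digit_mono c n : act (ugl c) (digit_mono n) =
  \sum_(k : {ffun 'I_f -> 'I_p}) sb c ^+ ofdigits p (digits k) *:
    (prod_bin kb (digits n) (digits k) *:
       hmono (ofdigits p (digits n) - ofdigits p (digits k))).
Proof.
rewrite [LHS]act_ugl_monfun => [|i]; last exact: ltn_ord.
apply: eq_bigr => k _; congr (_ *: _).
have [le_kn|lt_nk] := pselect (forall i, digits k i <= digits n i)%N; last first.
  by rewrite prod_bin_small // !scale0r.
congr (_ *: _); rewrite (ofdigitsB p le_kn) /hmono; congr monfun.
by have := leq_ofdigits p le_kn; have := ofdigits_digits_leq n; lia.
Qed.

Definition ugl_coef (c : {ffun 'I_f -> 'I_p} -> kb) (k : {ffun 'I_f -> 'I_p}) :
    funrep D :=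
  \sum_n c n *: (prod_bin kb (digits n) (digits k) *:
    hmono (ofdigits p (digits n) - ofdigits p (digits k))).

Lemma act_ugl_sum_digit_mono c z :
  act (ugl (teich z)) (\sum_n c n *: digit_mono n) =
  \sum_k kF_kbar D z ^+ ofdigits p (digits k) *: ugl_coef c k.
Proof.
rewrite linear_sum; under [RHS]eq_bigr do rewrite scaler_sumr.
rewrite [RHS]exchange_big; apply: eq_bigr => n _ /=.
transitivity (c n *: act (ugl (teich z)) (digit_mono n)); first exact: linearZ.
rewrite act_ugl_digit_mono scaler_sumr; apply: eq_bigr => k _.
by rewrite !scalerA [c n * _]mulrC.
Qed.

Section OneLayer.
Variable i0 : 'I_f.
Local Notation j := (hdist h i0).

Definition in_layer (n : {ffun 'I_f -> 'I_p}) : Prop :=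
  (forall i, digits n i <= wt j i)%N /\ (0 < digits n i0)%N.

Lemma layer_monfun_bottom b : (forall i, b i <= wt j i)%N -> b i0 = 0%N ->
  layer j.-1 (monfun D (ofdigits p (wt j) - ofdigits p b) (ofdigits p b)).
Proof.
move=> b_le bi0; have le_jf := hdist_le h i0.
have le_j1f : (j.-1 <= f)%N := leq_trans (leq_pred _) le_jf.
have b_le' t : (b t <= wt j.-1 t)%N.
  have [->|ti] := eqVneq t i0; first by rewrite bi0.
  exact: leq_trans (b_le t) (layer_wt_pred_ge h lt1p ti).
have b_lt' : (b (ordS i0) < wt j.-1 (ordS i0))%N.
  rewrite -layer_wt_carry // /carry eqxx addn1 ltnS.
  have [->|_] := eqVneq (ordS i0) i0; first by rewrite bi0.
  by rewrite muln0 subn0.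
have lt_wt : (ofdigits p b < ofdigits p (wt j))%N.
  by apply: (ltn_ofdigits lt1p b_le (i := i0)); rewrite bi0 layer_wt_top ltnW.
have lt_wt' := ltn_ofdigits lt1p b_le' b_lt'.
rewrite (monfun_modl D (a' := ofdigits p (wt j.-1) - ofdigits p b)) ?subn_gt0 //.
  exact: layer_monfun.
apply/eqP; rewrite -(eqn_modDr (ofdigits p b)) !subnK ?(ltnW lt_wt) ?(ltnW lt_wt') //.
by rewrite !ofdigits_layer_wt.
Qed.

Lemma layer_monfun_top b : (forall i, b i <= wt j i)%N -> b i0 = p ->
  layer j.-1 (monfun D (ofdigits p (wt j) - ofdigits p b) (ofdigits p b)).
Proof.
move=> b_le bi0; have b_ge_p : (p <= b i0)%N by rewrite bi0.
have wt_ge_p : (p <= wt j i0)%N by rewrite layer_wt_top.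
have b_le' t : (carry p i0 b t <= wt j.-1 t)%N.
  by rewrite -layer_wt_carry // /carry leq_add2r leq_sub2r.
have e_wt := ofdigits_carry wt_ge_p; have e_b := ofdigits_carry b_ge_p.
rewrite (eq_ofdigits p (layer_wt_carry h lt1p i0)) in e_wt.
rewrite -(subnDr (p ^ ordS i0)) e_wt e_b subnDr.
rewrite (@monfun_modr _ _ D _ _ (ofdigits p (carry p i0 b))); first exact: layer_monfun.
- by apply: (ofdigits_gt0 lt1p (i := i0)); rewrite bi0 ltnW.
- exact: (ofdigits_gt0 lt1p (carry_ordS_gt0 p i0 b)).
by rewrite ofdigits_carry_mod // ltnW.
Qed.

Lemma layer_monomial b : (forall i, b i <= wt j i)%N ->
  let phi := monfun D (ofdigits p (wt j) - ofdigits p b) (ofdigits p b) in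
  layer j.-1 phi \/ exists2 n, in_layer n & phi = digit_mono n.
Proof.
move=> b_le; have [bi0|bi0_gt0] := posnP (b i0).
  by left; apply: layer_monfun_bottom.
have [bi0_lt|bi0_ge] := ltnP (b i0) p; last first.
  left; apply: layer_monfun_top => //; apply/eqP.
  by rewrite eqn_leq bi0_ge -{1}(layer_wt_top p h i0) b_le.
have b_lt t : (b t < p)%N.
  have [->//|ti] := eqVneq t i0.
  exact: leq_ltn_trans (b_le t) (layer_wt_lt h lt1p ti).
have [n nE] := digits_ex b_lt; right; exists n; first by split=> [t|]; rewrite nE.
rewrite /digit_mono nE; have lt_wt : (ofdigits p b < ofdigits p (wt j))%N.
  by apply: (ltn_ofdigits lt1p b_le (i := i0)); rewrite layer_wt_top.
apply: monfun_hmono; first by rewrite subn_gt0.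
  by rewrite -nE ofdigits_digits_leq.
by rewrite subnK ?(ltnW lt_wt) // ofdigits_layer_wt ?hdist_le.
Qed.

Lemma layer_decomposition phi : layer j phi ->
  exists2 c : {ffun 'I_f -> 'I_p} -> kb, forall n, c n != 0 -> in_layer n &
    layer j.-1 (phi - \sum_n c n *: digit_mono n).
Proof.
move=> phi_j; apply: lspan_fin_family; move: phi_j; apply: layer_ind => b b_le.
exact/mem_lspan/layer_monomial.
Qed.

Variable T : subrep (funrep D).
Hypothesis layer_T : forall phi, layer j.-1 phi -> T phi.

Lemma in_layer_sub_mem (n n1 k : {ffun 'I_f -> 'I_p}) :
  in_layer n -> n != n1 -> (forall i, digits k i + (i == i0) = digits n1 i)%N ->
  (\sum_i digits n i <= (\sum_i digits k i).+1)%N -> (forall i, digits k i <= digits n i)%N ->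
  T (hmono (ofdigits p (digits n) - ofdigits p (digits k))).
Proof.
move=> [n_le _] nn1 kE sum_n le_kn.
have le_j1f : (j.-1 <= f)%N := leq_trans (leq_pred _) (hdist_le h i0).
have sum_d : (\sum_i (digits n i - digits k i) <= 1)%N.
  rewrite -(leq_add2r (\sum_i digits k i)) -big_split add1n.
  by rewrite (eq_bigr (digits n)) // => i _; rewrite /= subnK.
rewrite -ofdigitsB //; apply: layer_T.
have [d0|[i dE]] := sum_le1_delta sum_d; first by rewrite ofdigits0 //; apply: layer_hmono0.
rewrite (eq_ofdigits p dE) ofdigits_delta.
have nE t : digits n t = (digits k t + (t == i))%N by rewrite -dE subnKC.
have ii0 : i != i0.
  apply: contraNneq nn1 => ii0; apply/eqP/ffunP => t; apply/val_inj.
  by rewrite -[LHS]/(digits n t) nE ii0 kE.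
have wt_gt0 : (0 < wt j i)%N by apply: leq_trans (n_le i); rewrite nE eqxx addn1.
apply: layer_hmono_expp => //; apply: leq_trans (layer_wt_pred_ge h lt1p ii0).
by move: wt_gt0; rewrite layer_wt_other //; case: ifP => // _ _; lia.
Qed.

Lemma digits_sub_delta (b : 'I_f -> nat) :
  (forall i, (b i - (i == i0) < p)%N) -> (0 < b i0)%N ->
  exists2 k : {ffun 'I_f -> 'I_p}, forall i, (digits k i + (i == i0) = b i)%N &
    (ofdigits p b = ofdigits p (digits k) + p ^ i0)%N.
Proof.
move=> b_lt b_gt0; have [k kE] := digits_ex b_lt.
have kD i : (digits k i + (i == i0) = b i)%N.
  by rewrite kE subnK //; case: eqVneq => // ->.
by exists k => //; rewrite -(eq_ofdigits p kD) ofdigitsD ofdigits_delta.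
Qed.

(* The top-degree part of c has a nonzero z^k coefficient in u_z phi - phi, where
   k + e_(i0) is a digit sequence of maximal sum in the support of c. *)
Lemma ugl_invariant_mem_expp (c : {ffun 'I_f -> 'I_p} -> kb) n0
    (phi := \sum_n c n *: digit_mono n) :
  (forall n, c n != 0 -> in_layer n) ->
  (forall z, T (act (ugl (teich z)) phi - phi)) ->
  c n0 != 0 -> ofdigits p (digits n0) <> (p ^ i0)%N -> T (hmono (p ^ i0)).
Proof.
move=> c_in T_phi c0 n0E.
pose dsum (n : {ffun 'I_f -> 'I_p}) := (\sum_i digits n i)%N.
case: (arg_maxnP dsum (P := fun n => c n != 0) c0) => n1 c1 n1_max.
have [_ n1_gt0] := c_in _ c1.
have [i|//|k kE nE] := @digits_sub_delta (digits n1).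
  exact: leq_ltn_trans (leq_subr _ _) (ltn_ord _).
have dsum_n1 : dsum n1 = (dsum k).+1.
  by rewrite /dsum -(eq_bigr _ (fun i _ => kE i)) big_split /= sum_delta addn1.
have k_gt0 : (0 < ofdigits p (digits k))%N.
  rewrite lt0n; apply/eqP => /(ofdigits_eq0 lt1p) k0; case: n0E.
  have dsum_n0 : (dsum n0 <= 1)%N.
    by apply: leq_trans (n1_max _ c0) _; rewrite dsum_n1 /dsum big1 // => i _; apply: k0.
  have [_ n0_gt0] := c_in _ c0.
  case: (sum_le1_delta dsum_n0) => [n00|[i n0E]]; first by rewrite n00 in n0_gt0.
  rewrite (eq_ofdigits p n0E) ofdigits_delta.
  by move: n0_gt0; rewrite n0E; case: eqVneq => // ->.
have T_coef : T (ugl_coef c k).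
  apply: (mem_power_coef_sub (iota := kF_kbar D) (y := phi)
    (ofdigits_digits_inj lt1p) _ k_gt0) => [k'|z].
    by rewrite card_kF ofdigits_digits_ltn.
  by rewrite -act_ugl_sum_digit_mono.
have le_kn1 i : (digits k i <= digits n1 i)%N by rewrite -kE leq_addr.
have T_rest : T (\sum_(n | n != n1) c n *: (prod_bin kb (digits n) (digits k) *:
    hmono (ofdigits p (digits n) - ofdigits p (digits k)))).
  apply: smem_sum => n nn1.
  have [->|cn] := eqVneq (c n) 0; first by rewrite scale0r; apply: smem0.
  apply: smemZ; have [le_kn|lt_nk] := pselect (forall i, digits k i <= digits n i)%N.
    by apply/smemZ/(in_layer_sub_mem (c_in _ cn) nn1 kE) => //; rewrite -dsum_n1; apply: n1_max.
  by rewrite prod_bin_small // scale0r; apply: smem0.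
have nk_expp : (ofdigits p (digits n1) - ofdigits p (digits k) = p ^ i0)%N.
  by rewrite nE addKn.
have := smemB T_coef T_rest; rewrite /ugl_coef (bigD1 n1) //= addrK nk_expp.
have c1_unit : c n1 \is a GRing.unit by rewrite unitfE.
have bin_unit : prod_bin kb (digits n1) (digits k) \is a GRing.unit.
  by apply: (prod_bin_unit (kbar_pchar D)) => i; rewrite le_kn1 ltn_ord.
by move/(smemZ_inv c1_unit)/(smemZ_inv bin_unit).
Qed.

Lemma lgl_invariant_mem_digit_mono n :
  in_layer n -> ofdigits p (digits n) <> (p ^ i0)%N ->
  (forall z, T (act (lgl (teich z)) (hmono (p ^ i0)) - hmono (p ^ i0))) ->
  T (digit_mono n).
Proof.
move=> [n_le n_gt0] n_neq T_hmono.
have [|//|k kE nE] := @digits_sub_delta (digits n).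
  by move=> i; apply: leq_ltn_trans (leq_subr _ _) (ltn_ord _).
have [i||a aE wtE] := @digits_sub_delta (wt j).
- have [->|ii0] := eqVneq i i0; last by rewrite subn0 layer_wt_lt.
  by rewrite layer_wt_top; lia.
- by rewrite layer_wt_top ltnW.
have le_ka i : (digits k i <= digits a i)%N by rewrite -(leq_add2r (i == i0)) kE aE.
have lt_ka : (ofdigits p (digits k) < ofdigits p (digits a))%N.
  apply: (ltn_ofdigits lt1p le_ka (i := i0)); rewrite -(ltn_add2r (i0 == i0)) kE aE.
  by rewrite layer_wt_top; apply: ltn_ord.
have k_gt0 : (0 < ofdigits p (digits k))%N.
  by rewrite lt0n; apply/eqP => k0; case: n_neq; rewrite nE k0.
have wt_mod := ofdigits_layer_wt h lt1p (hdist_le h i0).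
have hmonoE : monfun D (ofdigits p (digits a)) (p ^ i0) = hmono (p ^ i0).
  by apply: monfun_hmono; rewrite -?wtE // ?(ltnW (ltn_expp_q1 D _ _)) //; lia.
have digit_monoE : monfun D (ofdigits p (digits a) - ofdigits p (digits k))
    (ofdigits p (digits n)) = digit_mono n.
  apply: monfun_hmono; rewrite ?subn_gt0 ?ofdigits_digits_leq //.
  by rewrite nE addnA subnK ?(ltnW lt_ka) // -wtE.
have T_coef : T (prod_bin kb (digits a) (digits k) *:
    monfun D (ofdigits p (fun i => digits a i - k i)%N) (p ^ i0 + ofdigits p (digits k))).
  apply: (mem_power_coef_sub (iota := kF_kbar D) (y := hmono (p ^ i0))
    (x := fun k => prod_bin kb (digits a) (digits k) *:
      monfun D (ofdigits p (fun i => digits a i - k i)%N) (p ^ i0 + ofdigits p (digits k)))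
    (ofdigits_digits_inj lt1p) _ k_gt0) => [k'|z].
    by rewrite card_kF ofdigits_digits_ltn.
  rewrite -[X in _ - X]hmonoE -(act_lgl_monfun _ _ (fun i => ltn_ord (a i))) hmonoE.
  exact: T_hmono.
have bin_unit : prod_bin kb (digits a) (digits k) \is a GRing.unit.
  by apply: (prod_bin_unit (kbar_pchar D)) => i; rewrite le_ka ltn_ord.
by move: (smemZ_inv bin_unit T_coef); rewrite (ofdigitsB p le_ka) addnC -nE digit_monoE.
Qed.

Lemma layer_generated : T (hmono (p ^ i0)) -> forall phi, layer j phi -> T phi.
Proof.
move=> T_hmono; apply: layer_ind => b /layer_monomial[/layer_T //|[n n_in ->]].
have [nE|n_neq] := pselect (ofdigits p (digits n) = (p ^ i0)%N).
  by rewrite /digit_mono nE.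
by apply: lgl_invariant_mem_digit_mono => // z; apply: act_sub_mem.
Qed.

Lemma layer_ugl_invariant phi : layer j phi ->
  (forall z, T (act (ugl (teich z)) phi - phi)) ->
  (forall phi', layer j phi' -> T phi') \/
  exists c, layer j.-1 (phi - c *: hmono (p ^ i0)).
Proof.
move=> /layer_decomposition[c c_in phi_c] T_phi.
have [[n0 c0 n0E]|c_supp] :=
    pselect (exists2 n, c n != 0 & ofdigits p (digits n) <> (p ^ i0)%N).
  left; apply/layer_generated/(ugl_invariant_mem_expp c_in _ c0 n0E) => z.
  exact: act_invariant_mod (layer_T phi_c) (T_phi z).
right; exists (\sum_n c n); rewrite scaler_suml.
congr (layer _ (_ - _)): phi_c; apply: eq_bigr => n _.
have [->|cn] := eqVneq (c n) 0; first by rewrite !scale0r.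
by congr (_ *: hmono _); apply: contrapT => nE; apply: c_supp; exists n.
Qed.

Lemma layer_simple phi : layer j phi -> T phi -> ~ layer j.-1 phi ->
  forall phi', layer j phi' -> T phi'.
Proof.
move=> phi_j T_phi phi_j1.
have [z|//|[c phi_c]] := layer_ugl_invariant phi_j; first exact: act_sub_mem.
apply: layer_generated; have c_unit : c \is a GRing.unit.
  by rewrite unitfE; apply/eqP => c0; apply: phi_j1; rewrite c0 scale0r subr0 in phi_c.
by apply: (smemZ_inv c_unit); rewrite -(subKr phi (c *: _)); apply/smemB/layer_T.
Qed.

(* If phi = c m modulo the previous layer with c != 0, invariance of m under lower
   unipotents gives the monomial with digits 2 e_(i0), and the latter gives m. *)
Lemma layer_invariant_mem phi : layer j phi ->
  (forall z, T (act (ugl (teich z)) phi - phi)) ->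
  (forall z, T (act (lgl (teich z)) phi - phi)) -> T phi.
Proof.
move=> phi_j T_ugl T_lgl; have [all_T|[c phi_c]] := layer_ugl_invariant phi_j T_ugl.
  exact: all_T.
have [c0|c_neq0] := eqVneq c 0; first by rewrite c0 scale0r subr0 in phi_c; apply: layer_T.
have c_unit : c \is a GRing.unit by rewrite unitfE.
have [|n nE] := @digits_ex p f (fun i => 2 * (i == i0))%N.
  by move=> i; case: (i == i0); rewrite ?muln0 ?muln1 //; lia.
have n_in : in_layer n.
  split=> [i|]; rewrite nE ?eqxx //.
  by have [->|_] := eqVneq i i0; rewrite ?muln0 // layer_wt_top muln1 ltnW.
have n_neq : ofdigits p (digits n) <> (p ^ i0)%N.
  by rewrite nE ofdigits_scale_delta; have := expp_gt0 D i0; lia.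
have T_n : T (digit_mono n).
  apply: lgl_invariant_mem_digit_mono => // z; apply: (smemZ_inv c_unit).
  by rewrite scalerBr -linearZ; apply: act_invariant_mod (layer_T phi_c) (T_lgl z).
have sum_n : \sum_n' (n' == n)%:R *: digit_mono n' = digit_mono n.
  rewrite (bigD1 n) //= eqxx scale1r big1 ?addr0 // => n' /negPf ->.
  by rewrite scale0r.
apply: layer_generated phi_j.
apply: (@ugl_invariant_mem_expp (fun n' => (n' == n)%:R) n) => [n'|z||//].
- by have [->|_] := eqVneq n' n; rewrite ?eqxx.
- by rewrite sum_n; apply: act_sub_mem.
by rewrite eqxx oner_neq0.
Qed.

End OneLayer.

End Layers.

Arguments hmono {p f} D h n.

Section Socle.
Variables (p f : nat) (D : padic_setting p f) (h : 'I_f) (r : 'I_f -> nat).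
Local Notation kb := (kbar D).
Local Notation sb := (structkbar D).
Local Notation V := (Vrep sb r).
Local Notation Q := (repQ D r).
Local Notation q1 := (p ^ f - 1)%N.
Local Notation wt := (layer_wt p h).
Local Notation layer := (layer D h).
Local Notation hmono := (hmono D h).
Hypothesis p_gt2 : (2 < p)%N.
Hypothesis r_ge_q : forall i, (p ^ f <= r i)%N.
Hypothesis r_mod : ofdigits p r = p ^ h %[mod q1].

Let f_gt0 : (0 < f)%N := leq_ltn_trans (leq0n h) (ltn_ord h).
Let r_ge_p i : (p <= r i)%N := r_ge_p D f_gt0 r_ge_q i.

Definition cls (v : V) : Q := qclass (add_sub (Vstar D r) (Xr D r)) v.

Lemma cls_linear : linear cls.
Proof. exact: linearP. Qed.

HB.instance Definition _ := GRing.isLinear.Build kb V Q _ cls cls_linear.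

Lemma cls_act k v : cls (act k v) = act k (cls v).
Proof. exact: qclass_act. Qed.

Lemma cls_surj (x : Q) : exists v, cls v = x.
Proof. by exists (repr x); apply: qclass_repr. Qed.

Lemma evalfun_cls v v' : evalfun v = evalfun v' -> cls v = cls v'.
Proof.
move=> e; apply/qclass_eq; apply: mem_lspan; left.
apply: (theta_span_Vstar (r := r)); apply: (evalfun_eq0_theta_span f_gt0 r_ge_q).
by rewrite linearB /= e subrr.
Qed.

Lemma ofdigits_r_gt0 : (0 < ofdigits p r)%N.
Proof. exact: leq_trans (expp_gt0 D f) (ofdigits_r_ge_q f_gt0 r_ge_q). Qed.

Lemma monfun_lift a b : (0 < a + b)%N -> (a + b = p ^ h %[mod q1])%N ->
  exists v : V, evalfun v = monfun D a b.
Proof.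
move=> ab_gt0 ab_mod; have r_gt0 := ofdigits_r_gt0.
have [b0|b_gt0] := posnP b.
  rewrite b0 addn0 in ab_mod ab_gt0 *; exists (vmon kb r (fun=> 0%N)).
  by rewrite evalfun_vmon0; apply: monfun_modl => //; rewrite r_mod.
have [a0|a_gt0] := posnP a.
  rewrite a0 add0n in ab_mod *; exists (vmon kb r r).
  by rewrite evalfun_vmon // subnn; apply: monfun_modr => //; rewrite r_mod.
have q1_gt0 : (0 < q1)%N by have := q_gt2 D p_gt2 f_gt0; lia.
have [c /andP[c_gt0 c_le] cE] := mod_pos_repr b_gt0 q1_gt0.
have c_lt_q : (c < p ^ f)%N by have := expp_gt0 D f; lia.
exists (vmon kb r (fun i => c * (i == Ordinal f_gt0))%N).
rewrite evalfun_vmon => [|i]; last first.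
  case: (i == _); rewrite ?muln0 // muln1; exact: leq_trans (ltnW c_lt_q) (r_ge_q i).
rewrite ofdigits_scale_delta expn0 muln1 (monfun_modr _ _ c_gt0 b_gt0 cE).
have lt_c := leq_trans c_lt_q (ofdigits_r_ge_q f_gt0 r_ge_q).
apply: monfun_modl; rewrite ?subn_gt0 //; apply/eqP.
by rewrite -(eqn_modDr c) subnK ?(ltnW lt_c) // r_mod -modnDmr cE modnDmr ab_mod.
Qed.

Lemma layer_lift j phi : (j <= f)%N -> layer j phi -> exists v : V, evalfun v = phi.
Proof.
move=> le_jf phi_j.
have [v _ vE] : lin_image (@evalfun p f D r) (full_sub _) phi; last by exists v.
move: phi_j; apply: layer_ind => b b_le; have := leq_ofdigits p b_le => le_b.
have [||v vE] := @monfun_lift (ofdigits p (wt j) - ofdigits p b) (ofdigits p b).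
- by rewrite subnK // ofdigits_layer_wt_gt0 // (p_gt1 D).
- by rewrite subnK // ofdigits_layer_wt // (p_gt1 D).
by exists v.
Qed.

Lemma layer_f_digits (n : {ffun 'I_f -> 'I_p}) :
  layer f (monfun D (ofdigits p r - ofdigits p (digits n)) (ofdigits p (digits n))).
Proof.
have n_wt i : (digits n i <= wt f i)%N.
  by apply: leq_trans (layer_wt_f_ge p h i); rewrite -ltnS prednK ?ltn_ord ?(ltnW (p_gt1 D)).
have n_lt : (digits n h < wt f h)%N.
  by have := layer_wt_top p h h; rewrite hdist_self => ->; apply: ltn_ord.
have lt_wt := ltn_ofdigits (p_gt1 D) n_wt n_lt.
have lt_r := ltn_digits_r f_gt0 r_ge_q n.
rewrite (monfun_modl D (a' := ofdigits p (wt f) - ofdigits p (digits n))) ?subn_gt0 //.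
  exact: layer_monfun.
apply/eqP; rewrite -(eqn_modDr (ofdigits p (digits n))) !subnK ?(ltnW lt_wt) ?(ltnW lt_r) //.
by rewrite r_mod ofdigits_layer_wt ?(p_gt1 D).
Qed.

Lemma layer_f_evalfun (v : V) : layer f (evalfun v).
Proof.
apply: (polyV_ind (S := lin_preim (@evalfun p f D r) (layer f))) => b b_le.
apply: (vmon_normal_form f_gt0 r_ge_q b_le) => y [/theta_span_Vstar/evalfun_Vstar y0|[o _ ->]].
  by rewrite /= /preimage_mem y0; apply: (smem0 (layer f)).
rewrite -[lin_preim _ _ _]/(layer f (evalfun _)) evalfun_vmon; last first.
  by case: o => // n i; apply: (digits_le_r D f_gt0 r_ge_q).
case: o => [n|]; first exact: layer_f_digits.
have := @layer_monfun _ _ D h f (wt f) (fun=> leqnn _); rewrite !subnn.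
rewrite (@monfun_modr _ _ D _ _ (ofdigits p r)) ?ofdigits_r_gt0 //.
  by rewrite ofdigits_layer_wt_gt0 ?(p_gt1 D).
by rewrite ofdigits_layer_wt ?(p_gt1 D).
Qed.

Lemma Xr_act_vmon0 k : Xr D r (act k (vmon kb r (fun=> 0%N) : V)).
Proof.
apply: mem_lspan; exists k, (vmon kb r (fun=> 0%N)); split=> //.
rewrite val_vmon // mpolyX_mon [X in _ * X]big1 ?mulr1 //.
by apply: eq_bigr => i _; rewrite subn0.
Qed.

Lemma layer0_cls v : layer 0 (evalfun v) -> cls v = 0.
Proof.
move=> v_layer; have r_gt0 := ofdigits_r_gt0; have ph_gt0 := expp_gt0 D h.
have [v' Xr_v' v'E] : lin_image (@evalfun p f D r) (Xr D r) (evalfun v).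
  move: v_layer; apply: layer_ind => b b_le.
  have bE i : b i = (b h * (i == h))%N.
    have := b_le i; rewrite /layer_wt /=.
    by case: eqVneq => [->|_]; rewrite ?muln1 ?muln0 // leqn0 => /eqP.
  have bh_le : (b h <= 1)%N by have := b_le h; rewrite /layer_wt /= eqxx.
  rewrite (eq_ofdigits p bE) ofdigits_scale_delta.
  rewrite (ofdigits_delta p h : ofdigits p (wt 0) = _).
  case: (b h) bh_le => [|[|//]] _.
    exists (act 1%g (vmon kb r (fun=> 0%N) : V)); first exact: Xr_act_vmon0.
    rewrite act1; apply: etrans (evalfun_vmon0 D r) _.
    by rewrite mul0n subn0; apply: monfun_modl.
  exists (act (wgl D) (vmon kb r (fun=> 0%N) : V)); first exact: Xr_act_vmon0.
  apply: etrans (evalfun_act _ _) _; rewrite evalfun_vmon0 act_wgl_monfun mul1n subnn.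
  exact: monfun_modr.
rewrite -(evalfun_cls v'E); apply/qclass_eq0/mem_lspan; right.
exact: Xr_v'.
Qed.

Definition fun_sub (S : subrep Q) : subrep (funrep D) :=
  image_sub (@evalfun_act _ _ D r) (preim_sub cls_act S).

Lemma fun_subP (S : subrep Q) v : fun_sub S (evalfun v) <-> S (cls v).
Proof.
by split=> [[v' Sv' e]|Sv]; [rewrite -(evalfun_cls e) | exists v].
Qed.

Lemma fun_sub_layer (S : subrep Q) j : (j <= f)%N ->
  (forall v, layer j (evalfun v) -> S (cls v)) ->
  forall phi, layer j phi -> fun_sub S phi.
Proof.
move=> le_jf S_layer phi phi_j; have [v vE] := layer_lift le_jf phi_j.
by rewrite -vE; apply/fun_subP/S_layer; rewrite vE.
Qed.

Definition cls_layer j : subrep Q :=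
  image_sub cls_act (preim_sub (@evalfun_act _ _ D r) (layer j)).

Lemma soc_quot_layer j (S : subrep Q) : (j < f)%N ->
  (forall v, layer j (evalfun v) -> S (cls v)) ->
  forall v, layer j.+1 (evalfun v) -> soc (quot_rep S) (qclass S (cls v)).
Proof.
move=> lt_jf S_layer v v_layer.
have [->|v_neq0] := eqVneq (qclass S (cls v)) 0; first exact: (smem0 (soc (quot_rep S))).
pose q : {linear Q -> quot_rep S} := qclass S.
pose L := image_sub (u := q) (@qclass_act _ _ _ S) (cls_layer j.+1).
apply: mem_lspan; exists 1%g, (qclass S (cls v)); rewrite act1; split=> //.
have L_v w : layer j.+1 (evalfun w) -> L (qclass S (cls w)).
  by move=> w_layer; exists (cls w) => //; exists w.
exists L; last exact: L_v.
split; first by exists (qclass S (cls v)) => //; apply: L_v.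
move=> S' le_S'L; have [S'0|/existsNP[y /not_implyP[S'y /eqP y_neq0]]] :=
  pselect (forall y, S' y -> y = 0); [by left | right].
have [_ [x x_layer <-] xE] := le_S'L y S'y.
have [i0 hdE] : exists i0, hdist h i0 = j.+1 by apply: hdist_surj.
pose T := fun_sub (preim_quot S').
have T_j phi : layer (hdist h i0).-1 phi -> T phi.
  rewrite hdE; apply: fun_sub_layer => [|w w_layer]; first exact: ltnW.
  rewrite -[preim_quot S' _]/(S' (qclass S (cls w))).
  by rewrite (_ : qclass S _ = 0); [apply: (smem0 S') | apply/qclass_eq0/S_layer].
have T_j1 phi : layer j.+1 phi -> T phi.
  rewrite -hdE; apply: (layer_simple p_gt2 T_j (phi := evalfun x)).
  - by rewrite hdE.
  - by apply/fun_subP; rewrite -[preim_quot S' _]/(S' (qclass S (cls x))) xE.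
  rewrite hdE => x_j; case/eqP: y_neq0; rewrite -xE; apply/qclass_eq0.
  exact: S_layer.
move=> _ [_ [w w_layer <-] <-].
by rewrite -[S' _]/(preim_quot S' (cls w)); apply/fun_subP/T_j1.
Qed.

Lemma socfil_layer j : (j <= f)%N ->
  forall v, layer j (evalfun v) -> socfil Q j (cls v).
Proof.
elim: j => [|j IH] le_jf v v_layer.
  by rewrite (layer0_cls v_layer); apply: (smem0 (socfil Q 0)).
exact: soc_quot_layer (IH (ltnW le_jf)) v v_layer.
Qed.

Local Notation rad := (socfil Q f.-1).

Lemma layer_fun_sub_rad phi : layer (hdist h h).-1 phi -> fun_sub rad phi.
Proof.
by rewrite hdist_self; apply/fun_sub_layer/socfil_layer; apply: leq_pred.
Qed.

Definition eps : V := vmon kb r (fun i => i == h).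

Lemma evalfun_eps : evalfun eps = hmono (p ^ h).
Proof.
have le_1r i : ((i == h) <= r i)%N.
  by case: eqVneq => // _; apply: leq_trans (r_ge_p i); apply: ltnW (p_gt1 D).
have lt_hr : (p ^ h < ofdigits p r)%N.
  apply: leq_trans (ofdigits_r_ge_q f_gt0 r_ge_q); rewrite ltn_exp2l ?(p_gt1 D) //.
rewrite evalfun_vmon // ofdigits_delta; apply: monfun_hmono.
- by rewrite subn_gt0.
- by rewrite ltnW // (ltn_expp_q1 D).
by rewrite subnK // ltnW.
Qed.

Lemma cosoc_ugl_invariant (x : V) :
  (forall z, rad (cls (act (ugl (teich z)) x) - cls x)) ->
  (forall v, rad (cls v)) \/ exists c, rad (cls x - c *: cls eps).
Proof.
move=> x_inv; have layer_hh (v : V) : layer (hdist h h) (evalfun v).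
  by rewrite hdist_self; apply: layer_f_evalfun.
have [z|all_T|[c x_c]] := layer_ugl_invariant p_gt2 layer_fun_sub_rad (layer_hh x).
- by rewrite -evalfun_act -linearB; apply/fun_subP; rewrite linearB.
- by left=> v; apply/fun_subP/all_T.
right; exists c; rewrite -linearZ -linearB; apply/fun_subP/layer_fun_sub_rad.
by rewrite linearB linearZ /= evalfun_eps.
Qed.

Lemma cosoc_invariant (x : V) :
  (forall z, rad (cls (act (ugl (teich z)) x) - cls x)) ->
  (forall z, rad (cls (act (lgl (teich z)) x) - cls x)) -> rad (cls x).
Proof.
move=> x_ugl x_lgl; apply/fun_subP.
apply: (layer_invariant_mem p_gt2 layer_fun_sub_rad) => [|z|z].
- by rewrite hdist_self; apply: layer_f_evalfun.
- by rewrite -evalfun_act -linearB; apply/fun_subP; rewrite linearB.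
by rewrite -evalfun_act -linearB; apply/fun_subP; rewrite linearB.
Qed.

End Socle.

(** * Taylor expansions *)

Section Multiples.
Variables (R : comNzRingType) (U : lmodType R) (c : R).

(* Congruence of u and v modulo c is expressed as membership of u - v in c U. *)
Definition multiples : submodule U := lin_image (GRing.scale c) (full_sub U).

Lemma multiplesP x : multiples x <-> exists w, x = c *: w.
Proof. by split=> [[w _ <-]|[w ->]]; exists w. Qed.

End Multiples.

Section AlgebraMultiples.
Variables (R : comNzRingType) (A : comAlgType R) (c : R).
Local Notation multiples := (multiples A c).

Lemma multiplesMl (x y : A) : multiples x -> multiples (y * x).
Proof. by move=> /multiplesP[w ->]; apply/multiplesP; exists (y * w); rewrite scalerAr. Qed.

Lemma multiples_mul (x x' y y' : A) :
  multiples (x - x') -> multiples (y - y') -> multiples (x * y - x' * y').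
Proof.
move=> hx hy; have -> : x * y - x' * y' = y * (x - x') + x' * (y - y') by ring.
by apply: smemD; apply: multiplesMl.
Qed.

Lemma multiples_exp (x x' : A) n :
  multiples (x - x') -> multiples (x ^+ n - x' ^+ n).
Proof.
move=> hx; elim: n => [|n IH]; first by rewrite subrr; apply: smem0.
by rewrite !exprS; apply: multiples_mul.
Qed.

Lemma multiples_prod I (s : seq I) (x x' : I -> A) :
  (forall i, multiples (x i - x' i)) ->
  multiples (\prod_(i <- s) x i - \prod_(i <- s) x' i).
Proof.
move=> hx; elim: s => [|i s IH]; first by rewrite !big_nil subrr; apply: smem0.
by rewrite !big_cons; apply: multiples_mul.
Qed.

End AlgebraMultiples.

Section PolynomialMultiples.
Variables (f : nat) (R : comNzRingType) (r : 'I_f -> nat) (c : R).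

Lemma multiples_polyV (v : polyV R r) : multiples _ c (val v) -> multiples _ c v.
Proof.
move=> /multiplesP[w vE]; apply/multiplesP.
exists (\sum_(m <- msupp (val v)) w@_m *: vmon R r (expY m)).
rewrite {1}[v]polyV_sum_mon scaler_sumr; apply: eq_bigr => m _.
by rewrite vE mcoeffZ scalerA.
Qed.

Lemma psubst_multiples (A B : 'I_f -> 'M[R]_2) (v : polyV R r) :
  (forall i a b, exists d, A i a b - B i a b = c * d) ->
  multiples _ c (psubst A v - psubst B v).
Proof.
move=> AB; pose S := lin_preim (psubst A (r := r) \- psubst B (r := r)) (multiples _ c).
have entry i a b (x : {mpoly R[f + f]}) : multiples _ c (A i a b *: x - B i a b *: x).
  have [d e] := AB i a b; apply/multiplesP; exists (d *: x).
  by rewrite -scalerBl e scalerA.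
apply: (polyV_ind (S := S)) => b b_le.
rewrite -[S _]/(multiples _ c (psubst A (vmon R r b) - psubst B (vmon R r b))).
apply: multiples_polyV.
rewrite -[val _]/(val (psubst A (vmon R r b)) - val (psubst B (vmon R r b))).
rewrite !val_psubst_vmon //.
by apply: multiples_mul; apply: multiples_prod => i; apply: multiples_exp;
   rewrite opprD addrACA; apply: smemD; apply: entry.
Qed.

Lemma psubst_vmon_diag0 (t : 'I_f -> R) b : (forall i, b i <= r i)%N ->
  psubst (fun i => mx2 1 (t i) 0 0) (vmon R r b) =
  (\prod_i t i ^+ b i) *: linprod r (fun=> 1) (fun=> 0).
Proof.
move=> b_le; apply/val_inj; rewrite val_psubst_vmon //= -scaler_prod -big_split.
apply: eq_bigr => i _; rewrite !mxE /= !scale0r !addr0 scale1r exprZn -scalerAr.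
by rewrite -exprD subnK.
Qed.

Lemma psubst_vmon_diag1 b i : (forall i, b i <= r i)%N -> (b i < r i)%N ->
  psubst (fun=> mx2 0 0 0 1) (vmon R r b) = 0.
Proof.
move=> b_le b_lt; apply/val_inj; rewrite val_psubst_vmon //= (bigD1 i) //= !mxE /=.
by rewrite !scale0r addr0 expr0n subn_eq0 leqNgt b_lt !mul0r.
Qed.

End PolynomialMultiples.

Lemma exprD_taylor (R : comNzRingType) (c a b : R) n : exists w,
  (a + c * b) ^+ n = a ^+ n + c * (n%:R * b * a ^+ (n - 1)) + c ^+ 2 * w.
Proof.
elim: n => [|[|n] [w IH]]; first by exists 0; rewrite !expr0; ring.
  by exists 0; rewrite subnn !expr0 !expr1; ring.
exists (n.+1%:R * b ^+ 2 * a ^+ n + w * (a + c * b)).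
by rewrite exprSr IH !subn1 /= !exprS; ring.
Qed.

Lemma prod_exprD_taylor (R : comNzRingType) (I : finType) (c : R) (A B : I -> R)
    (r : I -> nat) : exists w,
  \prod_i (A i + c * B i) ^+ r i =
  \prod_i A i ^+ r i +
  c * (\sum_i (r i)%:R * B i * \prod_j A j ^+ (r j - (j == i))) + c ^+ 2 * w.
Proof.
elim: (index_enum I) (index_enum_uniq I) => [_|i s IH /= /andP[i_s /IH[w2 e2]]].
  by exists 0; rewrite !big_nil; ring.
have [w1 e1] := exprD_taylor c (A i) (B i) (r i).
have prod_s : \prod_(j <- s) A j ^+ (r j - (j == i)) = \prod_(j <- s) A j ^+ r j.
  by apply: eq_big_seq => j js; case: eqVneq js i_s => [->|_ _ _]; rewrite ?subn0 // => ->.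
have sum_s : \sum_(l <- s) (r l)%:R * B l * \prod_(j <- i :: s) A j ^+ (r j - (j == l)) =
    A i ^+ r i * \sum_(l <- s) (r l)%:R * B l * \prod_(j <- s) A j ^+ (r j - (j == l)).
  rewrite mulr_sumr; apply: eq_big_seq => l ls; rewrite big_cons mulrCA.
  by case: eqVneq ls i_s => [<- ->|_ _ _]; rewrite ?subn0.
rewrite !big_cons sum_s prod_s eqxx e1 e2.
move: (A i ^+ (r i - true)) (A i ^+ r i) ((r i)%:R * B i) => a' a b.
set P := \prod_(j <- s) _; set S := \sum_(l <- s) _.
exists (b * a' * S + a * w2 + w1 * (P + c * S + c ^+ 2 * w2) + c * b * a' * w2).
by ring.
Qed.

Lemma prod_scaleD_taylor (R : comNzRingType) (A : comAlgType R) (I : finType) (c : R)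
    (a b : I -> R) (u v : I -> A) (r : I -> nat) : exists w,
  \prod_i (a i *: u i + (c * b i) *: v i) ^+ r i =
  (\prod_i a i ^+ r i) *: \prod_i u i ^+ r i +
  c *: (\sum_i ((r i)%:R * b i * \prod_j a j ^+ (r j - (j == i))) *:
          (v i * \prod_j u j ^+ (r j - (j == i)))) + c ^+ 2 *: w.
Proof.
have [w e] := prod_exprD_taylor (c%:A : A) (fun i => a i *: u i) (fun i => b i *: v i) r.
exists w; apply: etrans (etrans e _).
  by apply: eq_bigr => i _; rewrite -scalerAl mul1r scalerA.
rewrite !expr2 -mulrA -!scalerAl !mul1r scalerA; congr (_ + _ *: _ + _).
  by rewrite -scaler_prod; apply: eq_bigr => i _; rewrite exprZn.
apply: eq_bigr => i _; under eq_bigr do rewrite exprZn; rewrite scaler_prod.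
by rewrite -mulrA mulr_natl -scaler_nat -scalerAl -scalerAr !scalerA.
Qed.

Section LinprodTaylor.
Variables (f : nat) (R : comNzRingType) (r : 'I_f -> nat) (c : R).
Local Notation delta i := (fun j => (j == i : nat)).
Hypothesis r_gt0 : forall i, (0 < r i)%N.

Lemma delta_le (i j : 'I_f) : (delta i j <= r j)%N.
Proof. by rewrite /=; case: (j == i) => //=; apply: r_gt0. Qed.

Lemma prod_expr_delta (u : 'I_f -> {mpoly R[f + f]}) i : \prod_j u j ^+ (j == i) = u i.
Proof. by rewrite (bigD1 i) //= eqxx big1 ?mulr1 // => j /negPf ->. Qed.

Lemma val_vmon_delta i : val (vmon R r (delta i)) =
  varY R i * \prod_j varX R j ^+ (r j - (j == i)).
Proof.
rewrite val_vmon => [|j]; last exact: delta_le.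
by rewrite mpolyX_mon prod_expr_delta mulrC.
Qed.

Lemma val_vmon_codelta i : val (vmon R r (fun j => r j - (j == i))%N) =
  varX R i * \prod_j varY R j ^+ (r j - (j == i)).
Proof.
rewrite val_vmon => [|j]; last exact: leq_subr.
rewrite mpolyX_mon; congr (_ * _); rewrite -[RHS](prod_expr_delta (varX R)).
by apply: eq_bigr => j _; rewrite subKn // delta_le.
Qed.

Lemma linprod_taylorX (a b : 'I_f -> R) :
  multiples _ (c ^+ 2) (linprod r a (fun i => c * b i) -
    ((\prod_i a i ^+ r i) *: linprod r (fun=> 1) (fun=> 0) +
     c *: \sum_i ((r i)%:R * b i * \prod_j a j ^+ (r j - (j == i))) *: vmon R r (delta i))).
Proof.
have [w e] := prod_scaleD_taylor c a b (varX R) (varY R) r.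
apply: multiples_polyV; apply/multiplesP; exists w.
apply/eqP; rewrite subr_eq addrC; apply/eqP; apply: etrans e _; congr (_ + _).
rewrite [RHS]linearP; congr (_ *: _ + _ *: _).
  by apply: eq_bigr => i _; rewrite scale1r scale0r addr0.
rewrite [RHS](raddf_sum (\val : polyV R r -> {mpoly R[f + f]})).
by apply: eq_bigr => i _; rewrite -val_vmon_delta.
Qed.

Lemma linprod_taylorY (a b : 'I_f -> R) :
  multiples _ (c ^+ 2) (linprod r (fun i => c * b i) a -
    ((\prod_i a i ^+ r i) *: linprod r (fun=> 0) (fun=> 1) +
     c *: \sum_i ((r i)%:R * b i * \prod_j a j ^+ (r j - (j == i))) *:
       vmon R r (fun j => r j - (j == i))%N)).
Proof.
have [w e] := prod_scaleD_taylor c a b (varY R) (varX R) r.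
apply: multiples_polyV; apply/multiplesP; exists w.
apply/eqP; rewrite subr_eq addrC; apply/eqP; apply: etrans (etrans _ e) _.
  by apply: eq_bigr => i _; rewrite addrC.
congr (_ + _); rewrite [RHS]linearP; congr (_ *: _ + _ *: _).
  by apply: eq_bigr => i _; rewrite scale1r scale0r add0r.
rewrite [RHS](raddf_sum (\val : polyV R r -> {mpoly R[f + f]})).
by apply: eq_bigr => i _; rewrite -val_vmon_codelta.
Qed.

End LinprodTaylor.

(** * The lattice and its reduction *)

Lemma map_mx2 (R R' : nzRingType) (phi : R -> R') (a b c d : R) :
  map_mx phi (mx2 a b c d) = mx2 (phi a) (phi b) (phi c) (phi d).
Proof. by apply/matrixP => i k; rewrite !mxE; do 2 case: (_ == 0). Qed.

Section HeckeOperator.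
Variables (p f : nat) (D : padic_setting p f).
Local Notation OF := (intring (vF D)).

Definition hecke_teich_mx (R : comNzRingType) (j : {rmorphism OF -> R}) (c : kF D)
  (i : 'I_f) : 'M[R]_2 := mx2 1 ((- j (teich c)) ^+ (p ^ i)) 0 p%:R.

Definition hecke_alpha_mx (R : comNzRingType) (i : 'I_f) : 'M[R]_2 := mx2 p%:R 0 0 1.

Section OneRing.
Variables (R : comNzRingType) (j : {rmorphism OF -> R}) (r : 'I_f -> nat) (m : nat).
Local Notation W := (weight_rep j r m).

Lemma hecke_eltE g (v : W) : hecke_elt g v =
  \sum_(c : kF D) elt (g * gl_teich c)%g (psubst (hecke_teich_mx j c) v : W) +
  elt (g * gl_alpha D)%g (psubst (@hecke_alpha_mx R) v : W).
Proof. by []. Qed.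

Lemma hecke_elt_linear g : linear (@hecke_elt p f D R j r m g).
Proof.
move=> a u v; rewrite !hecke_eltE scalerDr addrACA; congr (_ + _); last first.
  by rewrite linearP; apply: elt_linear.
rewrite scaler_sumr -big_split; apply: eq_bigr => c _.
by rewrite linearP; apply: elt_linear.
Qed.

HB.instance Definition _ g := GRing.isLinear.Build R W (ind W) _
  (@hecke_elt p f D R j r m g) (hecke_elt_linear g).

End OneRing.

Lemma coef_map_psubst (R R' : comNzRingType) (phi : {rmorphism R -> R'})
    (j : {rmorphism OF -> R}) r A (v : Vrep j r) :
  Defs.coef_map phi j r (psubst A v) =
  psubst (fun i => map_mx phi (A i)) (Defs.coef_map phi j r v).
Proof. by apply/val_inj; apply: map_lsubst. Qed.

Lemma coef_mapZ (R R' : comNzRingType) (phi : {rmorphism R -> R'})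
    (j : {rmorphism OF -> R}) r a (v : Vrep j r) :
  Defs.coef_map phi j r (a *: v) = phi a *: Defs.coef_map phi j r v.
Proof. by apply/val_inj; apply: map_mpolyZ. Qed.

Lemma map_hecke_alpha_mx (R R' : comNzRingType) (phi : {rmorphism R -> R'}) :
  (fun i => map_mx phi (hecke_alpha_mx R i)) = hecke_alpha_mx R'.
Proof. by apply/funext => i; rewrite map_mx2 rmorph_nat rmorph0 rmorph1. Qed.

Lemma map_hecke_teich_mx (R R' : comNzRingType) (phi : {rmorphism R -> R'})
    (j : {rmorphism OF -> R}) c :
  (fun i => map_mx phi (hecke_teich_mx j c i)) = hecke_teich_mx (phi \o j) c.
Proof.
by apply/funext => i; rewrite map_mx2 rmorph1 rmorph0 rmorph_nat rmorphXn rmorphN.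
Qed.

Lemma ind_map_hecke_elt (R R' : comNzRingType) (phi : {rmorphism R -> R'})
    (j : {rmorphism OF -> R}) r g (v : Vrep j r) :
  ind_map (Defs.coef_map phi j r) (hecke_elt g v) = hecke_elt g (Defs.coef_map phi j r v).
Proof.
rewrite !hecke_eltE raddfD raddf_sum /=; congr (_ + _); last first.
  by rewrite ind_map_elt coef_map_psubst map_hecke_alpha_mx.
by apply: eq_bigr => c _; rewrite ind_map_elt coef_map_psubst map_hecke_teich_mx.
Qed.

End HeckeOperator.

Section Lattice.
Variables (p f : nat) (D : padic_setting p f) (r : 'I_f -> nat) (ap : E D).
Local Notation OE := (intring (vE D)).
Local Notation VO := (Vrep (structOE D) r).
Local Notation L := (ind VO).

Definition null : submodule L := lin_ker (@theta_map p f D r ap).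

Lemma null_saturated c z : val c != 0 -> null (c *: z) -> null z.
Proof.
move=> c_neq0 null_cz.
have : val c *: (theta_map ap z : bigPi r ap) = 0 by rewrite -[RHS]null_cz [RHS]linearZ.
by move/eqP; rewrite scaler_eq0 (negPf c_neq0) => /eqP.
Qed.

Lemma null_hecke g (v : VO) (a : OE) : val a = ap ->
  null (hecke_elt g v - a *: elt g v).
Proof.
move=> aE; apply/qclass_eq0; apply: mem_lspan.
exists (elt g (Defs.coefE D r v), hecke_elt g (Defs.coefE D r v)) => /=.
  by exists [:: (g, Defs.coefE D r v)]; rewrite !big_seq1.
rewrite [LHS](raddfB (ind_map (Defs.coefE D r))); congr (_ - _).
  exact: ind_map_hecke_elt.
rewrite [LHS](ind_map_semilinear (phi := val)) ?ind_map_elt -?aE // => b w.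
exact: coef_mapZ.
Qed.

(* The vectors whose class in Theta is divisible by c. *)
Definition small (c : OE) : submodule L := thicken null c.

Lemma small_elt_multiples c g (u v : VO) :
  multiples (polyV OE r) c (u - v) -> small c (elt g u - elt g v).
Proof.
move=> /multiplesP[w uvE]; rewrite -linearB.
have -> : u - v = c *: (w : VO) by [].
by rewrite linearZ; apply: thicken_scale.
Qed.

Lemma tensor1_zmod : zmod_morphism (@tensor1 OE (kbar D) (redE D) (Theta r ap)).
Proof.
suff tensor1D x y : tensor1 (redE D) (x + y : Theta r ap) = tensor1 (redE D) x + tensor1 (redE D) y.
  by move=> x y; apply/(canRL (addrK _)); rewrite -tensor1D subrK.
rewrite /tensor1 -linearD; apply/qclass_eq; apply: mem_lspan; left.
by exists x, y; rewrite opprD addrA.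
Qed.

HB.instance Definition _ := GRing.isZmodMorphism.Build _ _
  (@tensor1 OE (kbar D) (redE D) (Theta r ap)) tensor1_zmod.

Lemma tensor1Z a (x : Theta r ap) :
  tensor1 (redE D) (a *: x) = redE D a *: tensor1 (redE D) x.
Proof.
by rewrite /tensor1 -linearZ; apply/qclass_eq; apply: mem_lspan; right; exists a, x.
Qed.

Lemma to_theta_linear : linear (@to_theta p f D r ap).
Proof. exact: corestrict_linear. Qed.

HB.instance Definition _ := GRing.isLinear.Build OE L (Theta r ap) _
  (@to_theta p f D r ap) to_theta_linear.

Definition to_thetabar (x : L) : Thetabar r ap := tensor1 (redE D) (to_theta ap x).

Lemma to_thetabar_zmod : zmod_morphism to_thetabar.
Proof. by move=> x y; rewrite /to_thetabar !raddfB. Qed.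

HB.instance Definition _ :=
  GRing.isZmodMorphism.Build L (Thetabar r ap) to_thetabar to_thetabar_zmod.

Lemma to_thetabarZ a x : to_thetabar (a *: x) = redE D a *: to_thetabar x.
Proof. by rewrite /to_thetabar -tensor1Z linearZ. Qed.

Lemma to_thetabar_small c z : redE D c = 0 -> small c z -> to_thetabar z = 0.
Proof.
move=> c0 [w null_w]; have theta0 : to_theta ap (z - c *: w) = 0 by apply: corestrict_eq0.
have /eqP : to_thetabar (z - c *: w) = 0 by rewrite /to_thetabar theta0 raddf0.
by rewrite raddfB /= to_thetabarZ c0 scale0r subr0 => /eqP.
Qed.

End Lattice.

Lemma valuationN (K : fieldType) (v : valuation K) (x : K) : x != 0 -> v (- x) = v x.
Proof. by move=> x_neq0; rewrite -mulN1r vfunM ?oppr_eq0 ?oner_neq0 // vN1 add0r. Qed.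

Lemma valuation_subr (K : fieldType) (v : valuation K) (x y : K) :
  x != 0 -> y != 0 -> v x < v y -> x - y != 0 /\ v (x - y) = v x.
Proof.
move=> x_neq0 y_neq0 lt_xy.
have xy_neq0 : x - y != 0 by rewrite subr_eq0; apply: contraTneq lt_xy => ->; rewrite ltxx.
split=> //; apply/le_anti/andP; split; last first.
  by have := vfunD v x_neq0 _ xy_neq0; rewrite oppr_eq0 valuationN // min_l ?(ltW lt_xy) //; apply.
have := vfunD v xy_neq0 y_neq0; rewrite subrK => /(_ x_neq0).
by rewrite ge_min [v y <= v x]leNgt lt_xy orbF.
Qed.

Lemma dvd_intring_ex (K : fieldType) (v : valuation K) (x y : intring v) :
  val x != 0 -> val y != 0 -> v (val x) <= v (val y) -> exists d, y = d * x.
Proof.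
move=> x_neq0 y_neq0 le_xy; have int_d : val y / val x \in intring_pred v.
  by rewrite unfold_in /vge vfunM ?invr_eq0 // vV // subr_ge0 le_xy orbT.
by exists (Sub (val y / val x) int_d); apply/val_inj; rewrite /= divfK.
Qed.

Section Valuations.
Variables (p f : nat) (D : padic_setting p f).
Local Notation OE := (intring (vE D)).

Lemma vE_nat n : (0 < n)%N -> n%:R != 0 :> E D /\ vE D n%:R = (logn p n)%:R.
Proof.
move=> n_gt0; have [n_neq0 vn] := vF_nat D n_gt0.
have nE : n%:R = (n%:R : F D)%:A :> E D by rewrite scaler_nat.
by rewrite nE vE_F // vn scaler_eq0 negb_or n_neq0 oner_neq0.
Qed.

Lemma pE_neq0 : p%:R != 0 :> E D.
Proof. by have [] := vE_nat (prime_gt0 (p_prime D)). Qed.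

Lemma vE_p : vE D p%:R = 1.
Proof.
by have [_ ->] := vE_nat (prime_gt0 (p_prime D)); rewrite logn_prime ?eqxx ?(p_prime D).
Qed.

Lemma maximal_ideal_ex (x : E D) : x != 0 -> 0 < vE D x ->
  exists2 y : OE, val y = x & redE D y = 0.
Proof.
move=> x_neq0 vx_gt0; have int_x : x \in intring_pred (vE D).
  by rewrite unfold_in /vge (ltW vx_gt0) orbT.
by exists (Sub x int_x) => //; apply/redE_ker; rewrite /vgt /= vx_gt0 orbT.
Qed.

Lemma dvd_maximal_ideal_ex (x y : OE) : val x != 0 -> val y != 0 ->
  vE D (val x) < vE D (val y) -> exists2 d, y = x * d & redE D d = 0.
Proof.
move=> x_neq0 y_neq0 lt_xy; have [||d dE red_d] := @maximal_ideal_ex (val y / val x).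
- by rewrite mulf_neq0 ?invr_eq0.
- by rewrite vfunM ?invr_eq0 // vV // subr_gt0.
by exists d => //; apply/val_inj; rewrite /= dE mulrC divfK.
Qed.

Lemma common_divisor_ex (c x y : OE) :
  val c != 0 -> val x != 0 -> val y != 0 ->
  vE D (val c) < vE D (val x) -> vE D (val c) < vE D (val y) ->
  exists2 e, redE D e = 0 & (exists d, x = d * (c * e)) /\ (exists d, y = d * (c * e)).
Proof.
move=> c_neq0; wlog le_xy : x y / vE D (val x) <= vE D (val y).
  move=> wlog_le x_neq0 y_neq0 lt_cx lt_cy; case/orP: (le_total (vE D (val x)) (vE D (val y))).
    by move=> ?; apply: wlog_le.
  by move=> ?; have [|||||e ? []] := wlog_le y x => //; exists e.
move=> x_neq0 y_neq0 lt_cx _; have [e xE red_e] := dvd_maximal_ideal_ex c_neq0 x_neq0 lt_cx.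
exists e => //; rewrite -xE; split; first by exists 1; rewrite mul1r.
exact: dvd_intring_ex.
Qed.

End Valuations.

Section Discriminant.
Variables (p f : nat) (D : padic_setting p f) (ap : E D) (n : nat).
Local Notation discr := (ap ^+ 2 - p%:R * n%:R).
Hypotheses (n_gt0 : (0 < n)%N) (ap_neq0 : ap != 0).
Hypothesis v_lt1 : vE D ap < 1.

Lemma discriminant_valuation :
  vE D ap <> 2^-1 \/ (vE D ap = 2^-1 /\ padic_unit (vE D) (discr / p%:R)) ->
  discr != 0 /\
  (vE D discr = vE D ap *+ 2 \/ (vE D discr = 1 /\ 2^-1 <= vE D ap)).
Proof.
have p_neq0 := pE_neq0 D; have [n_neq0 vn] := vE_nat D n_gt0.
have pn_neq0 : p%:R * n%:R != 0 :> E D by rewrite mulf_neq0.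
have ap2_neq0 : ap ^+ 2 != 0 by rewrite expf_neq0.
have v_pn : vE D (p%:R * n%:R) = 1 + (logn p n)%:R by rewrite vfunM // vE_p vn.
have v_ap2 : vE D (ap ^+ 2) = vE D ap *+ 2 by rewrite vfunX.
have [lt_ap2_pn _|le_pn_ap2] := ltP (vE D (ap ^+ 2)) (vE D (p%:R * n%:R)).
  by have [? ->] := valuation_subr ap2_neq0 pn_neq0 lt_ap2_pn; split=> //; left.
rewrite v_ap2 v_pn in le_pn_ap2; have logn0 : logn p n = 0%N.
  apply/eqP; rewrite -leqn0 -ltnS -(ltr_nat rat) -(ltrD2l 1).
  by apply: le_lt_trans le_pn_ap2 _; rewrite mulr2n ltrD.
have half_le : 2^-1 <= vE D ap by move: le_pn_ap2; rewrite logn0; lra.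
case=> [neq_half|[_ [unit_neq0 v_unit]]].
  have lt_pn_ap2 : vE D (p%:R * n%:R) < vE D (ap ^+ 2).
    by rewrite v_ap2 v_pn logn0 addr0; move/eqP: neq_half; lra.
  have [c_neq0 v_c] := valuation_subr pn_neq0 ap2_neq0 lt_pn_ap2.
  rewrite -opprB oppr_eq0 valuationN //; split=> //; right; split=> //.
  by rewrite v_c v_pn logn0 addr0.
have c_neq0 : discr != 0 by apply: contra_neq unit_neq0 => ->; rewrite mul0r.
split=> //; right; split=> //; move/eqP: v_unit.
by rewrite vfunM ?invr_eq0 // vV // vE_p subr_eq0 => /eqP.
Qed.

End Discriminant.

Lemma discriminant_factor_ex (p f : nat) (D : padic_setting p f) (a : intring (vE D)) n :
  (0 < n)%N -> val a != 0 -> 0 < vE D (val a) -> vE D (val a) < 1 ->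
  vE D (val a) <> 2^-1 \/ (vE D (val a) = 2^-1 /\
    padic_unit (vE D) ((val a ^+ 2 - p%:R * n%:R) / p%:R)) ->
  exists c e : intring (vE D), [/\ val c != 0, redE D e = 0, c = a ^+ 2 - p%:R * n%:R,
    exists d, a * p%:R = d * (c * e) & exists d, a ^+ 3 = d * (c * e)].
Proof.
move=> n_gt0 a_neq0 v_gt0 v_lt1 a_discr; pose c : intring (vE D) := a ^+ 2 - p%:R * n%:R.
have [c_neq0 v_c] := discriminant_valuation n_gt0 a_neq0 v_lt1 a_discr.
have val_c : val c = val a ^+ 2 - p%:R * n%:R by rewrite /= !val_intring_nat.
have val_ap : val (a * p%:R) = val a * p%:R by rewrite /= val_intring_nat.
have val_a3 : val (a ^+ 3) = val a ^+ 3 by [].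
have [||||| e red_e [ap_ce a3_ce]] := @common_divisor_ex _ _ D c (a * p%:R) (a ^+ 3).
- by rewrite val_c.
- by rewrite val_ap mulf_neq0 ?pE_neq0.
- by rewrite val_a3 expf_neq0.
- by rewrite val_c val_ap vfunM ?pE_neq0 // vE_p; case: v_c => [->|[-> _]]; lra.
- by rewrite val_c val_a3 vfunX //; case: v_c => [->|[-> ?]]; lra.
by exists c, e; rewrite val_c.
Qed.

(** * Estimates for T - a_p *)

Section HeckeEstimates.
Variables (p f : nat) (D : padic_setting p f) (r : 'I_f -> nat) (a : intring (vE D)).
Variable h : 'I_f.
Local Notation OF := (intring (vF D)).
Local Notation OE := (intring (vE D)).
Local Notation G := (GL2 (F D)).
Local Notation jO := (structOE D).
Local Notation VO := (Vrep jO r).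
Local Notation L := (ind VO).
Local Notation q1 := (p ^ f - 1)%N.
Local Notation small := (@small p f D r (val a)).
Local Notation delta i := (fun j => (j == i : nat)).
Hypothesis p_gt2 : (2 < p)%N.
Hypothesis r_ge_q : forall i, (p ^ f <= r i)%N.
Hypothesis r_mod : ofdigits p r = p ^ h %[mod q1].
Hypotheses (a_neq0 : val a != 0) (va_lt1 : vE D (val a) < 1).

Let f_gt0 : (0 < f)%N := leq_ltn_trans (leq0n h) (ltn_ord h).
Let r_gt1 i : (1 < r i)%N.
Proof. exact: leq_trans (ltnW (q_gt2 D p_gt2 f_gt0)) (r_ge_q i). Qed.
Let r_gt0 i : (0 < r i)%N := ltnW (r_gt1 i).
Let ofdigits_r_gt0 : (0 < ofdigits p r)%N := ofdigits_r_gt0 D h r_ge_q.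

Lemma p_dvd_a : exists2 d : OE, p%:R = a * d & redE D d = 0.
Proof.
by apply: dvd_maximal_ideal_ex; rewrite ?val_intring_nat ?pE_neq0 ?vE_p.
Qed.

Definition powX : VO := linprod r (fun=> 1) (fun=> 0).
Definition powY : VO := linprod r (fun=> 0) (fun=> 1).
Definition epsO : VO := vmon OE r (delta h).

Definition teich_sum (g : G) (e : nat) : L :=
  \sum_(c : kF D) elt (g * gl_teich c)%g ((- jO (teich c)) ^+ e *: powX).

Lemma teich_sum_mod g e e' : (0 < e)%N -> (0 < e')%N -> e = e' %[mod q1] ->
  teich_sum g e = teich_sum g e'.
Proof.
move=> e_gt0 e'_gt0 ee'; apply: eq_bigr => c _.
rewrite (@expr_eq_mod _ (p ^ f) _ e e') ?(expp_gt0 D) //.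
by rewrite exprN_odd ?(odd_expp D) // -rmorphXn teichX.
Qed.

Lemma hecke_teich_part_small g b : (forall i, b i <= r i)%N ->
  small p%:R (\sum_(c : kF D) elt (g * gl_teich c)%g
      (psubst (hecke_teich_mx jO c) (vmon OE r b) : VO) - teich_sum g (ofdigits p b)).
Proof.
move=> b_le; rewrite -sumrB; apply: smem_sum => c _; apply: small_elt_multiples.
rewrite -prodr_expr_ofdigits -psubst_vmon_diag0 //; apply: psubst_multiples => i k l.
rewrite !mxE; case: (k == 0); case: (l == 0); rewrite /= ?subrr.
- by exists 0; rewrite mulr0.
- by exists 0; rewrite mulr0.
- by exists 0; rewrite mulr0.
by exists 1; rewrite subr0 mulr1.
Qed.

Lemma hecke_alpha_part_small g b i : (forall i, b i <= r i)%N -> (b i < r i)%N ->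
  small p%:R (elt g (psubst (@hecke_alpha_mx p f OE) (vmon OE r b) : VO)).
Proof.
move=> b_le b_lt; rewrite -[elt _ _]subr0 -(linear0 (elt g)).
apply: small_elt_multiples; rewrite -[0](psubst_vmon_diag1 OE b_le b_lt).
apply: psubst_multiples => i' k l.
rewrite !mxE; case: (k == 0); case: (l == 0); rewrite /= ?subrr.
- by exists 1; rewrite subr0 mulr1.
- by exists 0; rewrite mulr0.
- by exists 0; rewrite mulr0.
by exists 0; rewrite mulr0.
Qed.

Lemma hecke_vmon_small g b i : (forall i, b i <= r i)%N -> (b i < r i)%N ->
  small p%:R (hecke_elt g (vmon OE r b : VO) - teich_sum g (ofdigits p b)).
Proof.
move=> b_le b_lt; rewrite hecke_eltE addrAC.
by apply: smemD; [apply: hecke_teich_part_small | apply: hecke_alpha_part_small b_lt].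
Qed.

Lemma psubst_alpha_powY : psubst (@hecke_alpha_mx p f OE) (powY : polyV OE r) = powY.
Proof.
rewrite [LHS]psubst_linprod; apply: eq_linprod => i; rewrite !mxE /=.
  by rewrite mulr0 mul0r addr0.
by rewrite mulr0 mul1r add0r.
Qed.

Lemma hecke_powY_small g : small p%:R
  (hecke_elt g powY - teich_sum g (ofdigits p r) - elt (g * gl_alpha D)%g powY).
Proof.
rewrite hecke_eltE psubst_alpha_powY [X in X - _]addrAC addrK.
by rewrite /powY linprod01; apply: hecke_teich_part_small.
Qed.

(* T sends both monomials to the same element modulo p, a proper multiple of a. *)
Lemma to_thetabar_congr_monomials g b b' i i' : (forall i, b i <= r i)%N ->
  (forall i, b' i <= r i)%N -> (0 < ofdigits p b)%N -> (0 < ofdigits p b')%N ->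
  ofdigits p b = ofdigits p b' %[mod q1] -> (b i < r i)%N -> (b' i' < r i')%N ->
  to_thetabar (val a) (elt g (vmon OE r b - vmon OE r b' : VO)) = 0.
Proof.
move=> b_le b'_le b_gt0 b'_gt0 bb' b_lt b'_lt; have [d pE red_d] := p_dvd_a.
apply: (to_thetabar_small red_d); set w : VO := _ - _.
have [z null_z] : small (a * d) (a *: elt g w).
  rewrite -pE -[a *: _](subKr (hecke_elt g w)); apply: smemB.
    rewrite /w linearB; have := hecke_vmon_small g b'_le b'_lt.
    rewrite -(teich_sum_mod g b_gt0 b'_gt0 bb').
    by move=> /(smemB (hecke_vmon_small g b_le b_lt)); rewrite opprB addrA subrK.
  by apply: thicken_sub; apply: null_hecke.
exists z; apply: (null_saturated a_neq0); move: null_z.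
by rewrite -scalerA -scalerBr.
Qed.

(* The sums over F_q in T Y^r and T eps agree modulo p. *)
Lemma powY_alpha_small g :
  small p%:R (elt (g * gl_alpha D)%g powY - a *: elt g (powY - epsO)).
Proof.
have eps_le i : (delta h i <= r i)%N by rewrite /=; case: (i == h) => //=.
have eps_lt : (delta h h < r h)%N by rewrite eqxx.
have eps_small := hecke_vmon_small g eps_le eps_lt.
rewrite -(@teich_sum_mod g (ofdigits p r)) ?ofdigits_delta ?(expp_gt0 D) // in eps_small.
apply: smemB_trans (smemBC (hecke_powY_small g)) _.
apply: (smemB_trans (y := hecke_elt g (powY - epsO))); last first.
  exact/thicken_sub/null_hecke.
by rewrite linearB opprB addrC subrKA.
Qed.

Lemma small_powY g : small a (elt g powY).
Proof.
have [d pE _] := p_dvd_a; have := powY_alpha_small (g * (gl_alpha D)^-1)%g.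
rewrite mulgVK pE mulrC => /thicken_mulr powY_small.
set y := a *: elt (g * (gl_alpha D)^-1)%g (powY - epsO) in powY_small.
by rewrite -[elt g powY](subrK y); apply: smemD => //; apply: thicken_scale.
Qed.

Lemma small_act_powY g k : small a (elt g (act k powY)).
Proof. by rewrite -(elt_KZ g 0 k); apply: small_powY. Qed.

Lemma act_wgl_powY : act (wgl D) powY = powX.
Proof.
rewrite /= /weight_act_fun expr0 scale1r [LHS]psubst_linprod.
by apply: eq_linprod => i; rewrite !mxE /= ?rmorph0 ?rmorph1; ring.
Qed.

Lemma small_powX g : small a (elt g powX).
Proof. by rewrite -act_wgl_powY; apply: small_act_powY. Qed.

Definition ugl_powY (m : kF D) : VO := act (ugl (teich m)) powY.

Lemma ugl_powYE m : ugl_powY m = linprod r (fun i => jO (frobn i (teich m))) (fun=> 1).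
Proof.
rewrite /ugl_powY /= /weight_act_fun expr0 scale1r [LHS]psubst_linprod.
by apply: eq_linprod => i; rewrite !mxE /= ?rmorph0 ?rmorph1; ring.
Qed.

Lemma elt_ugl_powY g m : elt g (ugl_powY m) = elt (g * gl_teich m * gl_alpha D)%g powY.
Proof.
rewrite /ugl_powY -(elt_KZ g 1 (ugl (teich m))); congr elt; rewrite -mulgA; congr (_ * _)%g.
apply/val_inj/matrixP => i k; rewrite /= !mxE sum2 !mxE expr1z.
by do 2 case: (_ == 0); rewrite /= ?val_intring_nat; ring.
Qed.

Definition frob_diff (c m : kF D) (i : 'I_f) : OF := frobn i (teich m) - teich c ^+ (p ^ i).

Lemma psubst_teich_ugl_powY c m :
  psubst (hecke_teich_mx jO c) (ugl_powY m : polyV OE r) =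
  linprod r (fun i => jO (frob_diff c m i)) (fun i => p%:R * 1).
Proof.
rewrite ugl_powYE psubst_linprod; apply: eq_linprod => i; rewrite !mxE /=; last by ring.
by rewrite exprN_odd ?(odd_expp D) // rmorphB rmorphXn; ring.
Qed.

Lemma psubst_alpha_ugl_powY m :
  psubst (@hecke_alpha_mx p f OE) (ugl_powY m : polyV OE r) =
  linprod r (fun i => p%:R * jO (frobn i (teich m))) (fun=> 1).
Proof.
by rewrite ugl_powYE psubst_linprod; apply: eq_linprod => i; rewrite !mxE /=; ring.
Qed.

Lemma resF_frob_diff c m i : resF D (frob_diff c m i) = (m - c) ^+ (p ^ i).
Proof.
rewrite rmorphB resF_frobn rmorphXn !res_teich (exprD_pchar_pow (kF_pchar D)).
by rewrite exprN_odd ?(odd_expp D).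
Qed.

Lemma sum_prod_frob_diff c (e : 'I_f -> nat) : (0 < ofdigits p e)%N ->
  resF D (\sum_m \prod_(j < f) frob_diff c m j ^+ e j) = - (q1 %| ofdigits p e)%N%:R.
Proof.
move=> e_gt0; rewrite -(pred_card_kF D) -(sum_translate_finField c e_gt0) rmorph_sum.
apply: eq_bigr => m _.
rewrite rmorph_prod -prodr_expr_ofdigits; apply: eq_bigr => j _.
by rewrite rmorphXn resF_frob_diff.
Qed.

Lemma sum_prod_frob_diff_dvd c : exists z : OE,
  \sum_m \prod_(j < f) jO (frob_diff c m j) ^+ r j = p%:R * z.
Proof.
have [|z sumE] := @resF_eq0_dvd _ _ D (\sum_m \prod_(j < f) frob_diff c m j ^+ r j).
  rewrite sum_prod_frob_diff // /dvdn r_mod modn_small ?ltn_expp_q1 //.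
  by rewrite gtn_eqF ?oppr0 ?(expp_gt0 D).
exists (jO z); rewrite -(rmorph_nat jO) -rmorphM -sumE rmorph_sum; apply: eq_bigr => m _.
by rewrite rmorph_prod; apply: eq_bigr => j _; rewrite rmorphXn.
Qed.

Lemma sum_prod_frob_diff_delta c i : exists z : OE,
  \sum_m (r i)%:R * 1 * \prod_(j < f) jO (frob_diff c m j) ^+ (r j - (j == i)) =
  - ((r h)%:R * (i == h)%:R) + p%:R * z.
Proof.
have le_delta j : (delta i j <= r j)%N by apply: delta_le.
have lt_of : (p ^ i < ofdigits p r)%N.
  by rewrite -(ofdigits_delta p i); apply: (ltn_ofdigits (p_gt1 D) (i := i)); rewrite ?eqxx.
have [|z sumE] := @resF_eq_mod _ _ D
    ((r i)%:R * \sum_m \prod_(j < f) frob_diff c m j ^+ (r j - (j == i)))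
    (- ((r h)%:R * (i == h)%:R)).
  rewrite rmorphM sum_prod_frob_diff ofdigitsB // ofdigits_delta ?subn_gt0 //.
  rewrite rmorphN rmorphM !rmorph_nat mulrN; congr (- _).
  have -> : (q1 %| ofdigits p r - p ^ i)%N = (i == h).
    rewrite -eqn_mod_dvd ?(ltnW lt_of) // r_mod !modn_small ?ltn_expp_q1 //.
    by rewrite eqn_exp2l ?(p_gt1 D) // eq_sym.
  by case: eqVneq => [->|] //; rewrite !mulr0.
exists (jO z); rewrite -mulr_sumr mulr1.
transitivity (jO (- ((r h)%:R * (i == h)%:R) + p%:R * z)); last first.
  by rewrite rmorphD rmorphN !rmorphM !rmorph_nat.
rewrite -sumE rmorphM rmorph_nat rmorph_sum; congr (_ * _); apply: eq_bigr => m _.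
by rewrite rmorph_prod; apply: eq_bigr => j _; rewrite rmorphXn.
Qed.

Lemma sum_frobn_teich_dvd i : exists z : OE,
  \sum_(m : kF D) (r i)%:R * jO (frobn i (teich m)) = p%:R * z.
Proof.
have [|z sumE] := @resF_eq0_dvd _ _ D (\sum_(m : kF D) frobn i (teich m)).
  rewrite rmorph_sum; under eq_bigr do rewrite resF_frobn res_teich.
  rewrite sum_expr_finField ?(expp_gt0 D) // pred_card_kF.
  by rewrite gtnNdvd ?oppr0 ?(expp_gt0 D) ?ltn_expp_q1.
exists ((r i)%:R * jO z); rewrite -mulr_sumr mulrCA; congr (_ * _).
by rewrite -(rmorph_nat jO p) -rmorphM -sumE rmorph_sum.
Qed.

Definition sum_ugl_powY : VO := \sum_(m : kF D) ugl_powY m.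

Lemma psubst_sum_ugl_powY A :
  psubst A (sum_ugl_powY : polyV OE r) = \sum_m psubst A (ugl_powY m : polyV OE r).
Proof. exact: (linear_sum (psubst A (r := r))). Qed.

Lemma psubst_teich_sum_ugl_powY c : exists z : OE, multiples VO (p%:R ^+ 2)
  (psubst (hecke_teich_mx jO c) (sum_ugl_powY : polyV OE r) -
   (p%:R *: (z *: powX) - (p%:R * (r h)%:R) *: epsO)).
Proof.
have [z powX_coef] := sum_prod_frob_diff_dvd c.
have [w eps_coef] := choice (sum_prod_frob_diff_delta c).
exists z; rewrite psubst_sum_ugl_powY; under eq_bigr do rewrite psubst_teich_ugl_powY.
pose taylor m := (\prod_j jO (frob_diff c m j) ^+ r j) *: powX + p%:R *:
  \sum_i ((r i)%:R * 1 * \prod_j jO (frob_diff c m j) ^+ (r j - (j == i))) *: vmon OE r (delta i).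
apply: (smemB_trans (y := \sum_m taylor m)).
  by rewrite -sumrB; apply: smem_sum => m _; apply: linprod_taylorX.
apply/multiplesP; exists (\sum_i w i *: vmon OE r (delta i)).
rewrite big_split -scaler_suml powX_coef -scaler_sumr exchange_big /=.
under [X in _ + _ *: X]eq_bigr => i _ do rewrite -scaler_suml eps_coef scalerDl -scalerA.
rewrite big_split /= -scaler_sumr (bigD1 h) //= eqxx mulr1 big1 => [|i /negPf ->]; last first.
  by rewrite mulr0 oppr0 scale0r.
by rewrite addr0 scaleNr scalerDr scalerN !scalerA expr2 addrA [LHS]addrAC subrr add0r.
Qed.

Lemma psubst_alpha_sum_ugl_powY : exists z : OE, multiples VO (p%:R ^+ 2)
  (psubst (@hecke_alpha_mx p f OE) (sum_ugl_powY : polyV OE r) - p%:R *: (z *: powY)).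
Proof.
have [w coef] := choice sum_frobn_teich_dvd.
exists (p ^ f.-1)%:R; rewrite psubst_sum_ugl_powY; under eq_bigr do rewrite psubst_alpha_ugl_powY.
pose taylor (m : kF D) := powY + p%:R *:
  \sum_i ((r i)%:R * jO (frobn i (teich m))) *: vmon OE r (fun j => r j - (j == i))%N.
apply: (smemB_trans (y := \sum_m taylor m)).
  rewrite -sumrB; apply: smem_sum => m _.
  have := linprod_taylorY p%:R r_gt0 (fun=> 1) (fun i => jO (frobn i (teich m))).
  have prod1 (n : 'I_f -> nat) : \prod_j 1 ^+ n j = 1 :> OE.
    by rewrite big1 // => j _; rewrite expr1n.
  by rewrite prod1 scale1r; under eq_bigr do rewrite prod1 mulr1.
apply/multiplesP; exists (\sum_i w i *: vmon OE r (fun j => r j - (j == i))%N).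
rewrite big_split sumr_const -scaler_sumr exchange_big /=.
under [X in _ + _ *: X - _]eq_bigr => i _ do rewrite -scaler_suml coef -scalerA.
rewrite -scaler_sumr (card_kF D) scalerA -natrM -expnS prednK // scaler_nat addrC addKr.
by rewrite scalerA expr2.
Qed.

Lemma small_elt_multiples_p2 g (u v : VO) : multiples VO (p%:R ^+ 2) (u - v) ->
  small (a * p%:R) (elt g u - elt g v).
Proof.
move=> /small_elt_multiples small_uv; have [d pE _] := p_dvd_a.
have p2E : p%:R ^+ 2 = d * (a * p%:R) :> OE by rewrite expr2 {1}pE mulrAC mulrC.
by apply: (@thicken_mulr _ _ _ d); rewrite -p2E; apply: small_uv.
Qed.

Lemma small_pZ x : small a x -> small (a * p%:R) (p%:R *: x).
Proof. by rewrite mulrC; apply: thickenZ. Qed.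

Definition teich_eps (g : G) : L := \sum_(c : kF D) elt (g * gl_teich c)%g epsO.

Lemma hecke_sum_ugl_powY g :
  small (a * p%:R) (hecke_elt g sum_ugl_powY + (p%:R * (r h)%:R) *: teich_eps g).
Proof.
rewrite hecke_eltE addrAC; apply: smemD; last first.
  have [z psubstE] := psubst_alpha_sum_ugl_powY.
  rewrite -[elt _ _](subrK (elt (g * gl_alpha D)%g (p%:R *: (z *: powY)))).
  apply: smemD; first exact: small_elt_multiples_p2.
  by rewrite linearZ linearZ; apply/small_pZ/smemZ/small_powY.
rewrite scaler_sumr -big_split; apply: smem_sum => c _ /=.
have [z psubstE] := psubst_teich_sum_ugl_powY c; set g' := (g * gl_teich c)%g.
have powX_small : small (a * p%:R) (p%:R *: (z *: elt g' powX)).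
  exact/small_pZ/smemZ/small_powX.
have := smemD (small_elt_multiples_p2 g' psubstE) powX_small.
by rewrite linearB linearZ linearZ linearZ opprB addrA subrK.
Qed.

Lemma elt_sum_ugl_powY (N : submodule L) g : (forall x, small (a * p%:R) x -> N x) ->
  (forall x, small (a ^+ 3) x -> N x) ->
  N (a *: elt g sum_ugl_powY + a ^+ 2 *: teich_eps g).
Proof.
move=> N_ap N_a3; rewrite linear_sum !scaler_sumr -big_split; apply: smem_sum => m _ /=.
rewrite elt_ugl_powY; set g' := (g * gl_teich m)%g.
have N_powY : N (a ^+ 2 *: elt g' powY).
  by apply: N_a3; rewrite exprSr; apply/thickenZ/small_powY.
have := smemD (N_ap _ (thickenZ a (powY_alpha_small g'))) N_powY.
by rewrite scalerBr scalerA -expr2 linearB scalerBr opprB addrA subrK.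
Qed.

Lemma to_thetabar_teich_eps g (c e : OE) : val c != 0 -> redE D e = 0 ->
  c = a ^+ 2 - p%:R * (r h)%:R -> (exists d, a * p%:R = d * (c * e)) ->
  (exists d, a ^+ 3 = d * (c * e)) -> to_thetabar (val a) (teich_eps g) = 0.
Proof.
move=> c_neq0 red_e cE [d ap_ce] [d' a3_ce]; apply: (to_thetabar_small red_e).
have N_ap x : small (a * p%:R) x -> small (c * e) x by rewrite ap_ce; apply: thicken_mulr.
have N_a3 x : small (a ^+ 3) x -> small (c * e) x by rewrite a3_ce; apply: thicken_mulr.
have [z null_z] : small (c * e) (c *: teich_eps g).
  have null_hecke_sum := thicken_sub (c * e) (null_hecke (r := r) g sum_ugl_powY (erefl (val a))).
  have := smemB (smemD null_hecke_sum (elt_sum_ugl_powY g N_ap N_a3))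
                     (N_ap _ (hecke_sum_ugl_powY g)).
  by rewrite addrA subrK opprD addrACA subrr add0r -scalerBl -cE.
exists z; apply: (null_saturated c_neq0); move: null_z.
by rewrite -scalerA -scalerBr.
Qed.
End HeckeEstimates.

(** * The natural surjection *)

Section IndBaseChange.
Variables (p f : nat) (D : padic_setting p f) (R R' : comNzRingType).
Variables (phi : {rmorphism R -> R'}) (j : {rmorphism intring (vF D) -> R}).
Variable r : 'I_f -> nat.
Local Notation G := (GL2 (F D)).
Local Notation M := (Vrep j r).
Local Notation M' := (Vrep (phi \o j) r).
Variables (C : lmodType R') (t : {additive ind M -> C}).
Hypothesis t_semilinear : forall a x, t (a *: x) = phi a *: t x.

Definition fiber_map (g : G) (v : M') : C :=
  \sum_(m <- msupp (val (v : polyV R' r)))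
     (val (v : polyV R' r))@_m *: t (elt g^-1%g (vmon R r (expY m) : M)).

Lemma fiber_map_linear g : linear (fiber_map g).
Proof.
apply: (@sum_support_linear R' _ M' R'^o C (fun m v => (val (v : polyV R' r))@_m)
  (fun v => msupp (val (v : polyV R' r)))
  (fun m c => c *: t (elt g^-1%g (vmon R r (expY m) : M)))).
- by move=> m a u v; rewrite /= mcoeffD mcoeffZ.
- by move=> m a c c'; rewrite scalerDl scalerA.
- by move=> v; apply: msupp_uniq.
by move=> v m; rewrite mcoeff_msupp.
Qed.

Lemma fiber_map_coef_map g (v : M) :
  fiber_map g (Defs.coef_map phi j r v) = t (elt g^-1%g v).
Proof.
set w := val (v : polyV R r); set mon_term := fun m => t (elt g^-1%g (vmon R r (expY m) : M)).
have -> : t (elt g^-1%g v) = \sum_(m <- msupp w) phi w@_m *: mon_term m.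
  rewrite {1}[v]polyV_sum_mon linear_sum raddf_sum; apply: eq_bigr => m _.
  by rewrite linearZ t_semilinear.
transitivity (\sum_(m <- msupp (map_mpoly phi w)) phi w@_m *: mon_term m).
  by apply: eq_bigr => m _; congr (_ *: _); apply: mcoeff_map_mpoly.
apply: eq_big_support; rewrite ?msupp_uniq // => m; rewrite mcoeff_msupp.
  by rewrite mcoeff_map_mpoly; apply: contraNneq => ->; rewrite scale0r.
by apply: contraNneq => ->; rewrite rmorph0 scale0r.
Qed.

Lemma ind_base_change_ex : exists psi : {linear ind M' -> C},
  forall x, psi (ind_map (Defs.coef_map phi j r) x) = t x.
Proof.
have [reps repsP] := choice (@support_reps_ex p f D R' M').
pose value (g : G) (x : ind M') : M' := if coset_rep g == g then ind_fun x g else 0.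
have value_supp x g : value g x != 0 -> g \in reps x.
  rewrite /value; have [_ _ supp_x] := repsP x.
  by case: (eqVneq (coset_rep g) g) => [e gx|_ /eqP//]; rewrite -e; apply: supp_x.
have [|psi psiE] := @linear_fun_ex _ _ _ (fun x => \sum_(g <- reps x) fiber_map g (value g x)).
  apply: sum_support_linear => [g a x y|g|x|//].
  - by rewrite /value; case: ifP => _; rewrite ?ind_funP ?scaler0 ?addr0.
  - exact: fiber_map_linear.
  by have [] := repsP x.
exists psi => x; rewrite psiE; have [s sP] := support_reps_ex x.
have [s_uniq s_rep s_supp] := sP; have [reps_uniq _ _] := repsP (ind_map (Defs.coef_map phi j r) x).
have fiber0 g : fiber_map g 0 = 0.
  by have [u uE] := linear_fun_ex (fiber_map_linear g); rewrite -uE linear0.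
rewrite [in RHS](ind_sum_elt sP) raddf_sum (@eq_big_support _ _ _ _ s) //.
- rewrite big_seq [RHS]big_seq; apply: eq_bigr => g gs.
  by rewrite /value s_rep // eqxx -fiber_map_coef_map.
- by move=> g gx; apply: value_supp; apply: contraNneq gx => ->; rewrite fiber0.
move=> g; rewrite /value; case: (eqVneq (coset_rep g) g) => [e gx|]; last by rewrite fiber0 eqxx.
rewrite -e; apply: s_supp; apply: contraNneq gx => x0.
by rewrite -[ind_fun _ _]/(Defs.coef_map phi j r (ind_fun x _)) x0 raddf0 fiber0.
Qed.

End IndBaseChange.

Lemma natural_surj_ex (p f : nat) (D : padic_setting p f) (r : 'I_f -> nat) (ap : E D) :
  exists psi : {linear ind (Vrep (structkbar D) r) -> Thetabar r ap}, natural_surj psi.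
Proof. exact: ind_base_change_ex (@to_thetabarZ _ _ D r ap). Qed.

Section NaturalSurjection.
Variables (p f : nat) (D : padic_setting p f) (r : 'I_f -> nat) (a : intring (vE D)).
Variable h : 'I_f.
Local Notation OE := (intring (vE D)).
Local Notation kb := (kbar D).
Local Notation VO := (Vrep (structOE D) r).
Local Notation V := (Vrep (structkbar D) r).
Variable psi : {linear ind V -> Thetabar r (val a)}.
Hypothesis psi_natural : natural_surj psi.

Lemma psi_elt g (v : VO) :
  psi (elt g (coefkbar D r v)) = to_thetabar (val a) (elt g v).
Proof. by rewrite -ind_map_elt; apply: psi_natural. Qed.

Lemma coefkbar_vmon b : (forall i, b i <= r i)%N ->
  coefkbar D r (vmon OE r b) = vmon kb r b.
Proof.
move=> b_le; apply/val_inj; rewrite [RHS]val_vmon //.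
transitivity (map_mpoly (redE D) (val (vmon OE r b))); first by [].
by rewrite val_vmon // map_mpolyX.
Qed.

Hypothesis p_gt2 : (2 < p)%N.
Hypothesis r_ge_q : forall i, (p ^ f <= r i)%N.
Hypothesis r_mod : ofdigits p r = p ^ h %[mod p ^ f - 1].
Hypotheses (a_neq0 : val a != 0) (va_gt0 : 0 < vE D (val a)) (va_lt1 : vE D (val a) < 1).

Let f_gt0 : (0 < f)%N := leq_ltn_trans (leq0n h) (ltn_ord h).

Lemma psi_theta_relation g (v : V) : theta_relation v -> psi (elt g v) = 0.
Proof.
move=> [i0 [b [b_ge b_lt b_le ->]]]; have p_gt0 : (0 < p)%N := ltnW (p_gt1 D).
have carry_r := carry_le b_ge b_le b_lt.
rewrite -!coefkbar_vmon // -raddfB psi_elt.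
apply: (to_thetabar_congr_monomials p_gt2 a_neq0 va_lt1 g (i := ordS i0) (i' := i0)) => //.
- by apply: (ofdigits_gt0 (p_gt1 D) (i := i0)); apply: leq_trans b_ge.
- by apply: (ofdigits_gt0 (p_gt1 D) (i := ordS i0)); apply: carry_ordS_gt0.
- exact/esym/ofdigits_carry_mod/p_gt0.
exact: carry_ltn (p_gt1 D).
Qed.

Lemma psi_Vstar g (v : V) : Vstar D r v -> psi (elt g v) = 0.
Proof.
move=> /evalfun_Vstar/(evalfun_eq0_theta_span f_gt0 r_ge_q) span_v.
exact: (span_v (lin_ker (psi \o elt g)) (@psi_theta_relation g)).
Qed.

Lemma psi_Xr g (v : V) : Xr D r v -> psi (elt g v) = 0.
Proof.
move=> Xr_v; apply: (Xr_v (lin_ker (psi \o elt g))) => _ [k [x [xE ->]]].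
have -> : x = coefkbar D r (act (wgl D) (powY D r)).
  rewrite act_wgl_powY /powX linprod10 coefkbar_vmon //.
  by apply/val_inj; rewrite xE -linprod10; apply: eq_bigr => i _; rewrite scale1r scale0r addr0.
suff: psi (elt g (act k (coefkbar D r (act (wgl D) (powY D r))))) = 0 by [].
rewrite -equivar_act psi_elt -actM.
have [b ba red_b] := @maximal_ideal_ex _ _ D (val a) a_neq0 va_gt0.
apply: (@to_thetabar_small _ _ D r (val a) a).
  by have -> : a = b by apply/val_inj.
exact: (small_act_powY p_gt2 r_ge_q r_mod).
Qed.

Lemma psi_add_sub g (v : V) : add_sub (Vstar D r) (Xr D r) v -> psi (elt g v) = 0.
Proof.
move=> sum_v; apply: (sum_v (lin_ker (psi \o elt g))) => w [|].
  exact: psi_Vstar.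
exact: psi_Xr.
Qed.

Lemma psi_teich_eps g (c e : OE) : val c != 0 -> redE D e = 0 ->
  c = a ^+ 2 - p%:R * (r h)%:R -> (exists d, a * p%:R = d * (c * e)) ->
  (exists d, a ^+ 3 = d * (c * e)) ->
  psi (\sum_(t : kF D) elt (g * gl_teich t)%g (eps D h r)) = 0.
Proof.
move=> c_neq0 red_e cE ap_ce a3_ce.
apply: etrans (to_thetabar_teich_eps p_gt2 r_ge_q r_mod a_neq0 va_lt1 g c_neq0 red_e cE
                 ap_ce a3_ce).
rewrite /teich_eps linear_sum raddf_sum; apply: eq_bigr => t _.
apply: etrans _ (psi_elt _ _); rewrite coefkbar_vmon // => j; apply: delta_le => i.
exact: leq_trans (expp_gt0 D f) (r_ge_q i).
Qed.

End NaturalSurjection.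

Section InducedMap.
Variables (p f : nat) (D : padic_setting p f) (r : 'I_f -> nat) (ap : E D).
Local Notation kb := (kbar D).
Local Notation Q := (repQ D r).
Local Notation top := (socfil Q f).
Local Notation rad := (socfil Q f.-1).
Variable psiQ : {linear ind Q -> Thetabar r ap}.

Lemma psiQ_Fil (x : ind (sub_rep top)) :
  psiQ (ind_map (sub_incl top) x) \in smem_pred (Fil psiQ f).
Proof.
apply/smem_predP; exists (ind_map (sub_incl top) x) => // g.
exact/smem_predP/(valP (ind_fun x g : submod top)).
Qed.

Definition toFil (x : ind (sub_rep top)) : submod (Fil psiQ f) :=
  Sub (psiQ (ind_map (sub_incl top) x)) (psiQ_Fil x).

Lemma toFil_linear : linear toFil.
Proof.
move=> a x y; apply/val_inj; rewrite /= -linearP; congr (psiQ _).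
exact: ind_map_sub_incl_linear.
Qed.

Lemma induced_surj_ex : exists2 pi : {linear ind (cosocQ D r) -> Ft psiQ},
  induced_surj pi & forall x, pi (ind_map (quot_proj _) x) = toFt (toFil x).
Proof.
have [fil filE] := linear_fun_ex toFil_linear.
have [g v rad_v|pi piE] := @ind_quot_factor p f D kb (sub_rep top) (res_sub top rad) (Ft psiQ)
    (qclass _ \o fil).
  apply/qclass_eq0; rewrite filE /= ind_map_elt.
  by exists (elt g (val (v : submod top))) => //; apply: elt_ind_in.
exists pi => x; last by rewrite piE /= filE.
by move=> y yE; rewrite piE /= filE; congr (qclass _ _); apply/val_inj; rewrite /= yE.
Qed.

End InducedMap.

(** * Hecke operator on weights *)

Section Cosets.
Variables (p f : nat) (D : padic_setting p f).
Local Notation OF := (intring (vF D)).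

Lemma mx2_det1 (a b c d : OF) : a * d - b * c = 1 ->
  exists2 k : GL2 OF, val k = mx2 a b c d & \det (val k) = 1.
Proof.
move=> det1; have k_unit : mx2 a b c d \in unitmx by rewrite unitmxE det_mx2 det1 unitr1.
by exists (Sub (mx2 a b c d) k_unit) => //; rewrite det_mx2.
Qed.

(* Lower unipotents permute the cosets occurring in T by the Moebius
   transformations c -> c / (1 + z c) of the projective line. *)
Lemma lgl_gl_teich c z : 1 + z * c != 0 -> exists k : GL2 OF,
  [/\ (KZelt 0 (lgl (teich z)) * gl_teich c = gl_teich (c / (1 + z * c))%R * KZelt 0 k)%g,
      \det (val k) = 1, resF D (val k 0 0) = 1 - c / (1 + z * c) * z &
      resF D (val k 1 0) = 0].
Proof.
move=> c_neq; set c' := c / _; set t := teich z; set u := teich c; set u' := teich c'.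
have [|w uE] := @resF_eq0_dvd _ _ D (u - u' * (1 + t * u)).
  by rewrite rmorphB rmorphM rmorphD rmorph1 rmorphM !res_teich divfK ?subrr.
have [|k kE det_k] := @mx2_det1 (1 - u' * t) w (t * p%:R) (1 + t * u).
  by rewrite mulrCA [w * p%:R]mulrC -uE; ring.
exists k; split=> //; last 2 first.
- by rewrite kE mxE rmorphB rmorph1 rmorphM !res_teich.
- by rewrite kE mxE rmorphM resF_p mulr0.
apply/val_inj/matrixP => i j; rewrite /= kE !expr0z !scale1r !mxE !sum2 !mxE /=.
have val_u : val u - val u' * (1 + val t * val u) = p%:R * val w.
  by rewrite -(val_intring_nat (vF D)); apply: (congr1 val uE).
by case: (i == 0); case: (j == 0); rewrite /= ?val_intring_nat -?val_u -/u -/u' /=; ring.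
Qed.

Lemma lgl_gl_alpha c z : 1 + z * c = 0 -> exists k : GL2 OF,
  [/\ (KZelt 0 (lgl (teich z)) * gl_teich c = gl_alpha D * KZelt 0 k)%g,
      \det (val k) = 1, resF D (val k 0 0) = 0 & resF D (val k 1 0) = z].
Proof.
move=> c0; set t := teich z; set u := teich c.
have [|w tuE] := @resF_eq0_dvd _ _ D (1 + t * u).
  by rewrite rmorphD rmorph1 rmorphM !res_teich.
have [|k kE det_k] := @mx2_det1 p%:R u t w.
  by rewrite -tuE; ring.
exists k; split=> //; last 2 first.
- by rewrite kE mxE resF_p.
- by rewrite kE mxE res_teich.
apply/val_inj/matrixP => i j; rewrite /= kE !expr0z !scale1r !mxE !sum2 !mxE /=.
have val_tu : 1 + val t * val u = p%:R * val w.
  by rewrite -(val_intring_nat (vF D)); apply: (congr1 val tuE).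
by case: (i == 0); case: (j == 0); rewrite /= ?val_intring_nat -?val_tu -/t -/u /=; ring.
Qed.

End Cosets.

Section HeckeWeight.
Variables (p f : nat) (D : padic_setting p f) (s : 'I_f -> nat) (m : nat).
Local Notation kb := (kbar D).
Local Notation sb := (structkbar D).
Local Notation W := (weight_rep sb s m).
Local Notation iota := (kF_kbar D).

Definition linpow (x y : kF D) : W :=
  linprod s (fun i => iota x ^+ (p ^ i)) (fun i => iota y ^+ (p ^ i)).

Lemma linpowZ c x y : linpow (c * x) (c * y) = iota c ^+ ofdigits p s *: linpow x y.
Proof.
rewrite -prodr_expr_ofdigits -[RHS](linprodZ s (fun i => iota c ^+ (p ^ i))).
by apply: eq_linprod => i; rewrite rmorphM exprMn.
Qed.

Lemma act_linpow k x y : \det (val k) = 1 ->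
  act k (linpow x y) =
  linpow (resF D (val k 0 0) * x + resF D (val k 0 1) * y)
         (resF D (val k 1 0) * x + resF D (val k 1 1) * y).
Proof.
move=> det1; rewrite /= /weight_act_fun det1 rmorph1 expr1n scale1r [LHS]psubst_linprod.
apply: eq_linprod => i; rewrite !conj_mxE -!kF_kbar_resF -!exprMn -!rmorphM;
by rewrite -(exprD_pchar_pow (kbar_pchar D)) -rmorphD.
Qed.

Lemma act_ugl_linpow t : act (ugl t) (linpow 1 0) = linpow 1 0.
Proof.
rewrite act_linpow; last by rewrite det_mx2 mulr1 mulr0 subr0.
by rewrite !mxE /= !mulr1 !mulr0 !addr0 rmorph1 rmorph0.
Qed.

Lemma act_lgl_linpow z : act (lgl (teich z)) (linpow 1 0) = linpow 1 z.
Proof.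
rewrite act_linpow; last by rewrite det_mx2 mulr1 mul0r subr0.
by rewrite !mxE /= !mulr1 !mulr0 !addr0 rmorph1 res_teich.
Qed.

Lemma linpow_act_zero k : (forall i, s i = 0%N) -> \det (val k) = 1 ->
  act k (linpow 1 0) = linpow 1 0.
Proof.
move=> s0 det1; rewrite act_linpow //; apply/val_inj => /=.
by apply: eq_bigr => i _; rewrite s0.
Qed.

Hypothesis s_lt : forall i, (s i < p)%N.

Lemma linpow1_span (S : submodule W) : (forall z, S (linpow 1 z)) -> forall v, S v.
Proof.
move=> S_linpow; apply: (polyV_ind (S := S)) => b b_le.
have b_lt i : (b i < p)%N := leq_ltn_trans (b_le i) (s_lt i).
have [k kE] := digits_ex b_lt; rewrite -kE.
apply: (@smemZ_inv _ _ _ (prod_bin kb s (digits k))).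
  by apply: prod_bin_unit (kbar_pchar D) _ => i; rewrite kE b_le s_lt.
apply: (mem_power_coef (iota := iota) (S := S)
  (x := fun k => prod_bin kb s (digits k) *: vmon kb s (digits k) : W)
  (ofdigits_digits_inj (p_gt1 D))) => [k'|z].
  by rewrite (card_kF D); apply: ofdigits_digits_ltn.
have linpowE : linpow 1 z = \sum_(k : {ffun 'I_f -> 'I_p})
    iota z ^+ ofdigits p (digits k) *: (prod_bin kb s (digits k) *: vmon kb s (digits k) : W).
  apply: etrans (linprod_digits _ s_lt).
  by apply: eq_linprod => // i; rewrite rmorph1 expr1n.
by have := S_linpow z; rewrite linpowE.
Qed.

Lemma psubst_teich_linpow c x y :
  psubst (hecke_teich_mx sb c) (linpow x y : polyV kb s) = linpow (x - c * y) 0.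
Proof.
rewrite psubst_linprod; apply: eq_linprod => i; rewrite !mxE /=; last first.
  by rewrite kbar_natp !mul0r addr0 rmorph0 expr0n gtn_eqF ?(expp_gt0 D).
rewrite rmorphB (exprD_pchar_pow (kbar_pchar D)) rmorphM mul1r.
by rewrite -exprMn mulNr.
Qed.

Lemma psubst_alpha_linpow x y :
  psubst (@hecke_alpha_mx p f kb) (linpow x y : polyV kb s) = linpow 0 y.
Proof.
rewrite psubst_linprod; apply: eq_linprod => i; rewrite !mxE /=.
  by rewrite kbar_natp !mul0r addr0 rmorph0 expr0n gtn_eqF ?(expp_gt0 D).
by rewrite mul0r add0r mul1r.
Qed.

Lemma hecke_linpow g x y : hecke_elt g (linpow x y) =
  \sum_c elt (g * gl_teich c)%g (linpow (x - c * y) 0) +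
  elt (g * gl_alpha D)%g (linpow 0 y).
Proof.
rewrite hecke_eltE psubst_alpha_linpow; congr (_ + _).
by apply: eq_bigr => c _; rewrite psubst_teich_linpow.
Qed.

Hypothesis s_gt0 : exists i, (0 < s i)%N.

Lemma linpow00 : linpow 0 0 = 0.
Proof.
have [i si_gt0] := s_gt0.
have -> : linpow 0 0 = linpow (0 * 0) (0 * 0) by rewrite mul0r.
by rewrite linpowZ rmorph0 expr0n gtn_eqF ?scale0r // (ofdigits_gt0 (p_gt1 D) si_gt0).
Qed.

Lemma hecke_linpow10 g :
  hecke_elt g (linpow 1 0) = \sum_c elt (g * gl_teich c)%g (linpow 1 0).
Proof.
rewrite hecke_linpow linpow00 linear0 addr0; apply: eq_bigr => c _.
by rewrite mulr0 subr0.
Qed.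

Lemma hecke_linpow1 g z :
  hecke_elt g (linpow 1 z) = hecke_elt (g * KZelt 0 (lgl (teich z)))%g (linpow 1 0).
Proof.
rewrite hecke_linpow hecke_linpow10 [RHS](bigID (fun c => 1 + z * c != 0)) /=.
congr (_ + _).
  rewrite (bigID (fun c => 1 - z * c != 0)) /= [X in _ + X]big1 ?addr0 => [|c]; last first.
    by rewrite negbK mulrC => /eqP ->; rewrite linpow00 linear0.
  rewrite sum_mobius_finField; apply: eq_bigr => c c_neq.
  have [k [kE det_k k00 k10]] := lgl_gl_teich c_neq.
  by rewrite -[in RHS]mulgA kE mulgA elt_KZ act_linpow // k00 k10 !mulr0 !addr0 mulr1 mul0r.
have [->|z_neq0] := eqVneq z 0.
  by rewrite linpow00 linear0 big_pred0 // => c; rewrite mul0r addr0 oner_eq0.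
rewrite (big_pred1 (- z^-1)) => [|c]; last first.
  by rewrite negbK -[RHS](inj_eq (mulfI z_neq0)) mulrN divff // -[RHS]subr_eq0 opprK addrC.
have [|k [kE det_k k00 k10]] := @lgl_gl_alpha p f D (- z^-1) z.
  by rewrite mulrN divff // subrr.
by rewrite -[in RHS]mulgA kE mulgA elt_KZ act_linpow // k00 k10 !mulr0 !addr0 !mulr1.
Qed.

End HeckeWeight.

(** * Vanishing on the image of T *)

Section CosocleHecke.
Variables (p f : nat) (D : padic_setting p f) (r : 'I_f -> nat) (ap : E D) (h : 'I_f).
Local Notation sb := (structkbar D).
Local Notation G := (GL2 (F D)).
Local Notation V := (Vrep sb r).
Local Notation Q := (repQ D r).
Local Notation top := (socfil Q f).
Local Notation rad := (socfil Q f.-1).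
Local Notation toCosoc := (qclass (res_sub top rad)).
Hypothesis p_gt2 : (2 < p)%N.
Hypothesis r_ge_q : forall i, (p ^ f <= r i)%N.
Hypothesis r_mod : ofdigits p r = p ^ h %[mod p ^ f - 1].
Variable psiQ : {linear ind Q -> Thetabar r ap}.
Hypothesis psiQ_eps : forall g : G,
  psiQ (\sum_(t : kF D) elt (g * gl_teich t)%g (cls (eps D h r))) = 0.
Variable pi : {linear ind (cosocQ D r) -> Ft psiQ}.
Hypothesis piE : forall x, pi (ind_map (quot_proj _) x) = toFt (toFil psiQ x).

Lemma pi_teich_sum g (w : sub_rep top) c :
  rad (val (w : submod top) - c *: cls (eps D h r)) ->
  pi (\sum_(t : kF D) elt (g * gl_teich t)%g (toCosoc w : cosocQ D r)) = 0.
Proof.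
set n : Q := _ - _ => rad_n.
have -> : \sum_(t : kF D) elt (g * gl_teich t)%g (toCosoc w : cosocQ D r) =
    ind_map (quot_proj _) (\sum_(t : kF D) elt (g * gl_teich t)%g w).
  exact/esym/(ind_map_sum_elt (quot_proj _)).
rewrite piE; apply/qclass_eq0; exists (\sum_t elt (g * gl_teich t)%g n).
  by move=> g'; rewrite ind_fun_sum; apply: smem_sum => t _; apply: elt_ind_in.
rewrite -[RHS]/(psiQ (ind_map (sub_incl top) (\sum_t elt (g * gl_teich t)%g w))).
rewrite ind_map_sum_elt.
have -> : \sum_t elt (g * gl_teich t)%g (sub_incl top w) =
    c *: (\sum_t elt (g * gl_teich t)%g (cls (eps D h r))) + \sum_t elt (g * gl_teich t)%g n.
  rewrite scaler_sumr -big_split; apply: eq_bigr => t _.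
  by rewrite -[RHS]elt_linear; congr (elt _ _); rewrite /n addrC subrK.
by rewrite linearP psiQ_eps scaler0 add0r.
Qed.

Section Weight.
Variables (s : 'I_f -> nat) (m : nat).
Local Notation W := (weight_rep sb s m).
Variable iota : equivar W (cosocQ D r).
Hypothesis s_lt : forall i, (s i < p)%N.
Hypothesis iotaZ : forall a v, iota (a *: v) = a *: iota v.
Local Notation top_vector := (linpow s m 1 0).

Lemma iota_linear : linear iota.
Proof. by move=> a u v; rewrite raddfD iotaZ. Qed.

Lemma iota_eq0 : iota top_vector = 0 -> forall v, iota v = 0.
Proof.
move=> iota0; have [u uE] := linear_fun_ex iota_linear.
suff ker_u v : lin_ker u v by move=> v; rewrite -uE; apply: ker_u.
apply: (linpow1_span s_lt) => z; rewrite -act_lgl_linpow -[lin_ker _ _]/(u _ = 0).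
by rewrite uE equivar_act iota0 linear0.
Qed.

Lemma iota_lift_ex : exists (w : sub_rep top) (x : V),
  [/\ toCosoc w = iota top_vector, val (w : submod top) = cls x &
      forall k, act k top_vector = top_vector -> rad (cls (act k x) - cls x)].
Proof.
have [w wE] : exists w, toCosoc w = iota top_vector.
  by exists (repr (iota top_vector)); apply: qclass_repr.
have [x xE] := cls_surj (val (w : submod top)); exists w, x; split=> // k fix_k.
have /qclass_eq : toCosoc (act k w) = toCosoc w.
  by rewrite qclass_act wE -equivar_act fix_k.
by rewrite cls_act xE.
Qed.

Lemma iota_eq0_or_eps : (forall v, iota v = 0) \/
  (exists i, (0 < s i)%N) /\
  exists (w : sub_rep top) c, toCosoc w = iota top_vector /\
    rad (val (w : submod top) - c *: cls (eps D h r)).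
Proof.
have [w [x [wE xE x_inv]]] := iota_lift_ex.
have iota0 : rad (cls x) -> forall v, iota v = 0.
  move=> rad_x; apply: iota_eq0; rewrite -wE; apply/qclass_eq0.
  by rewrite -[res_sub _ _ _]/(rad (val (w : submod top))) xE.
have x_ugl z : rad (cls (act (ugl (teich z)) x) - cls x).
  by apply: x_inv; apply: act_ugl_linpow.
have [all_rad|[c rad_c]] := cosoc_ugl_invariant p_gt2 r_ge_q r_mod x_ugl.
  by left; apply/iota0/all_rad.
have [s_gt0|s0] := pselect (exists i, (0 < s i)%N); last first.
  left; apply/iota0/(cosoc_invariant p_gt2 r_ge_q r_mod x_ugl) => z.
  apply: x_inv; apply: linpow_act_zero; last by rewrite det_mx2 mulr1 mul0r subr0.
  by move=> i; apply/eqP; rewrite -leqn0 leqNgt; apply/negP => si; apply: s0; exists i.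
by right; split=> //; exists w, c; rewrite xE.
Qed.

Lemma pi_hecke_eq0 g v : pi (ind_map iota (hecke_elt g v)) = 0.
Proof.
have [iota0|[s_gt0 [w [c [wE rad_w]]]]] := iota_eq0_or_eps.
  have -> : ind_map iota (hecke_elt g v) = 0 by apply: ind_eq => g'; apply: iota0.
  exact: linear0.
have [u uE] := linear_fun_ex (ind_map_linear iota_linear).
apply: etrans (_ : pi (u (hecke_elt g v)) = _); first by rewrite uE.
apply: (linpow1_span s_lt (S := lin_ker (pi \o (u \o hecke_elt g)))) => z.
rewrite -[lin_ker _ _]/(pi (u (hecke_elt g (linpow s m 1 z))) = 0).
rewrite uE hecke_linpow1 // hecke_linpow10 // ind_map_sum_elt -wE.
exact: pi_teich_sum rad_w.
Qed.

End Weight.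

Lemma hecke_image_vanish y : hecke_image (cosocQ D r) y -> pi y = 0.
Proof.
move=> Ty; apply: (Ty (lin_ker pi)).
move=> _ [s [m [iota [x [Tx [s_lt iotaZ [l [_ ->]] ->]]]]]].
rewrite -[lin_ker _ _]/(pi _ = 0) raddf_sum linear_sum big1 // => gv _.
exact: pi_hecke_eq0.
Qed.

End CosocleHecke.

Theorem theorem8p3 (p f : nat) (D : padic_setting p f) (k : 'I_f -> nat)
    (h : 'I_f) (ap : E D) :
  let r := fun i : 'I_f => (k i - 2)%N in
  (2 < p)%N -> (1 <= f)%N ->
  (forall i, (p ^ f + p - 2 < r i)%N) ->
  (\sum_(i < f) r i * p ^ i = p ^ h %[mod p ^ f - 1])%N ->
  ap != 0 -> 0 < vE D ap -> vE D ap < 1 ->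
  vE D ap <> 2^-1 \/
    (vE D ap = 2^-1 /\
     padic_unit (vE D) ((ap ^+ 2 - p%:R * (r h)%:R) / p%:R)) ->
  exists (psi : {linear ind (Vrep (structkbar D) r) -> Thetabar r ap})
         (psiQ : {linear ind (repQ D r) -> Thetabar r ap})
         (pi : {linear ind (cosocQ D r) -> Ft psiQ}),
    [/\ natural_surj psi,
        forall x, psiQ (ind_map (projQ D r) x) = psi x,
        induced_surj pi
      & forall y, hecke_image (cosocQ D r) y -> pi y = 0].
Proof.
move=> r p_gt2 f_gt0 r_gt r_mod ap_neq0 v_gt0 v_lt1 ap_discr.
have r_ge_q i : (p ^ f <= r i)%N by have := r_gt i; lia.
have [a aE _] := maximal_ideal_ex ap_neq0 v_gt0; case: ap / aE in ap_neq0 v_gt0 v_lt1 ap_discr *.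
have [psi psi_natural] := natural_surj_ex r (val a).
have psi_ker := psi_add_sub psi_natural p_gt2 r_ge_q r_mod ap_neq0 v_gt0 v_lt1.
have [psiQ psiQE] := ind_quot_factor psi_ker.
have [pi pi_induced piE] := induced_surj_ex psiQ.
exists psi, psiQ, pi; split=> // y.
apply: (hecke_image_vanish p_gt2 r_ge_q r_mod) => // g.
have rh_gt0 : (0 < r h)%N := leq_ltn_trans (leq0n _) (r_gt h).
have [c [e [c_neq0 red_e cE ap_ce a3_ce]]] :=
  discriminant_factor_ex rh_gt0 ap_neq0 v_gt0 v_lt1 ap_discr.
rewrite -(psi_teich_eps psi_natural p_gt2 r_ge_q r_mod ap_neq0 v_lt1 g c_neq0 red_e cE) //.
by rewrite -psiQE ind_map_sum_elt.
Qed.
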